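(* Let $m\in\frac32+\mathbb Z_{\ge0}$ and $j,k\in\mathbb Z_{\ge0}$. Then the function $(n^+)^j.F_{k,m}$ is a (unique up to a multiplicative constant) $K$-finite matrix coefficient of $\overline{\pi_m}$ that transforms on the right as $\chi_{m+2j}$ and on the left as $\chi_{m+2k}$. Its complex conjugate $(n^-)^j.\overline{F_{k,m}}$ is a (unique up to a multiplicative constant) $K$-finite matrix coefficient of $\pi_m$ that transforms on the right as $\chi_{-m-2j}$ and on the left as $\chi_{-m-2k}$.
   Context: Let $\mathcal H=\{z\in\mathbb C:\Im z>0\}$, let $\mathrm{Hol}(\mathcal H)$ be the space of holomorphic functions on $\mathcal H$, let $g.z=\frac{az+b}{cz+d}$ and $j(g,z)=cz+d$ for $g=\begin{pmatrix}a&b\\c&d\end{pmatrix}$, and let $dv_{\mathcal H}(x+iy)=\frac{dx\,dy}{y^2}$. The square root $\sqrt{\cdot}$ is the branch with values in $\{\Re>0\}\cup\{\Re=0,\Im\ge0\}$, and $z^m:=(\sqrt z)^{2m}$ for half-integral $m$. The metaplectic group is $\mathrm{SL}_2(\mathbb R)^\sim=\{\sigma=(g_\sigma,\eta_\sigma)\in\mathrm{SL}_2(\mathbb R)\times\mathrm{Hol}(\mathcal H):\eta_\sigma(z)^2=j(g_\sigma,z)\ \forall z\in\mathcal H\}$ with multiplication $\sigma_1\sigma_2=(g_{\sigma_1}g_{\sigma_2},\ \eta_{\sigma_1}(g_{\sigma_2}.z)\eta_{\sigma_2}(z))$. An element $\sigma$ is determined by $(g_\sigma,\eta_\sigma(i))$,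 and we write $\sigma\equiv(g_\sigma,\eta_\sigma(i))$. Put $n_x=\left(\begin{pmatrix}1&x\\0&1\end{pmatrix},1\right)$, $a_y=\left(\begin{pmatrix}y^{1/2}&0\\0&y^{-1/2}\end{pmatrix},y^{-1/4}\right)$, $\kappa_t=\left(\begin{pmatrix}\cos t&-\sin t\\\sin t&\cos t\end{pmatrix},e^{it/2}\right)$. The Lie group structure is the one for which $(x,y,t)\mapsto n_xa_y\kappa_t$, $\mathbb R\times\mathbb R_{>0}\times\mathbb R\to\mathrm{SL}_2(\mathbb R)^\sim$, is a local diffeomorphism; $\pi_1(\sigma)=g_\sigma$ is then a double cover of $\mathrm{SL}_2(\mathbb R)$. $K=\{\kappa_t:t\in\mathbb R\}$ is a maximal compact subgroup, with characters $\chi_n(\kappa_t)=e^{-int}$, $n\in\frac12\mathbb Z$. A function $F:\mathrm{SL}_2(\mathbb R)^\sim\to\mathbb C$ transforms on the right (resp., left) as $\chi_n$ if $F(\sigma\kappa)=\chi_n(\kappa)F(\sigma)$ (resp., $F(\kappa\sigma)=\chi_n(\kappa)F(\sigma)$) for all $\kappa\in K$, $\sigma\in\mathrm{SL}_2(\mathbb R)^\sim$. The Lie algebra $\mathfrak g$ of $\mathrm{SL}_2(\mathbb R)^\sim$ is identified with $\mathfrak{sl}_2(\mathbb R)$ via the differential of $\pi_1$; elements of $U(\mathfrak g_{\mathbb C})=U(\mathfrak{sl}_2(\mathbb C))$ act on smooth functions on $\mathrm{SL}_2(\mathbb R)^\sim$ as left-invariant differential operators ($(X.F)(\sigma)=\frac{d}{ds}|_{s=0}F(\sigma\exp(sX))$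 for $X\in\mathfrak g$). $n^+=\frac12\begin{pmatrix}1&i\\i&-1\end{pmatrix}$, $n^-=\frac12\begin{pmatrix}1&-i\\-i&-1\end{pmatrix}$. For $m\in\frac32+\mathbb Z_{\ge0}$, $(\pi_m,H_m)$ is the unitary representation on the Hilbert space of holomorphic $f:\mathcal H\to\mathbb C$ with $\int_{\mathcal H}|f(z)|^2\Im(z)^m\,dv_{\mathcal H}(z)<\infty$ (with the corresponding inner product), given by $(\pi_m(\sigma^{-1})f)(z)=f(g_\sigma.z)\,\eta_\sigma(z)^{-2m}$; $(\overline{\pi_m},\overline{H_m})$ is defined in the same way with antiholomorphic functions in place of holomorphic ones and $\overline{\eta_\sigma(z)}$ in place of $\eta_\sigma(z)$. A $K$-finite matrix coefficient of a unitary representation $(\pi,H)$ is a function $\sigma\mapsto\langle\pi(\sigma)v,w\rangle_H$ with $v,w\in H$ $K$-finite. For $k\in\mathbb Z_{\ge0}$, $f_{k,m}(z)=(2i)^m\frac{(z-i)^k}{(z+i)^{m+k}}$ for $z\in\mathcal H$, and $F_{k,m}(\sigma)=f_{k,m}(g_\sigma.i)\,\eta_\sigma(i)^{-2m}$ for $\sigma\in\mathrm{SL}_2(\mathbb R)^\sim$. *)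

(* Defs.v *)
From HB Require Import structures.
From mathcomp Require Import all_boot all_order all_algebra.
From mathcomp Require Import all_classical all_reals all_analysis.
From mathcomp.real_closed Require Import complex.
From mathcomp Require Import ring lra.

Set Implicit Arguments.
Unset Strict Implicit.
Unset Printing Implicit Defensive.

Import Order.TTheory GRing.Theory Num.Theory.
Import numFieldNormedType.Exports.

Local Open Scope classical_set_scope.
Local Open Scope ring_scope.
Local Open Scope complex_scope.

(* The topology and the normed-module structure over itself of the complex    *)
(* field [R[i]] are carried by its alias [R[i]^o].                            *)

Definition mx2 (T : Type) (a b c d : T) : 'M[T]_2 :=
  \matrix_(i, j) if i == 0 then (if j == 0 then a else b)
                           else (if j == 0 then c else d).

Section UpperHalfPlane.
Variable R : realType.

Record uhp := UHP { uhp_val :> R[i]; uhp_im : 0 < complex.Im uhp_val }.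
HB.instance Definition _ := [isSub for uhp_val].

Lemma uhp_i_im : 0 < complex.Im ('i%C : R[i]).
Proof. exact: ltr01. Qed.
Definition uhp_i : uhp := UHP uhp_i_im.

Definition ext0 (V : nmodType) (f : uhp -> V) (z : R[i]) : V :=
  oapp f 0 (insub z).

Definition holomorphic (f : uhp -> R[i]) : Prop :=
  forall z : uhp, derivable (ext0 f : R[i]^o -> R[i]^o) (z : R[i]) 1.

Definition antiholomorphic (f : uhp -> R[i]) : Prop :=
  holomorphic (fun z => (f z)^*%C).

Lemma ext0E (V : nmodType) (f : uhp -> V) (z : uhp) : ext0 f z = f z.
Proof. by rewrite /ext0 valK. Qed.

Lemma normc_ge_Im (x : R[i]) : `|complex.Im x|%:C <= `|x|.
Proof.
case: x => a b; rewrite normc_def /= lecR -sqrtr_sqr ler_wsqrtr //.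
by rewrite lerDr sqr_ge0.
Qed.

Lemma near_uhp (z : uhp) : \forall w \near ((z : R[i]) : R[i]^o), 0 < complex.Im w.
Proof.
apply/nbhs_ballP; exists (complex.Im z)%:C => /=.
  by rewrite ltcR (uhp_im z).
move=> w; rewrite /ball /= => zw.
have := le_lt_trans (normc_ge_Im ((z : R[i]) - w)) zw; rewrite ltcR.
rewrite raddfB /= => h.
have := le_lt_trans (ler_norm _) h; lra.
Qed.

Lemma holomorphicP (f : uhp -> R[i]) (g : R[i] -> R[i]) (z : uhp) :
  (forall w : uhp, f w = g w) ->
  derivable (g : R[i]^o -> R[i]^o) (z : R[i]) 1 ->
  derivable (ext0 f : R[i]^o -> R[i]^o) (z : R[i]) 1.
Proof.
move=> fg; apply: near_eq_derivable.
by near=> w; rewrite /ext0; case: insubP => [u _ <-|/negP[]] //=; near: w; exact: near_uhp.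
Unshelve. all: by end_near. Qed.

End UpperHalfPlane.

Section SL2.
Variable R : realType.
Notation uhp := (uhp R).
Implicit Types (z : uhp).

Record SL2 := MkSL2 { sl2_mx :> 'M[R]_2; sl2_det : \det sl2_mx = 1 }.

Definition jfac (g : SL2) (z : R[i]) : R[i] := (g 1 0)%:C * z + (g 1 1)%:C.
Definition anum (g : SL2) (z : R[i]) : R[i] := (g 0 0)%:C * z + (g 0 1)%:C.

Lemma sl2_detE (g : SL2) : g 0 0 * g 1 1 - g 0 1 * g 1 0 = 1.
Proof.
rewrite -(sl2_det g) (expand_det_row _ 0) !big_ord_recl big_ord0 addr0.
rewrite /cofactor !det_mx11 !mxE /= expr0 expr1 mul1r mulN1r mulrN.
by congr (g _ _ * g _ _ - g _ _ * g _ _); apply/val_inj.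
Qed.

Lemma im_jfac (g : SL2) z : complex.Im (jfac g z) = g 1 0 * complex.Im z.
Proof. by case: z => -[x y] hy; rewrite /jfac /=; ring. Qed.

Lemma jfac_neq0 (g : SL2) z : jfac g z != 0.
Proof.
apply/negP => /eqP h; have := congr1 (@complex.Im _) h.
rewrite im_jfac /= => /eqP; rewrite mulf_eq0 (gt_eqF (uhp_im z)) orbF => /eqP c0.
move: h; rewrite /jfac c0 mul0r add0r => -[d0].
by have /eqP := sl2_detE g; rewrite c0 d0 !mulr0 subrr eq_sym oner_eq0.
Qed.

Lemma moebius_im (g : SL2) z : 0 < complex.Im (anum g z / jfac g z).
Proof.
have := jfac_neq0 g z; case: z => -[x y] hy /=; rewrite /jfac /anum.
set a := g 0 0; set b := g 0 1; set c := g 1 0; set d := g 1 1 => nz.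
have N0 : 0 < (c * x + d) ^+ 2 + (c * y) ^+ 2.
  rewrite lt0r addr_ge0 ?sqr_ge0 // andbT; apply: contra nz.
  rewrite paddr_eq0 ?sqr_ge0 // !sqrf_eq0 => /andP[/eqP u /eqP v].
  by apply/eqP; simpc; rewrite u v.
have E : a * d - b * c = 1 by exact: sl2_detE.
suff e : complex.Im ((a%:C * (x +i* y) + b%:C) / (c%:C * (x +i* y) + d%:C)) =
  y / ((c * x + d) ^+ 2 + (c * y) ^+ 2).
  by move: e => /= ->; rewrite divr_gt0.
have N1 := lt0r_neq0 N0.
transitivity ((a * d - b * c) * y / ((c * x + d) ^+ 2 + (c * y) ^+ 2)).
  by simpc; rewrite /=; field.
by rewrite E mul1r.
Qed.

Definition moebius (g : SL2) z : uhp := UHP (moebius_im g z).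

Lemma sl2_mul_det (g h : SL2) : \det (sl2_mx g *m sl2_mx h) = 1.
Proof. by rewrite det_mulmx !sl2_det mulr1. Qed.
Definition sl2_mul (g h : SL2) : SL2 := MkSL2 (sl2_mul_det g h).

Definition sl2_one : SL2 := MkSL2 (det1 R 2).

Lemma sl2_inv_det (g : SL2) : \det (invmx g) = 1.
Proof. by rewrite det_inv sl2_det invr1. Qed.
Definition sl2_inv (g : SL2) : SL2 := MkSL2 (sl2_inv_det g).

Lemma sl2_inj (g h : SL2) : sl2_mx g = sl2_mx h -> g = h.
Proof.
case: g h => [g dg] [h dh] /= e; subst h.
by rewrite (Prop_irrelevance dg dh).
Qed.

Lemma sl2_mulE (g h : SL2) i j : sl2_mul g h i j = g i 0 * h 0 j + g i 1 * h 1 j.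
Proof.
rewrite mxE !big_ord_recl big_ord0 addr0.
by congr (g _ _ * h _ _ + g _ _ * h _ _); apply/val_inj.
Qed.

Lemma sl2_mulV (g : SL2) : sl2_mul g (sl2_inv g) = sl2_one.
Proof. by apply: sl2_inj; rewrite /= mulmxV // unitmxE sl2_det unitr1. Qed.

Lemma sl2_Vmul (g : SL2) : sl2_mul (sl2_inv g) g = sl2_one.
Proof. by apply: sl2_inj; rewrite /= mulVmx // unitmxE sl2_det unitr1. Qed.

Lemma jfac_mul (g h : SL2) z :
  jfac (sl2_mul g h) z = jfac g (moebius h z) * jfac h z.
Proof.
have := jfac_neq0 h z; rewrite {2}/jfac /= /jfac !sl2_mulE /anum => nz.
by rewrite !rmorphD !rmorphM /=; field.
Qed.

Lemma moebius_mul (g h : SL2) z :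
  moebius (sl2_mul g h) z = moebius g (moebius h z).
Proof.
apply: val_inj => /=; rewrite jfac_mul /=.
have nz := jfac_neq0 h z.
have -> : anum (sl2_mul g h) z = anum g (moebius h z) * jfac h z.
  rewrite [in RHS]/anum /=; move: nz; rewrite /jfac /anum !sl2_mulE => nz.
  by rewrite !rmorphD !rmorphM /=; field.
by rewrite -mulf_div divff // mulr1.
Qed.

Lemma jfac1 (z : R[i]) : jfac sl2_one z = 1.
Proof. by rewrite /jfac !mxE /= mul0r add0r. Qed.

Lemma moebius1 z : moebius sl2_one z = z.
Proof. by apply: val_inj; rewrite /= jfac1 /anum !mxE /= mul1r addr0 divr1. Qed.

End SL2.

Lemma derivable_sqrt_branch (K : numFieldType) (s : K -> K) (z c : K) :
  0 < c -> (forall w, s w ^+ 2 = w) -> (forall w, s w + s z != 0) ->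
  (forall w, `|s w - s z| <= `|w - z| / c) ->
  derivable (s : K^o -> K^o) z 1.
Proof.
move=> c0 ss sn0 lip.
have cs : {for z, continuous s}.
  apply/(@cvgrPdist_le K K K (nbhs z) _ s (s z)) => e e0.
  apply/nbhs_ballP; exists (e * c) => /=; first by rewrite mulr_gt0.
  move=> w; rewrite /ball /= => zw.
  rewrite distrC; apply: le_trans (lip w) _.
  by rewrite ler_pdivrMr // distrC ltW.
apply/cvg_ex; exists ((s z + s z)^-1).
have : (s (h + z) + s z)^-1 @[h --> (0 : K)^'] --> (s z + s z)^-1.
  apply: cvgV; first exact: sn0.
  apply: cvgD; last exact: cvg_cst.
  apply: (@cvg_comp _ _ _ (fun h => h + z) s _ (nbhs z)); last exact: cs.
  have : h + z @[h --> (0 : K)^'] --> 0 + z.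
    by apply: cvgD; [exact: cvg_within|exact: cvg_cst].
  by rewrite add0r.
apply: cvg_trans; apply: near_eq_cvg.
near=> h => /=.
have h0 : h != 0 by near: h; exact: nbhs_dnbhs_neq.
rewrite /GRing.scale /= mulr1.
have := subr_sqr (s (h + z)) (s z); rewrite !ss addrK => E.
apply: (mulfI h0); rewrite mulrA mulfV // mul1r {1}E mulfK //.
Unshelve. all: by end_near. Qed.

Section HolomorphicOps.
Variable R : realType.
Implicit Types (z : uhp R) (g : SL2 R).

Lemma derivable_jfac (g : SL2 R) (z : R[i]) :
  derivable (jfac g : R[i]^o -> R[i]^o) z 1.
Proof.
apply: derivableD; last exact: derivable_cst.
by apply: derivableM; [exact: derivable_cst|exact: derivable_id].
Qed.

Lemma derivable_anum (g : SL2 R) (z : R[i]) :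
  derivable (anum g : R[i]^o -> R[i]^o) z 1.
Proof.
apply: derivableD; last exact: derivable_cst.
by apply: derivableM; [exact: derivable_cst|exact: derivable_id].
Qed.

Lemma derivable_moebius g z :
  derivable ((fun w => anum g w / jfac g w) : R[i]^o -> R[i]^o) (z : R[i]) 1.
Proof.
apply: derivableM; first exact: derivable_anum.
by apply: derivableV; [exact: jfac_neq0|exact: derivable_jfac].
Qed.

Lemma holomorphicM (f h : uhp R -> R[i]) :
  holomorphic f -> holomorphic h -> holomorphic (fun z => f z * h z).
Proof.
move=> hf hh z.
apply: (@holomorphicP _ _ (fun w => ext0 f w * ext0 h w)).
  by move=> w; rewrite !ext0E.
by apply: derivableM; [exact: hf|exact: hh].
Qed.

Lemma holomorphicV (f : uhp R -> R[i]) : (forall z, f z != 0) ->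
  holomorphic f -> holomorphic (fun z => (f z)^-1).
Proof.
move=> f0 hf z; apply: (@holomorphicP _ _ (fun w => (ext0 f w)^-1)).
  by move=> w; rewrite !ext0E.
by apply: derivableV; [rewrite ext0E|exact: hf].
Qed.

Lemma holomorphic_moebius (f : uhp R -> R[i]) g :
  holomorphic f -> holomorphic (fun z => f (moebius g z)).
Proof.
move=> hf z.
apply: (@holomorphicP _ _ (ext0 f \o (fun w => anum g w / jfac g w))).
  by move=> w /=; rewrite -(ext0E f (moebius g w)).
have /derivable1_diffP d1 := @derivable_moebius g z.
have /derivable1_diffP d2 := hf (moebius g z).
exact/derivable1_diffP/(differentiable_comp d1 d2).
Qed.

Lemma holomorphic_cst (a : R[i]) : holomorphic (fun _ : uhp R => a).
Proof.
by move=> z; apply: (@holomorphicP _ _ (fun _ => a)) => //; exact: derivable_cst.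
Qed.

Lemma Re_sqrtc_ge0 (x : R[i]) : 0 <= complex.Re (sqrtc x).
Proof. by case: x => a b; rewrite /sqrtc /= sqrtr_ge0. Qed.

Lemma Re_sqrtc_gt0 (x : R[i]) :
  (complex.Im x != 0) || (0 < complex.Re x) -> 0 < complex.Re (sqrtc x).
Proof.
case: x => a b /=; rewrite /sqrtc /= => h.
rewrite sqrtr_gt0 divr_gt0 //.
case: (ltP 0 a) => [a0|a0]; first by rewrite ltr_wpDl // sqrtr_ge0.
move: h; rewrite ltNge a0 orbF => b0.
rewrite -ltrBlDr sub0r -[X in X < _]ger0_norm ?oppr_ge0 // normrN -sqrtr_sqr.
rewrite ltr_sqrt ?ltrDl; first by rewrite exprn_even_gt0.
by rewrite ltr_wpDl ?sqr_ge0 // exprn_even_gt0.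
Qed.

Lemma derivable_sqrtc (z : R[i]) :
  (complex.Im z != 0) || (0 < complex.Re z) ->
  derivable (@sqrtc R : R[i]^o -> R[i]^o) z 1.
Proof.
move=> hz; have r0 := Re_sqrtc_gt0 hz.
have sn0 (w : R[i]) : sqrtc w + sqrtc z != 0.
  apply/negP => /eqP h; have := congr1 (@complex.Re _) h; rewrite raddfD /=.
  have := Re_sqrtc_ge0 w => ? ?; lra.
have lip (w : R[i]) : `|sqrtc w - sqrtc z| <= `|w - z| / (complex.Re (sqrtc z))%:C.
  rewrite ler_pdivlMr ?ltcR //.
  have -> : w - z = (sqrtc w - sqrtc z) * (sqrtc w + sqrtc z).
    by rewrite -subr_sqr !sqr_sqrtc.
  rewrite normrM ler_wpM2l //.
  apply: le_trans (normc_ge_Re (sqrtc w + sqrtc z)).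
  rewrite lecR raddfD /=; apply: le_trans (ler_norm _).
  by rewrite lerDr Re_sqrtc_ge0.
apply: (@derivable_sqrt_branch _ _ _ (complex.Re (sqrtc z))%:C) => //.
  by rewrite ltcR.
exact: sqr_sqrtc.
Qed.

End HolomorphicOps.

Section Metaplectic.
Variable R : realType.
Notation uhp := (uhp R).
Implicit Types (z : uhp).

Record Mp := MkMp {
  mp_g : SL2 R;
  mp_eta : uhp -> R[i];
  mp_holo : holomorphic mp_eta;
  mp_sqr : forall z, mp_eta z ^+ 2 = jfac mp_g z }.

Lemma mp_inj (s t : Mp) : mp_g s = mp_g t -> mp_eta s =1 mp_eta t -> s = t.
Proof.
case: s t => [g e he se] [h f hf sf] /= gh /funext ef; subst h f.
by rewrite (Prop_irrelevance he hf) (Prop_irrelevance se sf).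
Qed.

Lemma mp_eta_neq0 (s : Mp) z : mp_eta s z != 0.
Proof. by rewrite -sqrf_eq0 mp_sqr jfac_neq0. Qed.

Definition mp_act (s : Mp) (z : uhp) : uhp := moebius (mp_g s) z.

Fact mp_mul_sqr (s t : Mp) z :
  (mp_eta s (mp_act t z) * mp_eta t z) ^+ 2 = jfac (sl2_mul (mp_g s) (mp_g t)) z.
Proof. by rewrite exprMn !mp_sqr jfac_mul. Qed.

Definition mp_mul (s t : Mp) : Mp :=
  MkMp (@holomorphicM _ _ _ (@holomorphic_moebius _ _ (mp_g t) (@mp_holo s)) (@mp_holo t))
       (mp_mul_sqr s t).

Fact mp_one_sqr z : 1 ^+ 2 = jfac (sl2_one R) z.
Proof. by rewrite jfac1 expr1n. Qed.

Definition mp_one : Mp := MkMp (@holomorphic_cst _ 1) mp_one_sqr.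

Fact mp_inv_sqr (s : Mp) z :
  (mp_eta s (moebius (sl2_inv (mp_g s)) z))^-1 ^+ 2 = jfac (sl2_inv (mp_g s)) z.
Proof.
rewrite exprVn mp_sqr; set w := moebius _ z.
have w0 := jfac_neq0 (mp_g s) w.
by apply: (mulfI w0); rewrite mulfV // -jfac_mul sl2_mulV jfac1.
Qed.

Definition mp_inv (s : Mp) : Mp :=
  MkMp (@holomorphicV _ _ (fun z => mp_eta_neq0 s (moebius _ z))
         (@holomorphic_moebius _ _ (sl2_inv (mp_g s)) (@mp_holo s)))
       (mp_inv_sqr s).

Fact mp_mulA : associative mp_mul.
Proof.
move=> s t u; apply: mp_inj => [|z] /=.
  by apply: sl2_inj; rewrite /= mulmxA.
by rewrite /mp_act moebius_mul mulrA.
Qed.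

Fact mp_mul1 : left_id mp_one mp_mul.
Proof.
move=> s; apply: mp_inj => [|z] /=; last by rewrite mul1r.
by apply: sl2_inj; rewrite /= mul1mx.
Qed.

Fact mp_mulr1 : right_id mp_one mp_mul.
Proof.
move=> s; apply: mp_inj => [|z] /=; last by rewrite /mp_act moebius1 mulr1.
by apply: sl2_inj; rewrite /= mulmx1.
Qed.

Fact mp_mulV : left_inverse mp_one mp_inv mp_mul.
Proof.
move=> s; apply: mp_inj => [|z] /=; first exact: sl2_Vmul.
by rewrite /mp_act -moebius_mul sl2_Vmul moebius1 mulVf // mp_eta_neq0.
Qed.

Fact mp_mulrV : right_inverse mp_one mp_inv mp_mul.
Proof.
move=> s; apply: mp_inj => [|z] /=; first exact: sl2_mulV.
by rewrite /mp_act mulfV // mp_eta_neq0.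
Qed.

HB.instance Definition _ := gen_eqMixin Mp.
HB.instance Definition _ := gen_choiceMixin Mp.
HB.instance Definition _ :=
  isGroup.Build Mp mp_mulA mp_mul1 mp_mulr1 mp_mulV mp_mulrV.

(* The ratio [j(g,z) / j(g,i)] avoids the half-line of nonpositive reals, so  *)
(* [mp_of_eta g w] below is the holomorphic square root of [j(g,z)] that      *)
(* takes the value [w] at [i].                                                *)
Fact jfac_ratio_slit (g : SL2 R) z :
  (complex.Im (jfac g z / jfac g 'i%C) != 0) || (0 < complex.Re (jfac g z / jfac g 'i%C)).
Proof.
have := sl2_detE g; case: z => -[x y] hy /=; rewrite /jfac /=.
set a := g 0 0; set b := g 0 1; set c := g 1 0; set d := g 1 1 => E.
simpc; rewrite /=; set N := d ^+ 2 + c ^+ 2; move: hy => /= y0.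
have N0 : 0 < N.
  rewrite lt0r addr_ge0 ?sqr_ge0 // andbT paddr_eq0 ?sqr_ge0 // !sqrf_eq0.
  apply/negP => /andP[/eqP d0 /eqP c0].
  by move: E; rewrite d0 c0 !mulr0 subrr => /eqP; rewrite eq_sym oner_eq0.
case: eqP => //= im0.
have -> : (c * x + d) * (d / N) + c * y * (c / N) = ((c * x + d) * d + c ^+ 2 * y) / N.
  by ring.
rewrite divr_gt0 //.
have /eqP : c * (y * d - c * x - d) = 0.
  rewrite -[RHS](mul0r N) -im0; field; exact: lt0r_neq0.
rewrite mulf_eq0 => /orP[/eqP c0|/eqP h].
  rewrite c0 !mul0r add0r expr0n mul0r addr0 -expr2.
  by move: N0; rewrite /N c0 expr0n addr0.
have -> : c * x + d = y * d by lra.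
have -> : y * d * d + c ^+ 2 * y = y * N by rewrite /N; ring.
exact: mulr_gt0.
Qed.

Definition mp_of_eta (g : SL2 R) (w : R[i]) z : R[i] :=
  w * sqrtc (jfac g z / jfac g 'i%C).

Fact mp_of_holo g w : holomorphic (mp_of_eta g w).
Proof.
apply: holomorphicM; first exact: holomorphic_cst.
move=> z; set q := fun x : R[i] => jfac g x / jfac g 'i%C.
apply: (@holomorphicP _ _ (@sqrtc R \o q)) => //.
have dq : derivable (q : R[i]^o -> R[i]^o) (z : R[i]) 1.
  by apply: derivableM; [exact: derivable_jfac|exact: derivable_cst].
have ds := derivable_sqrtc (jfac_ratio_slit g z).
move: dq ds => /derivable1_diffP d1 /derivable1_diffP d2.
exact/derivable1_diffP/(differentiable_comp d1 d2).
Qed.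

Fact mp_of_sqr g w : w ^+ 2 = jfac g 'i%C ->
  forall z, mp_of_eta g w z ^+ 2 = jfac g z.
Proof.
move=> hw z; rewrite exprMn hw sqr_sqrtc mulrC divfK //.
exact: (jfac_neq0 g (uhp_i R)).
Qed.

(* the element determined by [g] and by the value [w] of [eta] at [i] *)
Definition mp_of (g : SL2 R) (w : R[i]) (hw : w ^+ 2 = jfac g 'i%C) : Mp :=
  MkMp (@mp_of_holo g w) (mp_of_sqr hw).

Lemma mp_of_etai g w hw : mp_eta (@mp_of g w hw) (uhp_i R) = w.
Proof.
rewrite /= /mp_of_eta.
have -> : jfac g (uhp_i R) / jfac g 'i%C = 1 by exact: divff (jfac_neq0 g (uhp_i R)).
by rewrite sqrtc1 mulr1.
Qed.

Definition expi (t : R) : R[i] := cos t +i* sin t.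

Fact rot_det (t : R) : \det (mx2 (cos t) (- sin t) (sin t) (cos t)) = 1.
Proof.
rewrite (expand_det_row _ 0) !big_ord_recl big_ord0 addr0.
rewrite /cofactor !det_mx11 !mxE /= expr0 expr1 mul1r mulN1r mulrNN.
by rewrite -!expr2 cos2Dsin2.
Qed.

Definition rot (t : R) : SL2 R := MkSL2 (rot_det t).

Fact kappa_sqr (t : R) : expi (t / 2) ^+ 2 = jfac (rot t) 'i%C.
Proof.
rewrite /jfac !mxE /= /expi expr2 [t in RHS]splitr cosD sinD; simpc.
by congr (_ +i* _); ring.
Qed.

Definition kappa (t : R) : Mp := mp_of (kappa_sqr t).

End Metaplectic.

(* Half-integers are represented by their doubles: below, an argument [d]     *)
(* stands for the weight [d / 2].                                             *)

Section KTypes.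
Variable R : realType.

(* [e^(-i n t)] for [n = d / 2], the value at [kappa t] of the character      *)
(* [chi_n] of the group [K] of all the [kappa t]                              *)
Definition chi (d : int) (t : R) : R[i] := expi (- (d%:~R / 2 * t)).

Definition transforms_right (d : int) (F : Mp R -> R[i]) : Prop :=
  forall (t : R) (s : Mp R), F (s * kappa t)%g = chi d t * F s.

Definition transforms_left (d : int) (F : Mp R -> R[i]) : Prop :=
  forall (t : R) (s : Mp R), F (kappa t * s)%g = chi d t * F s.

End KTypes.

Section LieAction.
Variable R : realType.

(* The one-parameter subgroup [s |-> exp (s X)] of the metaplectic group. The *)
(* topology of this group is the one induced by [(g, eta i)], and its Lie   *)
(* algebra is identified with traceless matrices by projecting to [SL2].      *)
Definition one_parameter (X : 'M[R]_2) (c : R -> Mp R) : Prop :=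
  [/\ forall s t, c (s + t) = (c s * c t)%g,
      continuous (fun s => mp_eta (c s) (uhp_i R) : R[i]^o) &
      is_derive (0 : R) 1 (fun s => sl2_mx (mp_g (c s))) X].

(* well defined when [\tr X = 0]: there is then exactly one such subgroup *)
Definition mp_exp (X : 'M[R]_2) : R -> Mp R :=
  xget (fun _ => 1%g) [set c | one_parameter X c].

Definition Cderive (f : R -> R[i]) (s : R) : R[i] :=
  derive1 (fun t => complex.Re (f t)) s +i* derive1 (fun t => complex.Im (f t)) s.

Definition lie_real (X : 'M[R]_2) (F : Mp R -> R[i]) (s : Mp R) : R[i] :=
  Cderive (fun t => F (s * mp_exp X t)%g) 0.

(* complex-linear extension to [Z = X + i Y] *)
Definition lie (Z : 'M[R[i]]_2) (F : Mp R -> R[i]) (s : Mp R) : R[i] :=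
  lie_real (map_mx (@complex.Re R) Z) F s +
  'i%C * lie_real (map_mx (@complex.Im R) Z) F s.

Definition nplus : 'M[R[i]]_2 := 2^-1 *: mx2 1 'i%C 'i%C (-1).
Definition nminus : 'M[R[i]]_2 := 2^-1 *: mx2 1 (- 'i%C) (- 'i%C) (-1).

End LieAction.

Section Representations.
Variable R : realType.
Notation uhp := (uhp R).

(* integration against [dx dy / y^2] *)
Definition dv_int (f : uhp -> R) : \bar R :=
  (\int[lebesgue_measure \x lebesgue_measure]_(p in [set p : R * R | 0 < p.2]%R)
     (ext0 f (p.1 +i* p.2) / p.2 ^+ 2)%:E)%E.

Definition dv_intC (f : uhp -> R[i]) : R[i] :=
  fine (dv_int (fun z => complex.Re (f z))) +i*
  fine (dv_int (fun z => complex.Im (f z))).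

Definition ypow (d : nat) (z : uhp) : R := complex.Im z `^ (d%:R / 2).

Definition sq_integrable (d : nat) (f : uhp -> R[i]) : Prop :=
  (dv_int (fun z => complex.Re (`|f z| ^+ 2) * ypow d z)%R < +oo)%E.

Definition dot (d : nat) (f g : uhp -> R[i]) : R[i] :=
  dv_intC (fun z => f z * (g z)^*%C * (ypow d z)%:C).

(* Raw data only: that the two instances below are unitary representations on *)
(* Hilbert spaces is not recorded.                                            *)
Record fun_rep := FunRep {
  rep_space : set (uhp -> R[i]);
  rep_dot : (uhp -> R[i]) -> (uhp -> R[i]) -> R[i];
  rep_op : Mp R -> (uhp -> R[i]) -> uhp -> R[i] }.

Definition pi_rep (d : nat) : fun_rep := {|
  rep_space := [set f | holomorphic f /\ sq_integrable d f];
  rep_dot := dot d;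
  rep_op := fun s f z => f (mp_act s^-1%g z) * mp_eta s^-1%g z ^- d |}.

Definition pi_bar_rep (d : nat) : fun_rep := {|
  rep_space := [set f | antiholomorphic f /\ sq_integrable d f];
  rep_dot := dot d;
  rep_op := fun s f z => f (mp_act s^-1%g z) * (mp_eta s^-1%g z)^*%C ^- d |}.

(* the [K]-orbit of [v] spans a finite-dimensional space *)
Definition K_finite (p : fun_rep) (v : uhp -> R[i]) : Prop :=
  rep_space p v /\
  exists (n : nat) (e : 'I_n -> uhp -> R[i]),
    (forall i, rep_space p (e i)) /\
    forall t : R, exists a : 'I_n -> R[i],
      forall z, rep_op p (kappa t) v z = \sum_i a i * e i z.

Definition K_finite_coef (p : fun_rep) (F : Mp R -> R[i]) : Prop :=
  exists v w, [/\ K_finite p v, K_finite p w &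
    forall s, F s = rep_dot p (rep_op p s v) w].

(* [F] is required to be nonzero, so that uniqueness is not degenerate.  *)
Definition unique_up_to_scalar (P : (Mp R -> R[i]) -> Prop)
    (F : Mp R -> R[i]) : Prop :=
  [/\ P F, exists s, F s != 0 &
      forall G, P G -> exists a : R[i], forall s, G s = a * F s].

(* [(2i)^m (z - i)^k / (z + i)^(m + k)] for [m = d / 2], where [x^n] stands   *)
(* for [(sqrtc x)^(2 n)]; the branch of [sqrtc] has values in                 *)
(* [{Re > 0} \/ {Re = 0, Im >= 0}]                                            *)
Definition fkm (k d : nat) (z : R[i]) : R[i] :=
  sqrtc (2 * 'i%C) ^+ d * (z - 'i%C) ^+ k / sqrtc (z + 'i%C) ^+ (d + 2 * k).

Definition Fkm (k d : nat) (s : Mp R) : R[i] :=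
  fkm k d (mp_act s (uhp_i R)) * mp_eta s (uhp_i R) ^- d.

End Representations.

(* Main.v *)
(* In the disc coordinate [w = (z - i) / (z + i)] the function [f_k] is       *)
(* [w^k] times [f_0], and if [[al, be], [ga, de]] is the conjugate of [g_s]   *)
(* in [SU(1,1)], then [pi(s^-1) f_k] is                                       *)
(* [(be + al w)^k (de + ga w)^(- m - k)] times [f_0]. The binomial series     *)
(* expands it as [sum_j b_j(s) f_j], uniformly relatively to [f_0]. Under     *)
(* [K] the [f_j] have distinct weights, hence are orthogonal, and             *)
(* [<pi(s^-1) f_k, f_j> = b_j(s) |f_j|^2]. On the other hand [n^+] acts as    *)
(* the derivation with [be -> al], [de -> ga], [al, ga -> 0]; as              *)
(* [F_k = b_0], this gives [(n^+)^j F_k = j! b_j].                            *)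
(* For uniqueness, averaging over the dyadic subgroups of [K] replaces the    *)
(* two [K]-finite vectors of a coefficient with the given equivariance by     *)
(* weight vectors: on a finite-dimensional span the averages are eventually   *)
(* constant. A weight vector [u] is a multiple of [f_j], because [u / f_0]    *)
(* solves the differential equation of [w^j].                                 *)

Require Import Defs.
From HB Require Import structures.
From mathcomp Require Import all_boot all_order all_algebra.
From mathcomp Require Import all_classical all_reals all_analysis measurable_realfun.
From mathcomp.real_closed Require Import complex.
From mathcomp Require Import ring lra zify.
Set Implicit Arguments.
Unset Strict Implicit.
Unset Printing Implicit Defensive.
Import Order.TTheory GRing.Theory Num.Theory.
Import numFieldNormedType.Exports.
Local Open Scope classical_set_scope.
Local Open Scope ring_scope.
Local Open Scope complex_scope.

(** * Complex-valued functions of a real variable *)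

(** Write [f_j] for [fk j d], [w] for the disc coordinate [cay], and [b_j(s)] for [bcf k d j s], the
    coefficient of [f_j] in the expansion of [pi(s^-1) f_k]. The theorem holds because two
    computations meet in [b_j].

    The analytic one: the disc formula [fkm_act] and the binomial series give the expansion, with an
    error that is small relative to [f_0] ([fkm_expansion]). The action is unitary ([dot_op],
    resting on [invariant_SL2]), and the [f_j] are square-integrable ([L2_fk]) and of distinct
    weights, hence orthogonal. Pairing with [f_j] gives [dot_op_fk]; by unitarity the conjugate of
    [b_j(s)] is then a nonzero multiple of [<pi(s) f_j, f_k>], a [K]-finite coefficient ([coef_fk]).

    The algebraic one: [nplus] acts on the generating function of the [b_j] as [d/dw] ([lieD_bcf]),
    so its [j]-th iterate sends [F_k = b_0] to [j! b_j] ([iter_lie_nplus]). This function is not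
    identically zero ([bcf_neq0]).

    For uniqueness, a coefficient with the prescribed behaviour on the right and on the left does
    not change when its two vectors are averaged over [K] against the corresponding characters
    ([project_right], [project_left]). Holomorphic weight vectors are multiples of the [f_j]
    ([twist_fixed], through [weight_vector]), so every such coefficient is a multiple of
    [<pi(s) f_j, f_k>]. The statement about [pi_bar_rep] follows by complex conjugation
    ([rep_op_cj]). *)

Section ComplexTopology.
Variable R : realType.
Local Notation C := (R[i]^o).
Implicit Types (z : R[i]).

Lemma normC_le_ReIm z : `|z| <= (`|complex.Re z| + `|complex.Im z|)%:C.
Proof.
rewrite {1}[z]complexE; apply: le_trans (ler_normD _ _) _.
rewrite normrM !normc_def /= !expr0n !add0r !addr0 expr1n sqrtr1 mul1r.
by rewrite !sqrtr_sqr rmorphD.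
Qed.

Lemma near_distC z (e : R) : 0 < e -> \forall w \near (z : C), `|z - w| < e%:C.
Proof. by move=> e0; apply/nbhs_ballP; exists e%:C => //=; rewrite ltcR. Qed.

Lemma continuous_Re : continuous (@complex.Re R : C -> R).
Proof.
move=> z; apply/(@cvgrPdist_lt _ R C (nbhs (z : C))) => e e0.
apply: filterS (near_distC z e0) => w /(le_lt_trans (normc_ge_Re _)).
by rewrite raddfB ltcR.
Qed.

Lemma continuous_Im : continuous (@complex.Im R : C -> R).
Proof.
move=> z; apply/(@cvgrPdist_lt _ R C (nbhs (z : C))) => e e0.
apply: filterS (near_distC z e0) => w /(le_lt_trans (normc_ge_Im _)).
by rewrite raddfB ltcR.
Qed.

Lemma cvg_complex (T : Type) (F : set_system T) {FF : Filter F} (f g : T -> R) a b :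
  f @ F --> a -> g @ F --> b -> (fun t => (f t +i* g t) : C) @ F --> (a +i* b : C).
Proof.
move=> fa gb; apply/cvgrPdist_lt => -[e e'] /[dup] e0.
rewrite ltcE /= => /andP[/eqP e'0 e1]; rewrite e'0.
near=> t; apply: le_lt_trans (normC_le_ReIm _) _; rewrite ltcR /=.
rewrite [ltRHS]splitr ltrD //.
  by near: t; apply: cvgr_dist_lt => //; rewrite divr_gt0.
by near: t; apply: cvgr_dist_lt => //; rewrite divr_gt0.
Unshelve. all: by end_near. Qed.

Lemma continuous_real_complex : continuous (real_complex R : R -> C).
Proof. by move=> x; apply: cvg_complex; [exact: cvg_id|exact: cvg_cst]. Qed.

Lemma continuous_conjc : continuous (@conjc R : C -> C).
Proof.
move=> z; have -> : (@conjc R : C -> C) = fun w => complex.Re w +i* - complex.Im w.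
  by apply/funext => -[].
apply: (@cvg_complex _ (nbhs (z : C))); first exact: continuous_Re.
by apply: (@cvgN _ _ _ (nbhs (z : C))); exact: continuous_Im.
Qed.

End ComplexTopology.

Section Caratheodory.
Variable K : numFieldType.

(** The factor is the difference quotient, completed at [z] by the derivative. The statement covers
    real and complex differentiation at once. *)
Lemma is_derive_carath (f : K -> K) (z v : K) :
  is_derive (z : K^o) 1 (f : K^o -> K^o) (v : K^o) ->
  exists g : K -> K, [/\ {for z, continuous (g : K^o -> K^o)}, g z = v &
    forall w, f w - f z = (w - z) * g w].
Proof.
move=> [df fv].
exists (fun w => if w == z then v else (f w - f z) / (w - z)); split.
- apply/(@continuous_withinNx K^o K^o) => /=; rewrite eqxx.
  have hv : h^-1 *: ((f (h *: 1 + z) : K^o) - f z) @[h --> 0^'] --> v.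
    by rewrite -fv; exact: df.
  apply/(@cvgrPdist_lt _ K^o) => e e0.
  move/(@cvgrPdist_lt _ K^o) : hv => /(_ e e0).
  rewrite !near_withinE => /(@nbhs_ballP K K^o) [d /= d0 hd].
  apply/(@nbhs_ballP K K^o); exists d => //= w zw wz; rewrite (negbTE wz).
  have := hd (w - z); rewrite /ball /= sub0r opprB subr_eq0 => /(_ zw wz).
  by rewrite /GRing.scale /= mulr1 subrK mulrC.
- by rewrite eqxx.
- move=> w; case: eqP => [->|/eqP wz]; first by rewrite !subrr mul0r.
  by rewrite mulrC divfK // subr_eq0.
Qed.
End Caratheodory.

Section CvgC.
Variables (R : realType) (T : Type) (F : set_system T).
Context {FF : Filter F}.
Local Notation C := (R[i]^o).
Implicit Types (f g : T -> C) (a b : C).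

Lemma cvgC_D f g a b : f @ F --> a -> g @ F --> b -> 
  (fun x => (f x : R[i]) + (g x : R[i]) : C) @ F --> ((a : R[i]) + b : C).
Proof. exact: (@cvgD (complex R) C). Qed.

Lemma cvgC_N f a : f @ F --> a -> (fun x => - (f x : R[i]) : C) @ F --> (- (a : R[i]) : C).
Proof. exact: (@cvgN (complex R) C). Qed.

Lemma cvgC_M f g a b : f @ F --> a -> g @ F --> b ->
  (fun x => (f x : R[i]) * (g x : R[i]) : C) @ F --> ((a : R[i]) * b : C).
Proof. exact: (@cvgM (complex R)). Qed.

Lemma cvgC_V f a : a != 0 -> f @ F --> a ->
  (fun x => (f x : R[i])^-1 : C) @ F --> ((a : R[i])^-1 : C).
Proof. exact: (@cvgV (complex R)). Qed.

Lemma cvgC_neq0 f a : f @ F --> a -> a != 0 -> \forall x \near F, f x != 0.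
Proof. exact: (@cvgr_neq0 (complex R) C). Qed.
End CvgC.

Section ForContinuousC.
Variables (R : realType) (T : topologicalType).
Local Notation C := (R[i]^o).
Implicit Types (f g : T -> R[i]) (t : T).

Lemma forC_D f g t : {for t, continuous (f : T -> C)} -> {for t, continuous (g : T -> C)} ->
  {for t, continuous (fun x => f x + g x : C)}.
Proof. exact: cvgC_D. Qed.

Lemma forC_N f t : {for t, continuous (f : T -> C)} ->
  {for t, continuous (fun x => - f x : C)}.
Proof. exact: cvgC_N. Qed.

Lemma forC_M f g t : {for t, continuous (f : T -> C)} -> {for t, continuous (g : T -> C)} ->
  {for t, continuous (fun x => f x * g x : C)}.
Proof. exact: cvgC_M. Qed.

Lemma forC_V f t : f t != 0 -> {for t, continuous (f : T -> C)} ->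
  {for t, continuous (fun x => (f x)^-1 : C)}.
Proof. exact: cvgC_V. Qed.

Lemma forC_cst a t : {for t, continuous (fun=> a : C)}.
Proof. exact: cvg_cst. Qed.

End ForContinuousC.
Arguments forC_cst {R T} a t.

Section CDeriv.
Variable R : realType.
Local Notation C := (R[i]^o).
Implicit Types (f g : R -> R[i]) (t : R) (v w : R[i]).

(* Caratheodory's form of [f'(t) = v], which makes products and compositions  *)
(* with holomorphic functions immediate.                                      *)
Definition cderiv f t v := exists phi : R -> R[i],
  [/\ {for t, continuous (phi : R -> C)}, phi t = v &
      \forall x \near t, f x - f t = (x - t)%:C * phi x].

Lemma cderiv_cst a t : cderiv (fun=> a) t 0.
Proof.
exists (fun=> 0); split=> //; first exact: cst_continuous.
by apply: (@nearW _ (nbhs t)) => x; rewrite subrr mulr0.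
Qed.

Lemma cderiv_continuous f t v : cderiv f t v -> {for t, continuous (f : R -> C)}.
Proof.
move=> [phi [cphi _ fE]].
have : (f t + (x - t)%:C * phi x : C) @[x --> t] --> (f t + (t - t)%:C * phi t : C).
  apply: (@cvgC_D _ _ (nbhs t)); first exact: cvg_cst.
  apply: (@cvgC_M _ _ (nbhs t)); last exact: cphi.
  apply: (@cvg_comp _ _ _ (fun x => x - t) _ (nbhs t)); last exact: continuous_real_complex.
  by apply: (@cvgB _ _ _ (nbhs t)); [exact: cvg_id|exact: cvg_cst].
rewrite subrr mul0r addr0; apply: cvg_trans; apply: near_eq_cvg.
by apply: filterS fE => x <-; rewrite addrC subrK.
Qed.

Lemma cderivD f g t v w : cderiv f t v -> cderiv g t w ->
  cderiv (fun x => f x + g x) t (v + w).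
Proof.
move=> [phi [cphi pv fE]] [psi [cpsi pw gE]].
exists (fun x => phi x + psi x); split; [exact: (forC_D cphi cpsi)|by rewrite pv pw|].
by apply: filterS2 fE gE => x e1 e2; rewrite mulrDr -e1 -e2; ring.
Qed.

Lemma cderivM f g t v w : cderiv f t v -> cderiv g t w ->
  cderiv (fun x => f x * g x) t (f t * w + v * g t).
Proof.
move=> df; have cf := cderiv_continuous df.
move: df => [phi [cphi pv fE]] [psi [cpsi pw gE]].
exists (fun x => f x * psi x + phi x * g t); split; [|by rewrite pv pw|].
  exact (forC_D (forC_M cf cpsi) (forC_M cphi (forC_cst (g t) t))).
apply: filterS2 fE gE => x e1 e2.
rewrite mulrDr mulrCA -e2 mulrA -e1; ring.
Qed.

Lemma cderivZ a f t v : cderiv f t v -> cderiv (fun x => a * f x) t (a * v).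
Proof. by move=> /(cderivM (cderiv_cst a t)); rewrite mul0r addr0. Qed.

Lemma cderivN f t v : cderiv f t v -> cderiv (fun x => - f x) t (- v).
Proof.
move=> /(cderivZ (-1)); rewrite mulN1r.
by under eq_fun do rewrite mulN1r.
Qed.

Lemma cderivX f t v n : cderiv f t v ->
  cderiv (fun x => f x ^+ n) t (n%:R * f t ^+ n.-1 * v).
Proof.
move=> df; elim: n => [|n /(cderivM df)]; first by rewrite mul0r mul0r; exact: cderiv_cst.
under eq_fun do rewrite -exprS.
congr cderiv; case: n => [|n] /=; first by rewrite expr0; ring.
rewrite -(natr1 n.+1) exprS; ring.
Qed.

Lemma cderiv_real (g : R -> R) t (a : R) :
  is_derive t 1 g a -> cderiv (fun x => (g x)%:C) t a%:C.
Proof.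
move=> /(@is_derive_carath R)[h [ch <- gE]].
exists (fun x => (h x)%:C); split => //.
  by apply: (@cvg_comp _ _ _ h _ (nbhs t) (nbhs (h t))); [exact: ch|exact: continuous_real_complex].
by apply: (@nearW _ (nbhs t)) => x; rewrite -rmorphB gE rmorphM.
Qed.

Lemma cderiv_comp (F : R[i] -> R[i]) (w : R[i]) f t v :
  is_derive (f t : C) 1 (F : C -> C) (w : C) -> cderiv f t v ->
  cderiv (F \o f) t (w * v).
Proof.
move=> /(@is_derive_carath (R[i]))[G [cG <- FE]] df; have cf := cderiv_continuous df.
move: df => [phi [cphi pv fE]].
exists (fun x => G (f x) * phi x); split; [|by rewrite pv|].
  have c1 : {for t, continuous (fun x => G (f x) : C)}.
    exact: (@cvg_comp _ _ _ f G (nbhs t) (nbhs (f t : C)) _ cf cG).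
  exact: (forC_M c1 cphi).
by apply: filterS fE => x e1 /=; rewrite FE e1; ring.
Qed.

(** The difference of [f] is that of [f ^+ 2] divided by [f x + f t]. Continuity of [f] keeps this
    divisor near [2 * f t], hence away from zero, whichever branch of the root [f] is. *)
Lemma cderiv_sqrt f t v : {for t, continuous (f : R -> C)} -> f t != 0 ->
  cderiv (fun x => f x ^+ 2) t v -> cderiv f t (v / (2 * f t)).
Proof.
move=> cf ft0 [phi [cphi <- fE]].
have c2 : {for t, continuous (fun x => f x + f t : C)}.
  exact: (forC_D cf (forC_cst (f t) t)).
have s0 : f t + f t != 0 by rewrite -mulr2n -mulr_natl mulf_neq0 // pnatr_eq0.
exists (fun x => phi x / (f x + f t)); split; last 1 first.
- have n0 : \forall x \near t, f x + f t != 0.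
    exact: (@cvgC_neq0 _ _ (nbhs t) _ _ _ c2).
  by apply: filterS2 fE n0 => x e1 xn0; rewrite mulrA -e1 subr_sqr mulfK.
- exact: (forC_M cphi (forC_V s0 c2)).
- by rewrite mulr_natl mulr2n.
Qed.

Lemma cderivV f t v : cderiv f t v -> f t != 0 ->
  cderiv (fun x => (f x)^-1) t (- v / f t ^+ 2).
Proof.
move=> df ft0; have cf := cderiv_continuous df.
move: df => [phi [cphi <- fE]].
exists (fun x => - phi x / (f x * f t)); split; last 1 first.
- have n0 : \forall x \near t, f x != 0.
    exact: (@cvgC_neq0 _ _ (nbhs t) _ _ _ cf).
  apply: filterS2 fE n0 => x e1 xn0.
  rewrite mulrA mulrN -e1; field; exact/andP.
- exact: (forC_M (forC_N cphi) (forC_V (mulf_neq0 ft0 ft0) (forC_M cf (forC_cst (f t) t)))).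
- by rewrite expr2.
Qed.

(** A continuous real-linear functional passes through the difference quotient; it is applied to the
    real and to the imaginary part. *)
Lemma is_derive_additive (L : R[i] -> R) f t v : additive L ->
  (forall (x : R) z, L (x%:C * z) = x * L z) -> continuous (L : C -> R) ->
  cderiv f t v -> is_derive t 1 (L \o f) (L v).
Proof.
move=> LB LZ cL [phi [cphi <- fE]].
have H : h^-1 *: ((L (f (h *: 1 + t)) : R^o) - L (f t)) @[h --> 0^'] --> L (phi t).
  have cp : L (phi (h + t)) @[h --> (0:R)^'] --> L (phi t).
    apply: (@cvg_comp _ _ _ (fun h => phi (h + t)) L _ (nbhs (phi t : C))); last exact: cL.
    apply: (@cvg_comp _ _ _ (fun h => h + t) phi _ (nbhs t)); last exact: cphi.
    have : h + t @[h --> (0:R)^'] --> 0 + t.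
      by apply: cvgD; [exact: cvg_within|exact: cvg_cst].
    by rewrite add0r.
  apply: cvg_trans cp; apply: near_eq_cvg.
  move: fE => /nbhs_ballP[d /= d0 hd].
  apply/nbhs_ballP; exists d => //= h; rewrite /ball /= sub0r normrN => hd0 h0.
  have /= := hd (h + t); rewrite /ball /= opprD addrCA subrr addr0 normrN => /(_ hd0) e1.
  rewrite /GRing.scale /= mulr1 -LB e1 addrK LZ mulrA mulVf ?mul1r //.
have D : derivable (L \o f) t 1 by apply/cvg_ex; exists (L (phi t)).
by split=> //; apply/cvg_lim.
Qed.

Lemma cderiv_Re f t v : cderiv f t v ->
  is_derive t 1 (fun x => complex.Re (f x)) (complex.Re v).
Proof.
apply: is_derive_additive; [exact: raddfB| |exact: continuous_Re].
by move=> x [a b] /=; rewrite mul0r subr0.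
Qed.

Lemma cderiv_Im f t v : cderiv f t v ->
  is_derive t 1 (fun x => complex.Im (f x)) (complex.Im v).
Proof.
apply: is_derive_additive; [exact: raddfB| |exact: continuous_Im].
by move=> x [a b] /=; rewrite mul0r addr0.
Qed.

Lemma cderiv_conj f t v : cderiv f t v -> cderiv (fun x => (f x)^*%C) t (v^*%C).
Proof.
move=> [phi [cphi <- fE]]; exists (fun x => (phi x)^*%C); split; last 1 first.
- apply: filterS fE => x e1.
  by rewrite -rmorphB e1 rmorphM; congr (_ * _); rewrite /= oppr0.
- exact: (@cvg_comp _ _ _ phi (@conjc R) (nbhs t) (nbhs (phi t : C)) _ cphi (@continuous_conjc R (phi t))).
- by [].
Qed.

Lemma cderiv_cvg_Cderive f t v : cderiv f t v -> Cderive f t = v.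
Proof.
move=> df; rewrite /Cderive !derive1E.
have [_ ->] := cderiv_Re df; have [_ ->] := cderiv_Im df.
by case: v {df}.
Qed.

(** The mean value theorem applies to the real and imaginary parts separately, which costs the
    factor 2. With [B = 0] it says that a vanishing derivative forces equal end values. *)
Lemma cderiv_bound f (df : R -> R[i]) (B : R) :
  (forall x : R, 0 <= x <= 1 -> cderiv f x (df x)) ->
  (forall x : R, 0 <= x <= 1 -> `|df x| <= B%:C) ->
  `|f 1 - f 0| <= (2 * B)%:C.
Proof.
move=> hf hB.
have key (L : R[i] -> R) :
    (forall x v, cderiv f x v -> is_derive x 1 (L \o f) (L v)) ->
    (forall z, `|L z|%:C <= `|z|) -> `|L (f 1) - L (f 0)| <= B.
  move=> hL Ln.
  have d (x : R) : 0 <= x <= 1 -> is_derive x 1 (L \o f) (L (df x)) by move=> /hf/hL.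
  have [||x x01] := @MVT_segment R (L \o f) (L \o df) 0 1 ler01.
  - by move=> x; rewrite in_itv /= => /andP[x0 x1]; apply: d; rewrite !ltW.
  - apply: derivable_within_continuous => x; rewrite in_itv /= => x01.
    by have [] := d _ x01.
  - rewrite subr0 mulr1 /= => ->.
    by rewrite -lecR; apply: le_trans (Ln _) (hB _ _); move: x01; rewrite in_itv.
apply: le_trans (normC_le_ReIm _) _; rewrite lecR mulr_natl mulr2n lerD //.
  by rewrite raddfB; apply: key; [exact: cderiv_Re|exact: normc_ge_Re].
by rewrite raddfB; apply: key; [exact: cderiv_Im|exact: normc_ge_Im].
Qed.

End CDeriv.

(** * The disc model *)

Section Expi.
Variable R : realType.
Implicit Types (s t : R).

Lemma expi0 : expi (0 : R) = 1. Proof. by rewrite /expi cos0 sin0. Qed.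

Lemma expiD s t : expi (s + t) = expi s * expi t.
Proof. by rewrite /expi cosD sinD; simpc; congr (_ +i* _); ring. Qed.

Lemma expiN t : expi (- t) = (expi t)^*%C.
Proof. by rewrite /expi cosN sinN. Qed.

Lemma expi_neq0 t : expi t != 0.
Proof.
apply/eqP => -[c0 s0]; have := cos2Dsin2 t.
by rewrite c0 s0 !expr0n addr0 => /eqP; rewrite eq_sym oner_eq0.
Qed.

Lemma expiV t : (expi t)^-1 = expi (- t).
Proof.
by apply: (mulfI (expi_neq0 t)); rewrite mulfV ?expi_neq0 // -expiD subrr expi0.
Qed.

Lemma expiM t n : expi (t * n%:R) = expi t ^+ n.
Proof.
by elim: n => [|n IH]; rewrite ?mulr0 ?expi0 // exprS -IH -natr1 mulrDr mulr1 addrC expiD.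
Qed.

Lemma expi_pi : expi (pi : R) = -1.
Proof. by rewrite /expi cospi sinpi; simpc. Qed.

Lemma expi_2pi (n : nat) : expi (pi *+ 2 * n%:R : R) = 1.
Proof. by rewrite expiM mulr2n expiD expi_pi mulrNN mulr1 expr1n. Qed.

End Expi.

(** * Holomorphic square roots on the half-plane *)

Section UpperHalfPlaneFacts.
Variable R : realType.
Local Notation C := (R[i]^o).
Implicit Types (z : uhp R).

Lemma sqr_normC (x : R[i]) : `|x| ^+ 2 = x * x^*%C.
Proof.
case: x => a b; rewrite normc_def /= -rmorphXn /= sqr_sqrtr ?addr_ge0 ?sqr_ge0 //.
by simpc; congr (_ +i* _); ring.
Qed.

Lemma holomorphic_continuous (f : uhp R -> R[i]) z : holomorphic f ->
  {for (z : R[i]), continuous (ext0 f : C -> C)}.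
Proof. by move=> /(_ z)/derivable1_diffP/differentiable_continuous. Qed.

Lemma segment_im z (t : R) : 0 <= t <= 1 ->
  0 < complex.Im ('i%C + t%:C * ((z : R[i]) - 'i%C)).
Proof.
case: z => -[x y] hy /=; rewrite /= in hy * => /andP[t0 t1]; nra.
Qed.

(* The ratio [e1 / e2] takes its values in [{1, -1}] and is continuous along  *)
(* the segment from [i] to [z].                                               *)
Lemma square_root_unique (e1 e2 : uhp R -> R[i]) :
  holomorphic e1 -> holomorphic e2 -> (forall z, e1 z ^+ 2 = e2 z ^+ 2) ->
  (forall z, e2 z != 0) -> e1 (uhp_i R) = e2 (uhp_i R) -> e1 =1 e2.
Proof.
move=> h1 h2 e12 e0 ei z.
pose r z := e1 z * (e2 z)^-1.
have hr : holomorphic r := holomorphicM h1 (holomorphicV e0 h2).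
have r2 w : r w = 1 \/ r w = -1.
  have : r w ^+ 2 == 1 by rewrite exprMn exprVn e12 divff // expf_neq0.
  by rewrite sqrf_eq1 => /orP[]/eqP; auto.
suff : r z = 1 by move/(congr1 ( *%R^~ (e2 z))); rewrite mul1r mulfVK.
pose p (t : R) : R[i] := 'i%C + t%:C * ((z : R[i]) - 'i%C).
pose g t := complex.Re (ext0 r (p t)).
have pE t (t01 : 0 <= t <= 1) : ext0 r (p t) = r (UHP (segment_im z t01)).
  by rewrite -(ext0E r).
have cg t : 0 <= t <= 1 -> {for t, continuous g}.
  move=> t01; have cr := @holomorphic_continuous r (UHP (segment_im z t01)) hr.
  have dp : cderiv p t (0 + 1%:C * ((z : R[i]) - 'i%C)).
    apply: cderivD; first exact: cderiv_cst.
    under eq_fun do rewrite mulrC.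
    by rewrite mulrC; apply: cderivZ; exact: cderiv_real.
  apply: (@cvg_comp _ _ _ (fun t => ext0 r (p t)) (@complex.Re R) (nbhs t) (nbhs (ext0 r (p t) : C))); last exact: continuous_Re.
  exact: (@cvg_comp _ _ _ p (ext0 r) (nbhs t) (nbhs (p t : C)) _ (cderiv_continuous dp) cr).
have p0 : ext0 r (p 0) = 1.
  rewrite /p mul0r addr0 (ext0E r (uhp_i R)) /r ei divff //.
have p1 : ext0 r (p 1) = r z.
  by rewrite /p mul1r addrCA subrr addr0 ext0E.
have [//|rz] := r2 z.
have [||c] := @IVT R g 0 1 0 ler01.
- apply: continuous_in_subspaceT => t; rewrite inE /= in_itv /=; exact: cg.
- by rewrite /g p0 p1 rz /= ge_min le_max ler01 oppr_le0 ler01 orbT.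
rewrite in_itv /= => c01; rewrite /g (pE c c01).
by case: (r2 (UHP (segment_im z c01))) => -> /= /eqP; rewrite ?oppr_eq0 oner_eq0.
Qed.

(** Both [eta] are holomorphic square roots of the same automorphy factor, so agreement at [i] is
    enough. Identities in the metaplectic group are checked through this. *)
Lemma mp_eq (s t : Mp R) : mp_g s = mp_g t ->
  mp_eta s (uhp_i R) = mp_eta t (uhp_i R) -> s = t.
Proof.
move=> g h; apply: mp_inj => //.
apply: square_root_unique => //; [exact: mp_holo|exact: mp_holo| |exact: mp_eta_neq0].
by move=> z; rewrite !mp_sqr g.
Qed.

End UpperHalfPlaneFacts.

(** * The Cayley transform and the functions f_k *)

Section Cayley.
Variable R : realType.
Local Notation C := (R[i]^o).
Local Notation uhp := (uhp R).
Local Notation I := (uhp_i R).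
Implicit Types (z : uhp) (g : SL2 R) (s : Mp R).

Definition cay (z : R[i]) : R[i] := (z - 'i%C) / (z + 'i%C).
(** A square root of [(z + i) / (2 i)] normalised to be 1 at [i]. It makes [fkm k d] equal to
    [cay ^ k] times [theta ^ (- d)], see [fkmE]. *)
Definition theta (z : R[i]) : R[i] := sqrtc (z + 'i%C) / sqrtc (2 * 'i%C).

(* [[al, be], [ga, de]] is the conjugate of [g] in [SU(1,1)] by the Cayley    *)
(* transform [cay].                                                           *)
Definition de g : R[i] := (g 0 0 + g 1 1) / 2 +i* ((g 1 0 - g 0 1) / 2).
Definition ga g : R[i] := (g 0 0 - g 1 1) / 2 +i* ((g 1 0 + g 0 1) / 2).
Definition al g : R[i] := (de g)^*%C.
Definition be g : R[i] := (ga g)^*%C.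

(* The square root of [de (mp_g s)] selected by the metaplectic lift [s].     *)
Definition Th s : R[i] := theta (mp_act s I) * mp_eta s I.

Lemma uhpDi_neq0 z : (z : R[i]) + 'i%C != 0.
Proof.
case: z => -[x y] hy /=; rewrite /= in hy; apply/eqP => -[_ h].
by have := ltr01 (R := R); lra.
Qed.

Lemma twoi_neq0 : 2 * 'i%C != 0 :> R[i].
Proof. by rewrite mulf_neq0 ?pnatr_eq0 //; apply/eqP => -[/eqP]; rewrite oner_eq0. Qed.

Lemma sqrtc_neq0 (x : R[i]) : x != 0 -> sqrtc x != 0.
Proof. by move=> x0; rewrite -sqrf_eq0 sqr_sqrtc. Qed.

Lemma theta_sqr (z : R[i]) : theta z ^+ 2 = (z + 'i%C) / (2 * 'i%C).
Proof. by rewrite exprMn exprVn !sqr_sqrtc. Qed.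

Lemma theta_neq0 z : theta z != 0.
Proof.
by rewrite mulf_neq0 ?invr_neq0 // sqrtc_neq0 ?twoi_neq0 ?uhpDi_neq0.
Qed.

Lemma thetai : theta 'i%C = 1.
Proof.
have -> : theta 'i%C = sqrtc ('i%C + 'i%C) / sqrtc (2 * 'i%C) by [].
have -> : 'i%C + 'i%C = 2 * 'i%C :> R[i] by ring.
by rewrite divff // sqrtc_neq0 // twoi_neq0.
Qed.

Lemma cayi : cay 'i%C = 0.
Proof. by rewrite /cay subrr mul0r. Qed.

Lemma uhpDi_cay z : ((z : R[i]) + 'i%C) * cay z = (z : R[i]) - 'i%C.
Proof. by rewrite mulrC divfK // uhpDi_neq0. Qed.

Lemma derivable_addc (a z : R[i]) :
  derivable ((fun w => w + a) : C -> C) (z : C) 1.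
Proof.
have h1 : derivable (id : C -> C) (z : C) 1 by exact: derivable_id.
have h2 : derivable (cst a : C -> C) (z : C) 1 by exact: derivable_cst.
exact: (derivableD h1 h2).
Qed.

Lemma holomorphic_cay : holomorphic (fun z => cay z).
Proof.
apply: holomorphicM.
  move=> z; apply: (@holomorphicP _ _ (fun w => w - 'i%C)); first by [].
  exact: (@derivable_addc (- 'i%C) z).
apply: holomorphicV => [z|z]; first exact: uhpDi_neq0.
apply: (@holomorphicP _ _ (fun w => w + 'i%C)); first by [].
exact: (@derivable_addc 'i%C z).
Qed.

Lemma holomorphic_sqrtc (f : uhp -> R[i]) : holomorphic f ->
  (forall z, (complex.Im (f z) != 0) || (0 < complex.Re (f z))) ->
  holomorphic (fun z => sqrtc (f z)).
Proof.
move=> hf f0 z; apply: (@holomorphicP _ _ (@sqrtc R \o ext0 f)).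
  by move=> w /=; rewrite ext0E.
have ds := derivable_sqrtc (f0 z).
move: (hf z) ds => /derivable1_diffP d1.
rewrite -(ext0E f) => /derivable1_diffP d2.
exact/derivable1_diffP/(differentiable_comp d1 d2).
Qed.

Lemma holomorphicX (f : uhp -> R[i]) n : holomorphic f -> holomorphic (fun z => f z ^+ n).
Proof.
move=> hf; elim: n => [|n IH]; first exact: holomorphic_cst.
by under eq_fun do rewrite exprS; exact: holomorphicM.
Qed.

Lemma holomorphicD (f h : uhp -> R[i]) :
  holomorphic f -> holomorphic h -> holomorphic (fun z => f z + h z).
Proof.
move=> hf hh z.
apply: (@holomorphicP _ _ (fun w => ext0 f w + ext0 h w)).
  by move=> w; rewrite !ext0E.
by apply: derivableD; [exact: hf|exact: hh].
Qed.

Lemma holomorphic_theta : holomorphic (fun z => theta z).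
Proof.
apply: holomorphicM; last exact: holomorphic_cst.
apply: holomorphic_sqrtc.
  move=> z; apply: (@holomorphicP _ _ (fun w => w + 'i%C)); first by [].
  exact: (@derivable_addc 'i%C z).
move=> -[[x y] /= hy]; rewrite gt_eqF //; exact: addr_gt0.
Qed.

Lemma fkmE k d z : fkm k d z = cay z ^+ k * theta z ^- d.
Proof.
rewrite /fkm /cay /theta exprD exprM sqr_sqrtc !expr_div_n.
by rewrite !invfM invrK mulrACA mulrC; congr (_ * _); rewrite mulrC.
Qed.

(** With [moebiusDi], this is the matrix identity between [g] and its conjugate in SU(1,1), read on
    numerator and denominator of the Cayley transform and cleared of fractions. *)
Lemma moebiusBi g z : ((moebius g z : R[i]) - 'i%C) * jfac g z =
  ((z : R[i]) + 'i%C) * (be g + al g * cay z).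
Proof.
have h := uhpDi_neq0 z; have h2 := jfac_neq0 g z.
rewrite [RHS]mulrDr [X in _ = _ + X]mulrCA uhpDi_cay /=.
rewrite mulrBl mulfVK // /anum /jfac /be /al /ga /de.
by case: (z : R[i]) => x y; simpc; congr (_ +i* _); field.
Qed.

Lemma moebiusDi g z : ((moebius g z : R[i]) + 'i%C) * jfac g z =
  ((z : R[i]) + 'i%C) * (de g + ga g * cay z).
Proof.
have h := uhpDi_neq0 z; have h2 := jfac_neq0 g z.
rewrite [RHS]mulrDr [X in _ = _ + X]mulrCA uhpDi_cay /=.
rewrite mulrDl mulfVK // /anum /jfac /ga /de.
by case: (z : R[i]) => x y; simpc; congr (_ +i* _); field.
Qed.

Lemma alde g : al g * de g - be g * ga g = 1.
Proof.
have E := sl2_detE g; rewrite /al /be /de /ga; simpc; congr (_ +i* _); last by ring.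
transitivity (g 0 0 * g 1 1 - g 0 1 * g 1 0); [by field|exact: E].
Qed.

(** The defining relation of SU(1,1). It yields [|ga / de| < 1], so that the binomial series in
    [(ga / de) w] converges uniformly on the disc. *)
Lemma norm_de g : `|de g| ^+ 2 = 1 + `|ga g| ^+ 2.
Proof. by rewrite !sqr_normC -(alde g) /al /be; ring. Qed.

Lemma de_neq0 g : de g != 0.
Proof.
apply/eqP => d0; have := norm_de g; rewrite d0 normr0 expr0n /= => /esym/eqP.
by rewrite gt_eqF // ltr_pwDl // exprn_ge0.
Qed.

Lemma norm_cay z : `|cay z| < 1.
Proof.
have h := uhpDi_neq0 z.
rewrite normrM normfV ltr_pdivrMr ?normr_gt0 // mul1r.
rewrite -(ltr_pXn2r (n := 2)) ?nnegrE // !sqr_normC.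
case: z {h} => -[x y] hy; rewrite -subr_gt0.
have -> : ((x +i* y) + 'i%C) * ((x +i* y) + 'i%C)^*%C -
    ((x +i* y) - 'i%C) * ((x +i* y) - 'i%C)^*%C = (4 * y)%:C.
  by simpc; congr (_ +i* _); ring.
by rewrite ltcR mulr_gt0.
Qed.

Lemma norm_ga_de g : `|ga g / de g| < 1.
Proof.
rewrite normrM normfV ltr_pdivrMr ?normr_gt0 ?de_neq0 // mul1r.
by rewrite -(ltr_pXn2r (n := 2)) ?nnegrE // norm_de ltrDr.
Qed.

(** Keeps [1 + q] in the right half-plane, where the branch [sqrtc] is holomorphic and does not
    vanish. *)
Lemma Re_1D (q : R[i]) : `|q| < 1 -> 0 < complex.Re (1 + q).
Proof.
move=> /(le_lt_trans (normc_ge_Re q)); rewrite ltcR ltr_norml raddfD /= => /andP[h _].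
lra.
Qed.

Lemma cay_moebius g z :
  cay (moebius g z) = (be g + al g * cay z) / (de g + ga g * cay z).
Proof.
have h := uhpDi_neq0 z; have j0 := jfac_neq0 g z; have m0 := uhpDi_neq0 (moebius g z).
have e1 := moebiusBi g z; have e2 := moebiusDi g z.
have d0 : de g + ga g * cay z != 0.
  apply/eqP => d0; move: e2; rewrite d0 mulr0 => /eqP.
  by rewrite mulf_eq0 (negbTE m0) (negbTE j0).
apply: (mulIf d0); rewrite divfK //; apply: (mulfI h).
by rewrite mulrCA -e2 -e1 /cay mulrA divfK.
Qed.

Lemma Th_sqr s : Th s ^+ 2 = de (mp_g s).
Proof.
rewrite exprMn theta_sqr mp_sqr mulrAC moebiusDi cayi mulr0 addr0.
have -> : (I : R[i]) + 'i%C = 2 * 'i%C by rewrite /=; ring.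
by rewrite mulrAC mulfV ?mul1r // twoi_neq0.
Qed.

Lemma Th_neq0 s : Th s != 0.
Proof. by rewrite mulf_neq0 ?theta_neq0 ?mp_eta_neq0. Qed.

Lemma norm_q g z : `|ga g / de g * cay z| < 1.
Proof. by rewrite normrM mulr_ilt1 // ?norm_ga_de ?norm_cay. Qed.

Lemma de_q g (w : R[i]) : de g * (1 + ga g / de g * w) = de g + ga g * w.
Proof. by rewrite mulrDr mulr1 mulrA mulrCA divff ?de_neq0 // mulr1. Qed.

(** Both sides are holomorphic square roots of the same function, by [moebiusDi] and [Th_sqr], and
    they agree at [i]. This settles every sign in the half-integral powers. *)
Lemma theta_moebius s z : theta (mp_act s z) * mp_eta s z =
  Th s * (theta z * sqrtc (1 + ga (mp_g s) / de (mp_g s) * cay z)).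
Proof.
have q0 (w : uhp) := Re_1D (norm_q (mp_g s) w).
have hq : holomorphic (fun z => sqrtc (1 + ga (mp_g s) / de (mp_g s) * cay z)).
  apply: holomorphic_sqrtc; last by move=> w; rewrite q0 orbT.
  apply: holomorphicD; first exact: holomorphic_cst.
  by apply: holomorphicM; [exact: holomorphic_cst|exact: holomorphic_cay].
move: z; apply: square_root_unique.
- apply: holomorphicM; last exact: mp_holo.
  exact: (@holomorphic_moebius _ (fun z => theta z) _ holomorphic_theta).
- apply: holomorphicM; first exact: holomorphic_cst.
  by apply: holomorphicM; [exact: holomorphic_theta|].
- move=> z; rewrite /= [LHS]exprMn [RHS]exprMn [X in _ = _ * X]exprMn.
  rewrite Th_sqr !theta_sqr mp_sqr sqr_sqrtc mulrAC moebiusDi.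
  by rewrite -de_q mulrCA -!mulrA; congr (_ * (_ * _)); rewrite mulrC.
- move=> z; apply: mulf_neq0; first exact: Th_neq0.
  apply: mulf_neq0; first exact: theta_neq0.
  by apply: sqrtc_neq0; apply: contraTneq (q0 z) => ->; rewrite ltxx.
- by rewrite thetai cayi mulr0 addr0 sqrtc1 !mulr1.
Qed.

(** The disc formula [(be + al w)^k (de + ga w)^(- m - k)] times [f_0], where the square root of
    [de + ga w] is factored as [Th s] times the principal root of [1 + (ga / de) w]. *)
Lemma fkm_act k d s z : fkm k d (mp_act s z) * mp_eta s z ^- d =
  (be (mp_g s) + al (mp_g s) * cay z) ^+ k *
  (Th s * sqrtc (1 + ga (mp_g s) / de (mp_g s) * cay z)) ^- (d + 2 * k) * theta z ^- d.
Proof.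
set q := ga _ / _ * _.
have q0 : sqrtc (1 + q) != 0.
  by rewrite sqrtc_neq0 //; apply: contraTneq (Re_1D (norm_q (mp_g s) z)) => ->; rewrite ltxx.
have -> : fkm k d (mp_act s z) * mp_eta s z ^- d =
    cay (mp_act s z) ^+ k * (theta (mp_act s z) * mp_eta s z) ^- d.
  by rewrite fkmE [X in _ = _ * X^-1]exprMn [X in _ = _ * X]invfM mulrA.
rewrite theta_moebius cay_moebius -/q.
have -> : de (mp_g s) + ga (mp_g s) * cay z = (Th s * sqrtc (1 + q)) ^+ 2.
  by rewrite [RHS]exprMn Th_sqr sqr_sqrtc /q de_q.
rewrite expr_div_n exprD exprM [Th s * (_ * _)]mulrCA [X in _ * X^-1]exprMn.
rewrite [X in _ * X]invfM [X in _ = _ * X * _]invfM -!mulrA; congr (_ * _).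
by rewrite [RHS]mulrCA; congr (_ * _); rewrite mulrC.
Qed.

Lemma FkmE k d s : Fkm k d s = be (mp_g s) ^+ k * (Th s)^-1 ^+ (d + 2 * k).
Proof.
by rewrite /Fkm fkm_act cayi !mulr0 !addr0 sqrtc1 mulr1 thetai expr1n invr1 mulr1 exprVn.
Qed.

Lemma de_rot t : de (Defs.rot t) = expi t.
Proof. by rewrite /de !mxE /= /expi; congr (_ +i* _); field. Qed.

Lemma ga_rot t : ga (Defs.rot t) = 0.
Proof. by rewrite /ga !mxE /= subrr subrr !mul0r. Qed.

Lemma rot_i t : moebius (Defs.rot t) I = I.
Proof.
have h := moebiusBi (Defs.rot t) I.
move: h; rewrite /be ga_rot cayi mulr0 conjc0 addr0 mulr0 => /eqP.
rewrite mulf_eq0 (negbTE (jfac_neq0 _ _)) orbF subr_eq0 => /eqP h.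
exact/val_inj.
Qed.

Lemma kappa_etai t : mp_eta (kappa t) I = expi (t / 2).
Proof. exact: mp_of_etai. Qed.

Lemma Th_kappa t : Th (kappa t) = expi (t / 2).
Proof. by rewrite /Th /mp_act rot_i thetai mul1r kappa_etai. Qed.

Lemma kappaD (s t : R) : kappa (s + t) = (kappa s * kappa t)%g :> Mp R.
Proof.
apply: mp_eq => /=.
  apply: sl2_inj; apply/matrixP => i j; rewrite [RHS](sl2_mulE (Defs.rot s) (Defs.rot t)) !mxE /=.
  by case: ifP => _; case: ifP => _; rewrite ?sinD ?cosD //; ring.
rewrite -[LHS]/(mp_eta (kappa (s + t)) I) -[X in _ * X]/(mp_eta (kappa t) I).
rewrite -[X in X * _]/(mp_eta (kappa s) (mp_act (kappa t) I)) /mp_act rot_i !kappa_etai.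
by rewrite mulrDl expiD.
Qed.

Lemma kappa0 : kappa 0 = 1%g :> Mp R.
Proof.
apply: (mulgI (kappa 0)); by rewrite -kappaD addr0 mulg1.
Qed.

Lemma kappaN t : kappa (- t) = (kappa t)^-1%g :> Mp R.
Proof. by apply: (mulgI (kappa t)); rewrite -kappaD subrr kappa0 mulgV. Qed.

(** For a rotation [be] and [ga] vanish, and the disc formula collapses to a scalar: [f_k] has
    weight [m + 2 k], whose double is [d + 4 k]. *)
Lemma fkm_kappa k d t z : fkm k d (mp_act (kappa t) z) * mp_eta (kappa t) z ^- d =
  expi (- ((d + 4 * k)%:R / 2 * t)) * fkm k d z.
Proof.
rewrite fkm_act fkmE Th_kappa /be /al ga_rot de_rot !mul0r addr0 sqrtc1 mulr1 conjc0 add0r.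
have -> : (expi (t / 2)) ^- (d + 2 * k) = expi (- (t / 2) * (d + 2 * k)%:R).
  by rewrite expiM -exprVn expiV.
rewrite [X in X * _ * _]exprMn -expiN -expiM.
have -> : - ((d + 4 * k)%:R / 2 * t) = - t * k%:R + - (t / 2) * (d + 2 * k)%:R.
  by rewrite (natrD _ d (4 * k)) (natrD _ d (2 * k)) (natrM _ 4) (natrM _ 2); field.
by rewrite expiD -!mulrA; congr (_ * _); rewrite mulrCA.
Qed.

End Cayley.

(** * Binomial expansions *)

Section BinomialSeries.
Variable R : realType.
Local Notation C := (R[i]^o).

(** The generalised binomial coefficient, the coefficient of [x^n] in [(1 + x)^a]; it is used at the
    half-integers [a = - M / 2]. *)
Definition bincoef (a : R) (n : nat) : R := \prod_(l < n) ((a - l%:R) / l.+1%:R).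

Lemma bincoef0 a : bincoef a 0 = 1. Proof. exact: big_ord0. Qed.

Lemma bincoefS a n : n.+1%:R * bincoef a n.+1 = (a - n%:R) * bincoef a n.
Proof.
rewrite /bincoef big_ord_recr /= mulrCA mulrC; congr (_ * _).
by rewrite mulrCA divff ?mulr1 // pnatr_eq0.
Qed.

Lemma bincoef_neq0 a n : a < 0 -> bincoef a n != 0.
Proof.
move=> a0; apply/prodf_neq0 => l _.
rewrite mulf_neq0 ?invr_neq0 ?pnatr_eq0 // lt_eqF // subr_lt0.
exact: lt_le_trans a0 (ler0n _ _).
Qed.

Definition binsum (a : R) N (x : R[i]) : R[i] := \sum_(n < N) (bincoef a n)%:C * x ^+ n.

(** For [|x| <= r], it bounds the one term by which the partial sum of length [N] fails the
    differential equation, see [binsum_telescope]. *)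
Definition binrest (a : R) N (r : R) : R := N%:R * `|bincoef a N| * r ^+ N.-1.

(** Ratio test: the quotient of consecutive terms is at most [(|a| + N) r / N], and this is below
    [r' = (1 + r) / 2 < 1] as soon as [N] exceeds [2 |a| r / (1 - r)]. *)
Lemma binrest_cvg (a r : R) : 0 <= r < 1 -> binrest a N r @[N --> \oo] --> 0.
Proof.
move=> /andP[r0 r1].
pose r' := (1 + r) / 2.
have r'0 : 0 < r' by rewrite /r'; lra.
have r'1 : r' < 1 by rewrite /r'; lra.
have [N0 hN0] : exists N0, forall N, (N0 <= N)%N -> (`|a| + N%:R) * r <= N%:R * r'.
  exists (Num.truncn (2 * (`|a| * r) / (1 - r))).+1 => N hN.
  have : 2 * (`|a| * r) / (1 - r) < N%:R.
    by apply: lt_le_trans (truncnS_gt _) _; rewrite ler_nat.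
  rewrite ltr_pdivrMr ?subr_gt0 // /r' => h; lra.
have step N : (N0.+1 <= N)%N -> binrest a N.+1 r <= r' * binrest a N r.
  move=> hN; have /hN0 h : (N0 <= N)%N by exact: ltnW.
  have N1 : (0 < N)%N by exact: leq_trans hN.
  rewrite /binrest -[X in X * _ * _]ger0_norm ?ler0n // -normrM bincoefS normrM.
  have E : r ^+ N = r * r ^+ N.-1 by rewrite -exprS prednK.
  rewrite -[N.+1.-1]/N E.
  have -> : `|a - N%:R| * `|bincoef a N| * (r * r ^+ N.-1) =
     (`|a - N%:R| * r) * (`|bincoef a N| * r ^+ N.-1) by ring.
  have -> : r' * (N%:R * `|bincoef a N| * r ^+ N.-1) =
     (N%:R * r') * (`|bincoef a N| * r ^+ N.-1) by ring.
  apply: ler_wpM2r; first by rewrite mulr_ge0 ?normr_ge0 ?exprn_ge0.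
  apply: le_trans h; apply: ler_wpM2r => //.
  by apply: le_trans (ler_normB _ _) _; rewrite lerD2l ger0_norm.
have geo n : binrest a (N0.+1 + n) r <= binrest a N0.+1 r * r' ^+ n.
  elim: n => [|n IH]; first by rewrite addn0 expr0 mulr1.
  rewrite addnS; apply: le_trans (step _ _) _; first by rewrite leq_addr.
  by rewrite exprS [leRHS]mulrCA; apply: ler_wpM2l IH; exact: ltW.
have c0 : binrest a N0.+1 r * r' ^+ n @[n --> \oo] --> 0.
  rewrite -[X in _ --> X](mulr0 (binrest a N0.+1 r)).
  by apply: cvgMr; apply: cvg_expr; rewrite ger0_norm // ltW.
rewrite -(cvg_shiftn N0.+1).
apply: (@squeeze_cvgr _ _ _ _ (fun=> 0) (fun n => binrest a N0.+1 r * r' ^+ n)) => //.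
  apply: nearW => n /=; rewrite [(n + _)%N]addnC geo andbT.
  by rewrite /binrest !mulr_ge0 ?normr_ge0 ?exprn_ge0.
exact: cvg_cst.
Qed.

(* A partial sum [S] of the binomial series solves [(1 + x) S' = a S] up to   *)
(* one term; this bounds the derivative of [(1 + x)^(- a) S].                 *)
Lemma binsum_telescope (a : R) N (x : R[i]) :
  (1 + x) * (\sum_(n < N) (n%:R * bincoef a n)%:C * x ^+ n.-1) - a%:C * binsum a N x =
  - ((N%:R * bincoef a N)%:C * x ^+ N.-1).
Proof.
rewrite /binsum; elim: N => [|N IH]; first by rewrite !big_ord0 !mul0r !mulr0 subrr oppr0.
rewrite !big_ord_recr /= bincoefS.
rewrite !mulrDr opprD addrACA IH.
case: N {IH} => [|N] /=.
  by rewrite subr0 !mul0r !mulr0 expr0 !mulr1 rmorphM /=; ring.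
rewrite exprS !rmorphM rmorphB /=; ring.
Qed.

Lemma cderiv_sum n (f : 'I_n -> R -> R[i]) (v : 'I_n -> R[i]) t :
  (forall i, cderiv (f i) t (v i)) -> cderiv (fun x => \sum_i f i x) t (\sum_i v i).
Proof.
elim: n f v => [|n IH] f v h.
  by rewrite big_ord0; under eq_fun do rewrite big_ord0; exact: cderiv_cst.
rewrite big_ord_recr; under eq_fun do rewrite big_ord_recr.
exact: (cderivD (IH _ _ (fun i => h (widen_ord (leqnSn n) i))) (h ord_max)).
Qed.

(** The function [y(t) = (1 + t q)^(M / 2) S(t q)], with [S] the partial sum, has [y(0) = 1], and
    its derivative is the single leftover term; [cderiv_bound] controls [y(1) - 1]. In the constant,
    [2 ^+ M / (1 - r)] bounds [|1 + t q|^(M / 2 - 1)], and the last power of [1 - r] comes from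
    dividing by [(1 + q)^(M / 2)]. *)
Lemma binsum_error (M N : nat) (q : R[i]) (r : R) : r < 1 -> `|q| <= r%:C ->
  `|binsum (- (M%:R / 2)) N.+1 q - sqrtc (1 + q) ^- M| <=
  (2 * (2 ^+ M / (1 - r)) / (1 - r) ^+ M * binrest (- (M%:R / 2)) N.+1 r)%:C.
Proof.
move=> r1 qr; set a := - _.
have r0 : 0 <= r by rewrite -lecR; apply: le_trans qr; exact: normr_ge0.
pose S (t : R) := sqrtc (1 + t%:C * q).
have tq (t : R) : 0 <= t <= 1 -> `|t%:C * q| <= r%:C.
  move=> /andP[t0 t1]; rewrite normrM ger0_norm ?lecR //.
  by apply: le_trans qr; apply: ler_piMl => //; rewrite -[1]/(1%:C) lecR.
have reS (t : R) : 0 <= t <= 1 -> 0 < complex.Re (1 + t%:C * q).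
  by move=> /tq h; apply: Re_1D; apply: le_lt_trans h _; rewrite ltcR.
have nS (t : R) : 0 <= t <= 1 -> (1 - r)%:C <= `|S t| ^+ 2 /\ `|S t| ^+ 2 <= 2%:C.
  move=> /tq h; rewrite -normrX sqr_sqrtc; split.
    rewrite rmorphB /=; apply: le_trans (lerB_normD _ _).
    by rewrite normr1 lerD2l lerN2.
  apply: le_trans (ler_normD _ _) _; rewrite normr1.
  have -> : 2%:C = 1 + 1 :> R[i] by simpc.
  rewrite lerD2l; apply: le_trans h _; rewrite -[1]/(1%:C) lecR; exact: ltW.
have S0 (t : R) : 0 <= t <= 1 -> S t != 0.
  move=> /reS h; apply: sqrtc_neq0; apply: contraTneq h => ->; by rewrite ltxx.
have dlin (t : R) : cderiv (fun t : R => t%:C * q) t q.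
  under eq_fun do rewrite mulrC.
  by rewrite -[X in cderiv _ _ X]mulr1 -[1]/(1%:C); apply: cderivZ; exact: cderiv_real.
have dlin1 (t : R) : cderiv (fun t : R => 1 + t%:C * q) t q.
  by rewrite -[X in cderiv _ _ X]add0r; apply: cderivD => //; exact: cderiv_cst.
have dS (t : R) : 0 <= t <= 1 -> cderiv S t (q / (2 * S t)).
  move=> t01; apply: cderiv_sqrt; last 1 first.
  - by under eq_fun do rewrite sqr_sqrtc.
  - have ds : derivable (@sqrtc R : C -> C) (1 + t%:C * q) 1.
      by apply: derivable_sqrtc; rewrite (reS t t01) orbT.
    exact: cderiv_continuous (cderiv_comp (derivableP ds) (dlin1 t)).
  - exact: S0.
pose T (t : R) := binsum a N.+1 (t%:C * q).
pose T' (t : R) := q * \sum_(n < N.+1) (n%:R * bincoef a n)%:C * (t%:C * q) ^+ n.-1.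
have dT (t : R) : cderiv T t (T' t).
  rewrite /T' mulr_sumr; apply: cderiv_sum => n.
  have -> : q * ((n%:R * bincoef a n)%:C * (t%:C * q) ^+ n.-1) =
     (bincoef a n)%:C * (n%:R * (t%:C * q) ^+ n.-1 * q).
    by rewrite rmorphM /= rmorph_nat; ring.
  by apply: cderivZ; exact: (cderivX n (dlin t)).
pose y t := S t ^+ M * T t.
pose y' (t : R) := q * S t ^+ M / S t ^+ 2 * - ((N.+1%:R * bincoef a N.+1)%:C * (t%:C * q) ^+ N).
have ident (u v G : R[i]) m : u != 0 ->
    u ^+ m * (q * G) + m%:R * u ^+ m.-1 * (q / (2 * u)) * v =
    q * u ^+ m / u ^+ 2 * (u ^+ 2 * G - - (m%:R / 2) * v).
  move=> u0; case: m => [|m] /=; first by rewrite expr0; field.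
  by rewrite exprS; field.
have dy (t : R) : 0 <= t <= 1 -> cderiv y t (y' t).
  move=> t01; have := cderivM (cderivX M (dS t t01)) (dT t).
  congr cderiv.
  rewrite /y' -(binsum_telescope a N.+1) -/(T t).
  have -> : 1 + t%:C * q = S t ^+ 2 by rewrite sqr_sqrtc.
  rewrite /T'; set Sg := \sum_(n < _) _.
  have -> : a%:C = - (M%:R / 2) :> R[i] by rewrite /a rmorphN rmorphM fmorphV /= !rmorph_nat.
  exact: ident (S0 t t01).
have bound (t : R) : 0 <= t <= 1 -> `|y' t| <= (2 ^+ M / (1 - r) * binrest a N.+1 r)%:C.
  move=> t01; have [n1 n2] := nS t t01.
  have S2 : `|S t| ^+ M <= (2 ^+ M)%:C.
    have p2 : 0 <= 2%:C :> R[i] by rewrite lecR.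
    rewrite rmorphXn /=; apply: lerXn2r; rewrite ?nnegrE ?normr_ge0 //.
    rewrite -(ler_pXn2r (n := 2)) ?nnegrE ?normr_ge0 //.
    by apply: le_trans n2 _; rewrite -rmorphXn lecR /=; lra.
  have S3 : `|S t| ^- 2 <= ((1 - r)^-1)%:C.
    rewrite fmorphV /= lef_pV2 // posrE ?ltcR ?subr_gt0 //.
    by rewrite exprn_gt0 // normr_gt0 S0.
  rewrite /y' normrM normrN normrM normfV normrM !normrX.
  have -> : (2 ^+ M / (1 - r) * binrest a N.+1 r)%:C =
     1 * (2 ^+ M)%:C * ((1 - r)^-1)%:C * (binrest a N.+1 r)%:C.
    by rewrite !rmorphM /= mul1r.
  apply: ler_pM => //; rewrite ?mulr_ge0 ?invr_ge0 ?exprn_ge0 //.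
    apply: ler_pM => //; rewrite ?mulr_ge0 ?invr_ge0 ?exprn_ge0 //.
    apply: ler_pM => //; rewrite ?exprn_ge0 //.
    apply: le_trans qr _; rewrite -[1]/(1%:C) lecR; exact: ltW.
  rewrite /binrest [X in _ <= X]rmorphM /= normrM; apply: ler_pM => //.
    have nC (x : R) : `|x%:C| = `|x|%:C by rewrite normc_def /= expr0n addr0 sqrtr_sqr.
    by rewrite nC normrM ger0_norm ?ler0n.
  have rC0 : 0 <= r%:C :> R[i] by rewrite lecR.
  rewrite normrX rmorphXn /=; apply: lerXn2r; rewrite ?nnegrE ?normr_ge0 //.
  exact: tq.
have := cderiv_bound dy bound.
have -> : y 0 = 1.
  rewrite /y /S /T mul0r addr0 sqrtc1 expr1n mul1r /binsum big_ord_recl /=.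
  rewrite bincoef0 expr0 mulr1 big1 ?addr0 // => i _.
  by rewrite /= expr0n /= mulr0.
have -> : y 1 = sqrtc (1 + q) ^+ M * binsum a N.+1 q by rewrite /y /S /T mul1r.
have [n1 _] := nS 1 (introT andP (conj ler01 (lexx 1))).
have s0 := S0 1 (introT andP (conj ler01 (lexx 1))).
move: n1 s0; rewrite /S mul1r => n1 s0 h.
have -> : binsum a N.+1 q - sqrtc (1 + q) ^- M =
    (sqrtc (1 + q) ^+ M * binsum a N.+1 q - 1) / sqrtc (1 + q) ^+ M.
  by rewrite mulrBl mul1r mulrAC divff ?mul1r // expf_neq0.
rewrite normrM normfV normrX.
have -> : (2 * (2 ^+ M / (1 - r)) / (1 - r) ^+ M * binrest a N.+1 r)%:C =
   (2 * (2 ^+ M / (1 - r) * binrest a N.+1 r))%:C * (((1 - r)%:C) ^+ M)^-1.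
  have -> : 2 * (2 ^+ M / (1 - r)) / (1 - r) ^+ M * binrest a N.+1 r =
     2 * (2 ^+ M / (1 - r) * binrest a N.+1 r) / (1 - r) ^+ M by ring.
  by rewrite [LHS]rmorphM fmorphV rmorphXn.
have p1 : 0 < (1 - r)%:C :> R[i] by rewrite ltcR subr_gt0.
apply: ler_pM; rewrite ?invr_ge0 ?exprn_ge0 ?normr_ge0 //.
rewrite lef_pV2 ?posrE ?exprn_gt0 ?normr_gt0 //.
apply: lerXn2r; rewrite ?nnegrE ?normr_ge0 ?(ltW p1) //.
rewrite -(ler_pXn2r (n := 2)) ?nnegrE ?normr_ge0 ?(ltW p1) //.
apply: le_trans n1; rewrite -rmorphXn lecR /=; nra.
Qed.

Lemma binsum_uniform (M : nat) (r : R) (e : R) : 0 <= r < 1 -> 0 < e ->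
  \forall N \near \oo, forall q : R[i], `|q| <= r%:C ->
    `|binsum (- (M%:R / 2)) N q - sqrtc (1 + q) ^- M| <= e%:C.
Proof.
move=> r01 e0; have /andP[r0 r1] := r01.
pose K := 2 * (2 ^+ M / (1 - r)) / (1 - r) ^+ M.
have cK : K * binrest (- (M%:R / 2)) N r @[N --> \oo] --> 0.
  rewrite -[X in _ --> X](mulr0 K); apply: cvgMr; exact: binrest_cvg.
have : \forall N \near \oo, K * binrest (- (M%:R / 2)) N r < e.
  exact: (@cvgr_lt _ _ _ _ _ _ cK _ e0).
move=> [N0 _ hN0]; exists N0.+1 => // -[//|N] hN q qr.
apply: le_trans (binsum_error M N r1 qr) _; rewrite lecR; apply/ltW.
by apply: hN0; rewrite /=; exact: ltnW.
Qed.

End BinomialSeries.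

(** * Expansion of a translate of f_k in the functions f_j *)

Section Expansion.
Variable R : realType.
Local Notation uhp := (uhp R).
Implicit Types (z : uhp) (g : SL2 R) (s : Mp R).

Lemma normc_nneg (x : R[i]) : 0 <= Normc.normc x.
Proof. by case: x => a b; exact: sqrtr_ge0. Qed.

(* [bcf k d j s] is the coefficient of [w^j] in                               *)
(* [(be + al w)^k (de + ga w)^(- M / 2)], where [M = d + 2 k] and [de^(1/2)]  *)
(* stands for [Th s].                                                         *)
Definition bU k g i : R[i] := 'C(k, i)%:R * be g ^+ (k - i) * al g ^+ i.

Definition bV M s n : R[i] :=
  (bincoef (- (M%:R / 2)) n)%:C * ga (mp_g s) ^+ n * (Th s)^-1 ^+ (M + 2 * n).

Definition bcf k d j s : R[i] :=
  \sum_(i < j.+1) bU k (mp_g s) i * bV (d + 2 * k) s (j - i).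

Lemma bU_gt k g i : (k < i)%N -> bU k g i = 0.
Proof. by move=> h; rewrite /bU bin_small // !mul0r. Qed.

(** The polynomial is the exact expansion of [(be + al w)^k] times a truncated binomial series for
    the other factor. An error measured relative to [f_0] can be integrated against [f_j] later
    on. *)
Lemma fkm_expansion k d s j (e : R) : 0 < e -> exists p : {poly R[i]},
  p`_j = bcf k d j s /\
  forall z, `|fkm k d (mp_act s z) * mp_eta s z ^- d - \sum_(i < size p) p`_i * fkm i d z|
    <= e%:C * `|fkm 0 d z|.
Proof.
move=> e0; set M := (d + 2 * k)%N.
set g := mp_g s; set q := ga g / de g.
(* [B] bounds the factor [(be + al w)^k Th^(- M)] on the disc, so a binomial error of [e / (1 + B)]
   suffices. *)
pose B := (Normc.normc (be g) + Normc.normc (al g)) ^+ k * Normc.normc (Th s)^-1 ^+ M.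
have B0 : 0 <= B by rewrite mulr_ge0 ?exprn_ge0 ?addr_ge0 ?normc_nneg.
have e'0 : 0 < e / (1 + B) by rewrite divr_gt0 // ltr_pwDl.
have r01 : 0 <= Normc.normc q < 1.
  by rewrite normc_nneg -ltcR; exact: norm_ga_de.
have [N0 _ hN0] := binsum_uniform M r01 e'0.
(* Truncating beyond [j] leaves the coefficient of [w^j] exact. *)
pose N := maxn N0 j.+1.
have hN := hN0 N (leq_maxl _ _).
pose pU := \poly_(i < k.+1) bU k g i.
pose pV := \poly_(i < N) ((bincoef (- (M%:R / 2)) i)%:C * q ^+ i).
pose p := (Th s)^-1 ^+ M *: (pU * pV).
exists p; split.
  rewrite coefZ coefM mulr_sumr; apply: eq_bigr => -[i /= ij] _.
  rewrite !coef_poly.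
  have -> : (j - i < N)%N by rewrite (leq_ltn_trans (leq_subr _ _)) // leq_max ltnSn orbT.
  have -> : (if (i < k.+1)%N then bU k g i else 0) = bU k g i.
    by case: ltnP => // /bU_gt ->.
  rewrite mulrCA; congr (_ * _); rewrite mulrCA /bV -mulrA; congr (_ * _).
  rewrite exprD exprM [(Th s)^-1 ^+ 2]exprVn Th_sqr mulrCA; congr (_ * _).
  by rewrite -exprMn.
move=> z.
have -> : \sum_(i < size p) p`_i * fkm i d z = p.[cay z] * theta z ^- d.
  by rewrite horner_coef mulr_suml; apply: eq_bigr => i _; rewrite fkmE mulrA.
have -> : p.[cay z] = (be g + al g * cay z) ^+ k * (Th s)^-1 ^+ M *
    binsum (- (M%:R / 2)) N (q * cay z).
  rewrite hornerZ hornerM mulrCA -mulrA; congr (_ * _).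
    rewrite horner_poly exprDn; apply: eq_bigr => i _.
    by rewrite /bU -[RHS]mulr_natl [(al g * _) ^+ _]exprMn !mulrA.
  congr (_ * _); rewrite horner_poly; apply: eq_bigr => i _.
  by rewrite [(q * _) ^+ _]exprMn mulrA.
rewrite fkm_act -/g -/q -/M [fkm 0 d z]fkmE expr0 mul1r -mulrBl normrM.
apply: ler_wpM2r => //.
rewrite [(Th s * _) ^+ _]exprMn invfM -[(Th s) ^- M]exprVn [X in `|X - _|]mulrA -mulrBr normrM.
have nq : `|q * cay z| <= (Normc.normc q)%:C.
  by rewrite normrM ler_piMr // ltW // norm_cay.
have := hN _ nq; rewrite distrC => h.
have e1B : 0 <= (e / (1 + B))%:C :> R[i] by rewrite lecR ltW.
apply: (@le_trans _ _ (B%:C * (e / (1 + B))%:C)).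
  apply: ler_pM => //.
  have -> : B%:C = (`|be g| + `|al g|) ^+ k * `|(Th s)^-1| ^+ M.
    by rewrite /B rmorphM !rmorphXn rmorphD.
  rewrite normrM !normrX.
  apply: ler_wpM2r; first exact: exprn_ge0.
  apply: lerXn2r; rewrite ?nnegrE ?addr_ge0 //.
  apply: le_trans (ler_normD _ _) _; rewrite lerD2l normrM ler_piMr //.
  by apply: ltW; exact: norm_cay.
rewrite -rmorphM lecR /= mulrCA ler_piMr ?(ltW e0) // ler_pdivrMr ?mul1r ?lerDr //.
exact: ltr_pwDl.
Qed.

End Expansion.

(** * Lie derivatives *)

Section OneParameter.
Variable R : realType.
Local Notation C := (R[i]^o).
Local Notation uhp := (uhp R).
Local Notation I := (uhp_i R).
Implicit Types (z : uhp) (g : SL2 R) (s : Mp R).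

Lemma is_derive_mxP (M : R -> 'M[R]_2) (X : 'M[R]_2) (t : R) :
  is_derive t 1 M X <-> forall i j, is_derive t 1 (fun x => M x i j) (X i j).
Proof.
split=> [[dM MX] i j|h].
  have dij : derivable (fun x => M x i j) t 1.
    by move/derivable_mxP : dM => /(_ i j).
  by split => //; rewrite -MX derive_mx // mxE.
have dM : derivable M t 1 by apply/derivable_mxP => i j; have [] := h i j.
split => //; rewrite derive_mx //; apply/matrixP => i j; rewrite mxE.
by have [] := h i j.
Qed.

Fact diag_det (t : R) : \det (mx2 (expR (t / 2)) 0 0 (expR (- (t / 2)))) = 1.
Proof.
rewrite (expand_det_row _ 0) !big_ord_recl big_ord0 addr0.
rewrite /cofactor !det_mx11 !mxE /= expr0 mul0r addr0 mul1r.
by rewrite -expRD subrr expR0.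
Qed.

Definition diag_sl2 (t : R) : SL2 R := MkSL2 (diag_det t).

Lemma jfac_diag t z : jfac (diag_sl2 t) z = (expR (- (t / 2)))%:C.
Proof. by rewrite /jfac !mxE /= mul0r add0r. Qed.

Fact diag_sqr (t : R) : (expR (- (t / 4)))%:C ^+ 2 = jfac (diag_sl2 t) 'i%C.
Proof.
rewrite -[X in jfac _ X]/(uhp_val I) jfac_diag -rmorphXn -expRM_natl.
by congr (expR _)%:C; field.
Qed.

Definition diag_mp (t : R) : Mp R := mp_of (diag_sqr t).

Lemma diag_mp_eta t z : mp_eta (diag_mp t) z = (expR (- (t / 4)))%:C.
Proof.
rewrite /= /mp_of_eta -[X in _ / jfac _ X]/(uhp_val I) !jfac_diag.
rewrite divff ?sqrtc1 ?mulr1 //.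
by apply/eqP => -[] /eqP; rewrite gt_eqF ?expR_gt0.
Qed.

Lemma diag_mpD (u t : R) : diag_mp (u + t) = (diag_mp u * diag_mp t)%g.
Proof.
apply: mp_eq.
  apply: sl2_inj; apply/matrixP => i j.
  rewrite [RHS](sl2_mulE (diag_sl2 u) (diag_sl2 t)) !mxE /=.
  case: ifP => _; case: ifP => _; rewrite ?(mulr0, mul0r, addr0, add0r) //.
    by rewrite -expRD mulrDl.
  by rewrite -expRD mulrDl opprD.
rewrite -[RHS]/(mp_eta (diag_mp u) (mp_act (diag_mp t) I) * mp_eta (diag_mp t) I).
by rewrite !diag_mp_eta -rmorphM -expRD mulrDl opprD.
Qed.

(** The diagonal subgroup conjugated by a rotation of angle [p]. Its generator is the symmetric
    traceless matrix [gen (p * 2)]; the real and imaginary parts of [nplus] are of this form, which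
    provides the existence that [mp_exp] relies on. *)
Definition boost (p t : R) : Mp R := (kappa p * diag_mp t * kappa (- p))%g.

Definition gen (phi : R) : 'M[R]_2 :=
  2^-1 *: mx2 (cos phi) (sin phi) (sin phi) (- cos phi).

Lemma boost_g (p t : R) (i j : 'I_2) : mp_g (boost p t) i j =
  Defs.rot p i 0 * expR (t / 2) * Defs.rot (- p) 0 j +
  Defs.rot p i 1 * expR (- (t / 2)) * Defs.rot (- p) 1 j.
Proof.
rewrite [LHS](sl2_mulE (sl2_mul (Defs.rot p) (diag_sl2 t)) (Defs.rot (- p))) !sl2_mulE.
by rewrite [diag_sl2 t 0 0]mxE [diag_sl2 t 0 1]mxE [diag_sl2 t 1 0]mxE [diag_sl2 t 1 1]mxE
  /= !mulr0 add0r addr0.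
Qed.

Lemma ext0_continuous_comp (T : topologicalType) (f : uhp -> R[i]) (c : T -> uhp) t :
  holomorphic f -> {for t, continuous (fun x => uhp_val (c x) : C)} ->
  {for t, continuous (fun x => f (c x) : C)}.
Proof.
move=> hf cc; have -> : (fun x => f (c x)) = (fun x => ext0 f (c x)).
  by apply/funext => x; rewrite ext0E.
exact: (@cvg_comp _ _ _ (fun x => uhp_val (c x)) (ext0 f) (nbhs t)
  (nbhs (uhp_val (c t) : C)) _ cc (holomorphic_continuous hf)).
Qed.

Lemma one_parameter_boost (p : R) : one_parameter (gen (p * 2)) (boost p).
Proof.
split.
- move=> u t; rewrite /boost diag_mpD !mulgA; congr (_ * _)%g.
  by rewrite -!mulgA; congr (_ * (_ * _))%g; rewrite mulgA -kappaD addNr kappa0 mul1g.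
- move=> t.
  have kI (q : R) : mp_act (kappa q) I = I by exact: rot_i.
  have E : (fun t => mp_eta (boost p t) I) = (fun t =>
      mp_eta (kappa p) (mp_act (diag_mp t) I) * ((expR (- (t / 4)))%:C * mp_eta (kappa (- p)) I)).
    apply/funext => u.
    rewrite -[LHS]/(mp_eta (kappa p) (mp_act (diag_mp u) (mp_act (kappa (- p)) I)) *
      mp_eta (diag_mp u) (mp_act (kappa (- p)) I) * mp_eta (kappa (- p)) I).
    by rewrite kI diag_mp_eta mulrA.
  have ce (a : R) : continuous (fun t : R => (expR (t * a))%:C : C).
    move=> u; apply: (@cvg_comp _ _ _ (fun t => expR (t * a)) (real_complex R)
      (nbhs u) (nbhs (expR (u * a)))); last exact: continuous_real_complex.
    apply: (@cvg_comp _ _ _ (fun t => t * a) (@expR R) (nbhs u) (nbhs (u * a))).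
      exact: mulrr_continuous.
    exact: continuous_expR.
  have c1 : {for t, continuous (fun t => mp_eta (kappa p) (mp_act (diag_mp t) I) : C)}.
    have c0 : {for t, continuous (fun t => uhp_val (mp_act (diag_mp t) I) : C)}.
      have -> : (fun t => uhp_val (mp_act (diag_mp t) I)) = (fun t => (expR (t * 1))%:C * 'i%C).
        apply/funext => u; rewrite -[LHS]/(anum (diag_sl2 u) I / jfac (diag_sl2 u) I) jfac_diag /anum !mxE /= addr0 mulr1.
        by rewrite mulrAC -fmorphV -rmorphM /= -expRN opprK -expRD -splitr.
      exact: (forC_M (ce 1 t) (forC_cst 'i%C t)).
    exact: (@ext0_continuous_comp _ (mp_eta (kappa p)) (fun t => mp_act (diag_mp t) I) t (@mp_holo _ (kappa p)) c0).
  have c2 : {for t, continuous (fun t : R => (expR (- (t / 4)))%:C : C)}.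
    have -> : (fun t : R => (expR (- (t / 4)))%:C) = (fun t : R => (expR (t * - 4^-1))%:C).
      by apply/funext => u; rewrite mulrN.
    exact: ce.
  rewrite E.
  exact: (forC_M c1 (forC_M c2 (forC_cst (mp_eta (kappa (- p)) I) t))).
- apply/is_derive_mxP => i j.
  under eq_fun do rewrite boost_g.
  have de (a : R) : is_derive (0 : R) 1 (fun t : R => expR (t * a)) a.
    have h : is_derive (0 : R) (1 : R) (fun t : R => t * a) a.
      have -> : (fun t : R => t * a) = a *: (id : R -> R).
        by apply/funext => u; rewrite mulrC.
      by apply: is_derive_eq; rewrite /GRing.scale /= mulr1.
    have := @is_derive1_comp R (@expR R) (fun t => t * a) 0 _ _ (is_derive_expR (0 * a)) h.
    by rewrite mul0r expR0 mul1r.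
  have d1 := de 2^-1; have d2 := de (- 2^-1).
  have -> : (fun t : R => Defs.rot p i 0 * expR (t / 2) * Defs.rot (- p) 0 j +
      Defs.rot p i 1 * expR (- (t / 2)) * Defs.rot (- p) 1 j) =
    (Defs.rot p i 0 * Defs.rot (- p) 0 j) *: (fun t : R => expR (t * 2^-1)) +
    (Defs.rot p i 1 * Defs.rot (- p) 1 j) *: (fun t : R => expR (t * - 2^-1)).
    apply/funext => u; rewrite !fctE /GRing.scale /= mulrN; ring.
  have := is_deriveD (is_deriveZ (Defs.rot p i 0 * Defs.rot (- p) 0 j) d1)
    (is_deriveZ (Defs.rot p i 1 * Defs.rot (- p) 1 j) d2).
  congr (is_derive _ _ _ _).
  have -> : p * 2 = p + p by ring.
  rewrite /GRing.scale /= /gen !mxE cosD sinD cosN sinN /=.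
  by case: ifP => _; case: ifP => _; field.
Qed.

End OneParameter.

(** * The action of the raising operator on the SU(1,1) entries *)

Section LieDerivative.
Variable R : realType.
Local Notation C := (R[i]^o).
Local Notation uhp := (uhp R).
Local Notation I := (uhp_i R).
Implicit Types (z : uhp) (g : SL2 R) (s : Mp R) (F : Mp R -> R[i]) (X : 'M[R]_2).

(** Quantifying over every subgroup with generator [X] covers the one that [mp_exp] picks by
    choice. *)
Definition drv X F s v := forall c, one_parameter X c ->
  cderiv (fun t => F (s * c t)%g) 0 v.

Lemma one_parameter0 X c : one_parameter X c -> c 0 = 1%g.
Proof. by case=> cD _ _; apply: (mulgI (c 0)); rewrite -cD addr0 mulg1. Qed.

Lemma drv_lie_real X F s v : (exists c, one_parameter X c) -> drv X F s v ->
  lie_real X F s = v.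
Proof.
move=> ex dF; apply: cderiv_cvg_Cderive; apply: dF.
exact: (xgetPex (fun=> 1%g) ex).
Qed.

Lemma drv_entry X s (i j : 'I_2) :
  drv X (fun s => (mp_g s i j)%:C) s ((mp_g s *m X) i j)%:C.
Proof.
move=> c [_ _ /is_derive_mxP dX].
have E : (fun t => (mp_g (s * c t)%g i j)%:C) = (fun t =>
    (mp_g s i 0)%:C * (mp_g (c t) 0 j)%:C + (mp_g s i 1)%:C * (mp_g (c t) 1 j)%:C).
  apply/funext => t.
  by rewrite -[mp_g (s * c t)%g]/(sl2_mul (mp_g s) (mp_g (c t))) sl2_mulE rmorphD !rmorphM.
have -> : ((mp_g s *m X) i j)%:C =
    (mp_g s i 0)%:C * (X 0 j)%:C + (mp_g s i 1)%:C * (X 1 j)%:C.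
  rewrite mxE !big_ord_recl big_ord0 addr0 rmorphD !rmorphM.
  by congr (_ * _ + (mp_g s i _)%:C * (X _ j)%:C); exact/val_inj.
rewrite E; apply: cderivD; apply: cderivZ; apply: cderiv_real; exact: dX.
Qed.

Definition Xgen : 'M[R]_2 := map_mx (@complex.Re R) (nplus R).
Definition Ygen : 'M[R]_2 := map_mx (@complex.Im R) (nplus R).

Lemma half_complex : 2^-1 = (2^-1)%:C :> R[i].
Proof. by rewrite fmorphV rmorph_nat. Qed.

Lemma XgenE : Xgen = 2^-1 *: mx2 1 0 0 (-1).
Proof.
apply/matrixP => i j; rewrite !mxE half_complex.
by case: ifP => _; case: ifP => _; rewrite /= ?mulr0 ?mul0r ?subr0 ?oppr0 ?mulr0 ?subr0.
Qed.

Lemma YgenE : Ygen = 2^-1 *: mx2 0 1 1 0.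
Proof.
apply/matrixP => i j; rewrite !mxE half_complex.
by case: ifP => _; case: ifP => _; rewrite /= ?mulr0 ?mul0r ?addr0 ?oppr0 ?mulr0 ?addr0.
Qed.

Lemma Re_nminus : map_mx (@complex.Re R) (nminus R) = Xgen.
Proof.
apply/matrixP => i j; rewrite XgenE !mxE half_complex.
by case: ifP => _; case: ifP => _; rewrite /= ?mulr0 ?mul0r ?subr0 ?oppr0 ?mulr0 ?subr0.
Qed.

Lemma Im_nminus : map_mx (@complex.Im R) (nminus R) = - Ygen.
Proof.
apply/matrixP => i j; rewrite YgenE !mxE half_complex.
by case: ifP => _; case: ifP => _; rewrite /= ?mulr0 ?mul0r ?addr0 ?oppr0 ?mulrN ?mulr0 ?addr0 ?oppr0.
Qed.

Lemma ex_Xgen : exists c, one_parameter Xgen c.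
Proof.
exists (boost 0); have -> : Xgen = gen (0 * 2 : R) by rewrite XgenE /gen mul0r cos0 sin0.
exact: one_parameter_boost.
Qed.

Lemma ex_Ygen : exists c, one_parameter Ygen c.
Proof.
exists (boost (pi / 4)); have -> : Ygen = gen (pi / 4 * 2 : R).
  have -> : pi / 4 * 2 = pi / 2 :> R by field.
  by rewrite YgenE /gen cos_pihalf sin_pihalf oppr0.
exact: one_parameter_boost.
Qed.

Lemma ex_YgenN : exists c, one_parameter (- Ygen) c.
Proof.
exists (boost (- (pi / 4))); have -> : - Ygen = gen (- (pi / 4) * 2 : R).
  have -> : - (pi / 4) * 2 = - (pi / 2) :> R by field.
  rewrite YgenE /gen cosN sinN cos_pihalf sin_pihalf oppr0 -scalerN; congr (_ *: _).
  by apply/matrixP => i j; rewrite !mxE; case: ifP => _; case: ifP => _; rewrite ?oppr0.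
exact: one_parameter_boost.
Qed.

(* The Lie derivative of [F] along [nplus] exists at [s] and is [v]. The      *)
(* derivative along [- Ygen] serves the conjugate operator [nminus].          *)
Definition lieD F s v := exists x y,
  [/\ drv Xgen F s x, drv Ygen F s y, drv (- Ygen) F s (- y) & v = x + 'i%C * y].

Lemma lieD_lie F s v : lieD F s v -> lie (nplus R) F s = v.
Proof.
move=> [x [y [dx dy _ ->]]].
by rewrite /lie (drv_lie_real ex_Xgen dx) (drv_lie_real ex_Ygen dy).
Qed.

Lemma lieD_lie_conj F s v : lieD F s v ->
  lie (nminus R) (fun s => (F s)^*%C) s = v^*%C.
Proof.
move=> [x [y [dx _ dy ->]]].
have dxc : drv Xgen (fun s => (F s)^*%C) s x^*%C by move=> c /dx/cderiv_conj.
have dyc : drv (- Ygen) (fun s => (F s)^*%C) s (- y)^*%C by move=> c /dy/cderiv_conj.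
rewrite /lie Re_nminus Im_nminus.
rewrite (drv_lie_real ex_Xgen dxc) (drv_lie_real ex_YgenN dyc).
by case: x y {dx dy dxc dyc} => a b [u v'] /=; simpc; congr (_ +i* _); ring.
Qed.

Lemma lieD_cst a s : lieD (fun=> a) s 0.
Proof.
exists 0, 0; split; [by move=> c _; exact: cderiv_cst|by move=> c _; exact: cderiv_cst|
  by rewrite oppr0 => c _; exact: cderiv_cst|by rewrite mulr0 addr0].
Qed.

Lemma lieD_D F G s v w : lieD F s v -> lieD G s w -> lieD (fun s => F s + G s) s (v + w).
Proof.
move=> [x [y [dx dy dy' ->]]] [x' [y' [ex ey ey' ->]]].
exists (x + x'), (y + y'); split.
- by move=> c hc; exact: cderivD (dx c hc) (ex c hc).
- by move=> c hc; exact: cderivD (dy c hc) (ey c hc).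
- by rewrite opprD => c hc; exact: cderivD (dy' c hc) (ey' c hc).
- by rewrite mulrDr addrACA.
Qed.

Lemma lieD_M F G s v w : lieD F s v -> lieD G s w ->
  lieD (fun s => F s * G s) s (F s * w + v * G s).
Proof.
move=> [x [y [dx dy dy' ->]]] [x' [y' [ex ey ey' ->]]].
have aux X u u' : drv X F s u -> drv X G s u' -> drv X (fun s => F s * G s) s (F s * u' + u * G s).
  move=> h h' c hc; have := cderivM (h c hc) (h' c hc).
  by rewrite (one_parameter0 hc) mulg1.
exists (F s * x' + x * G s), (F s * y' + y * G s); split.
- exact: aux.
- exact: aux.
- by have := aux _ _ _ dy' ey'; rewrite mulrN mulNr -opprD.
- by ring.
Qed.

Lemma lieD_Z a F s v : lieD F s v -> lieD (fun s => a * F s) s (a * v).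
Proof. by move=> /(lieD_M (lieD_cst a s)); rewrite mul0r addr0. Qed.

Lemma lieD_X F s v n : lieD F s v -> lieD (fun s => F s ^+ n) s (n%:R * F s ^+ n.-1 * v).
Proof.
move=> dF; elim: n => [|n /(lieD_M dF)]; first by rewrite mul0r mul0r; exact: lieD_cst.
under eq_fun do rewrite -exprS.
congr lieD; case: n => [|n] /=; first by rewrite expr0; ring.
rewrite -(natr1 n.+1) exprS; ring.
Qed.

Lemma lieD_sum n (f : 'I_n -> Mp R -> R[i]) (v : 'I_n -> R[i]) s :
  (forall i, lieD (f i) s (v i)) -> lieD (fun x => \sum_i f i x) s (\sum_i v i).
Proof.
elim: n f v => [|n IH] f v h.
  by rewrite big_ord0; under eq_fun do rewrite big_ord0; exact: lieD_cst.
rewrite big_ord_recr; under eq_fun do rewrite big_ord_recr.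
exact: (lieD_D (IH _ _ (fun i => h (widen_ord (leqnSn n) i))) (h ord_max)).
Qed.

(** A left-invariant operator acts on the matrix of coordinate functions by right multiplication,
    here by [nplus]. *)
Lemma lieD_entry s (i j : 'I_2) : lieD (fun s => (mp_g s i j)%:C) s
  (2^-1 * if j == 0 then (mp_g s i 0)%:C + 'i%C * (mp_g s i 1)%:C
          else 'i%C * (mp_g s i 0)%:C - (mp_g s i 1)%:C).
Proof.
exists ((mp_g s *m Xgen) i j)%:C, ((mp_g s *m Ygen) i j)%:C; split.
- exact: drv_entry.
- exact: drv_entry.
- have -> : - ((mp_g s *m Ygen) i j)%:C = ((mp_g s *m - Ygen) i j)%:C.
    by rewrite mulmxN [in RHS]mxE rmorphN.
  exact: drv_entry.
rewrite !mxE !big_ord_recl !big_ord0 !addr0 XgenE YgenE.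
have -> : lift ord0 ord0 = 1 :> 'I_2 by exact/val_inj.
rewrite !mxE half_complex /=.
case: ifP => _; rewrite !(mulr1, mulr0, addr0, add0r, mulrN1) /=.
  by simpc; congr (_ +i* _); ring.
by simpc; congr (_ +i* _); ring.
Qed.

Lemma deE s : de (mp_g s) = 2^-1 * ((mp_g s 0 0)%:C + (mp_g s 1 1)%:C +
  ('i%C * (mp_g s 1 0)%:C + - 'i%C * (mp_g s 0 1)%:C)).
Proof. by rewrite half_complex /de; simpc; congr (_ +i* _); ring. Qed.

Lemma gaE s : ga (mp_g s) = 2^-1 * ((mp_g s 0 0)%:C + -1 * (mp_g s 1 1)%:C +
  ('i%C * (mp_g s 1 0)%:C + 'i%C * (mp_g s 0 1)%:C)).
Proof. by rewrite half_complex /ga; simpc; congr (_ +i* _); ring. Qed.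

Lemma alE s : al (mp_g s) = 2^-1 * ((mp_g s 0 0)%:C + (mp_g s 1 1)%:C +
  (- 'i%C * (mp_g s 1 0)%:C + 'i%C * (mp_g s 0 1)%:C)).
Proof. by rewrite half_complex /al /de; simpc; congr (_ +i* _); ring. Qed.

Lemma beE s : be (mp_g s) = 2^-1 * ((mp_g s 0 0)%:C + -1 * (mp_g s 1 1)%:C +
  (- 'i%C * (mp_g s 1 0)%:C + - 'i%C * (mp_g s 0 1)%:C)).
Proof. by rewrite half_complex /be /ga; simpc; congr (_ +i* _); ring. Qed.

Lemma lieD_lin (p q r : R[i]) s : lieD (fun s => 2^-1 * ((mp_g s 0 0)%:C + p * (mp_g s 1 1)%:C +
    (q * (mp_g s 1 0)%:C + r * (mp_g s 0 1)%:C))) s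
  (2^-1 * (2^-1 * ((mp_g s 0 0)%:C + 'i%C * (mp_g s 0 1)%:C) +
    p * (2^-1 * ('i%C * (mp_g s 1 0)%:C - (mp_g s 1 1)%:C)) +
    (q * (2^-1 * ((mp_g s 1 0)%:C + 'i%C * (mp_g s 1 1)%:C)) +
     r * (2^-1 * ('i%C * (mp_g s 0 0)%:C - (mp_g s 0 1)%:C))))).
Proof.
apply: lieD_Z; apply: lieD_D; apply: lieD_D.
- exact: (lieD_entry s 0 0).
- by apply: lieD_Z; exact: (lieD_entry s 1 1).
- by apply: lieD_Z; exact: (lieD_entry s 1 0).
- by apply: lieD_Z; exact: (lieD_entry s 0 1).
Qed.

(** The Cayley transform conjugates [nplus] to the elementary matrix whose right multiplication
    replaces the second column of [[[al, be], [ga, de]]] by the first, and the first by zero. The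
    next three lemmas are the other entries. *)
Lemma lieD_de s : lieD (fun s => de (mp_g s)) s (ga (mp_g s)).
Proof.
under eq_fun do rewrite deE -[X in _ + X + _]mul1r.
have := lieD_lin 1 'i%C (- 'i%C) s; congr lieD.
by rewrite gaE half_complex; simpc; congr (_ +i* _); field.
Qed.

Lemma lieD_ga s : lieD (fun s => ga (mp_g s)) s 0.
Proof.
under eq_fun do rewrite gaE.
have := lieD_lin (-1) 'i%C 'i%C s; congr lieD.
by rewrite half_complex; simpc; congr (_ +i* _); field.
Qed.

Lemma lieD_al s : lieD (fun s => al (mp_g s)) s 0.
Proof.
under eq_fun do rewrite alE -[X in _ + X + _]mul1r.
have := lieD_lin 1 (- 'i%C) 'i%C s; congr lieD.
by rewrite half_complex; simpc; congr (_ +i* _); field.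
Qed.

Lemma lieD_be s : lieD (fun s => be (mp_g s)) s (al (mp_g s)).
Proof.
under eq_fun do rewrite beE.
have := lieD_lin (-1) (- 'i%C) (- 'i%C) s; congr lieD.
by rewrite alE half_complex; simpc; congr (_ +i* _); field.
Qed.

(** Continuity of [eta] at [i] along a one-parameter subgroup is part of [one_parameter]; it enters
    here, to let [cderiv_sqrt] differentiate [Th] as a square root of [de]. *)
Lemma Th_continuous X c s : one_parameter X c ->
  {for 0, continuous (fun t : R => Th (s * c t)%g : C)}.
Proof.
move=> hc; have [_ ceta /is_derive_mxP dX] := hc.
have ce i j : {for 0, continuous (fun t : R => (mp_g (c t) i j)%:C : C)}.
  exact: (cderiv_continuous (cderiv_real (dX i j))).
pose w t := mp_act (c t) I.
have cw : {for 0, continuous (fun t : R => uhp_val (w t) : C)}.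
  have cj (i : 'I_2) : {for 0, continuous (fun t : R =>
      (mp_g (c t) i 0)%:C * 'i%C + (mp_g (c t) i 1)%:C : C)}.
    exact: (forC_D (forC_M (ce i 0) (forC_cst 'i%C (0 : R))) (ce i 1)).
  have j0 : (mp_g (c 0) 1 0)%:C * 'i%C + (mp_g (c 0) 1 1)%:C != 0 :> R[i].
    exact: (jfac_neq0 (mp_g (c 0)) I).
  exact: (forC_M (cj 0) (forC_V j0 (cj 1))).
have E : (fun t => Th (s * c t)%g) = (fun t =>
    (theta (mp_act s (w t)) * mp_eta s (w t)) * mp_eta (c t) I).
  apply/funext => t; rewrite /Th.
  rewrite -[mp_eta (s * c t)%g I]/(mp_eta s (w t) * mp_eta (c t) I) mulrA.
  by congr (theta (uhp_val _) * _ * _); exact: moebius_mul.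
rewrite E; apply: forC_M; last exact: ceta.
apply: (@ext0_continuous_comp _ _ (fun z => theta (mp_act s z) * mp_eta s z) w 0 _ cw).
apply: holomorphicM; last exact: mp_holo.
exact: (@holomorphic_moebius _ (fun z => theta z) _ (@holomorphic_theta R)).
Qed.

(** Differentiating [Th ^+ 2 = de] along each generator gives [Th' = de' / (2 Th)], and [nplus]
    sends [de] to [ga]. *)
Lemma lieD_ThV s : lieD (fun s => (Th s)^-1) s (- (ga (mp_g s) / 2) * (Th s)^-1 ^+ 3).
Proof.
have [x [y [dx dy dy' e]]] := lieD_de s.
have h0 := Th_neq0 s.
have aux X v : drv X (fun s => de (mp_g s)) s v ->
    drv X (fun s => (Th s)^-1) s (- (v / (2 * Th s)) / Th s ^+ 2).
  move=> h c hc; have cT := @Th_continuous X c s hc.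
  have T0 : Th (s * c 0)%g = Th s by rewrite (one_parameter0 hc) mulg1.
  have d1 : cderiv (fun t => Th (s * c t)%g) 0 (v / (2 * Th s)).
    rewrite -T0; apply: cderiv_sqrt => //; first by rewrite T0.
    under eq_fun do rewrite Th_sqr; exact: h.
  by rewrite -{2}T0; apply: cderivV; rewrite ?T0.
exists (- (x / (2 * Th s)) / Th s ^+ 2), (- (y / (2 * Th s)) / Th s ^+ 2); split.
- exact: aux.
- exact: aux.
- by have := aux _ _ dy'; rewrite !mulNr !opprK.
- by rewrite e; field.
Qed.

End LieDerivative.

(** * Iterating the raising operator *)

Section RaisingOperator.
Variable R : realType.
Implicit Types (s : Mp R).

(** Sending [be] to [al] differentiates [be + al w] in [w], so on the coefficients of
    [(be + al w)^k] the operator acts as [d/dw] does: the one of index [i] becomes [i + 1] times the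
    next. [lieD_bV] is the same for [(de + ga w)^(- M / 2)]. *)
Lemma lieD_bU k i s : lieD (fun s => bU k (mp_g s) i) s (i.+1%:R * bU k (mp_g s) i.+1).
Proof.
have := lieD_M (lieD_Z 'C(k, i)%:R (lieD_X (k - i) (lieD_be s))) (lieD_X i (lieD_al s)).
congr lieD; rewrite !mulr0 add0r /bU.
have -> : i.+1%:R * ('C(k, i.+1)%:R * be (mp_g s) ^+ (k - i.+1) * al (mp_g s) ^+ i.+1) =
   (i.+1 * 'C(k, i.+1))%:R * (be (mp_g s) ^+ (k - i.+1) * al (mp_g s) ^+ i.+1).
  by rewrite natrM !mulrA.
by rewrite mul_bin_left natrM subnS exprS; ring.
Qed.

Lemma lieD_bV M n s : lieD (fun s => bV M s n) s (n.+1%:R * bV M s n.+1).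
Proof.
have := lieD_M (lieD_Z (bincoef (- (M%:R / 2)) n)%:C (lieD_X n (lieD_ga s)))
  (lieD_X (M + 2 * n) (lieD_ThV s)).
congr lieD; rewrite !mulr0 mul0r addr0 /bV.
have e1 : (n.+1%:R : R[i]) * (bincoef (- (M%:R / 2)) n.+1)%:C =
    - ((M + 2 * n)%:R / 2) * (bincoef (- (M%:R / 2)) n)%:C.
  rewrite -[n.+1%:R](rmorph_nat (real_complex R)) -rmorphM bincoefS rmorphM; congr (_ * _).
  rewrite rmorphB rmorphN rmorphM fmorphV !rmorph_nat natrD natrM; by field.
(* The exponent [(M + 2 * n).-1] is truncated when [M + 2 * n = 0], but then the leading factor
   vanishes. *)
have e2 : (M + 2 * n)%:R * ((Th s)^-1 ^+ (M + 2 * n).-1 * (Th s)^-1 ^+ 3) =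
   (M + 2 * n)%:R * (Th s)^-1 ^+ (M + 2 * n.+1) :> R[i].
  have -> : (M + 2 * n.+1 = (M + 2 * n).+2)%N by rewrite mulnS addnCA.
  by case: (M + 2 * n)%N => [|N]; rewrite ?mul0r // -exprD addnC.
transitivity ((bincoef (- (M%:R / 2)) n)%:C * ga (mp_g s) ^+ n * - (ga (mp_g s) / 2) *
    ((M + 2 * n)%:R * ((Th s)^-1 ^+ (M + 2 * n).-1 * (Th s)^-1 ^+ 3))); first by ring.
rewrite e2 !mulrA e1 exprS; ring.
Qed.

(** The Leibniz rule for a product of two series: in the convolution the weight [j + 1] splits as
    [(j + 1 - i) + i], one part for each factor. *)
Lemma lieD_bcf k d j s : lieD (bcf k d j) s (j.+1%:R * bcf k d j.+1 s).
Proof.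
have := lieD_sum (fun i : 'I_j.+1 => lieD_M (lieD_bU k i s) (lieD_bV (d + 2 * k) (j - i) s)).
congr lieD; rewrite big_split /= /bcf.
have -> : j.+1%:R * (\sum_(i < j.+2) bU k (mp_g s) i * bV (d + 2 * k) s (j.+1 - i)) =
    \sum_(i < j.+2) (j.+1 - i)%:R * (bU k (mp_g s) i * bV (d + 2 * k) s (j.+1 - i)) +
    \sum_(i < j.+2) i%:R * (bU k (mp_g s) i * bV (d + 2 * k) s (j.+1 - i)).
  rewrite mulr_sumr -big_split; apply: eq_bigr => -[i /= ij] _.
  by rewrite -mulrDl -natrD subnK.
rewrite [X in _ = X + _]big_ord_recr [X in _ = _ + X]big_ord_recl /= subnn !mul0r addr0 add0r.
congr (_ + _); apply: eq_bigr => -[i /= ij] _; last by rewrite /bump /= add1n subSS mulrA.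
by rewrite subSn // mulrCA.
Qed.

Lemma iter_lie_nplus k d j :
  iter j (lie (nplus R)) (Fkm k d) = (fun s => j`!%:R * bcf k d j s).
Proof.
elim: j => [|j IH].
  apply/funext => s; rewrite /= FkmE /bcf big_ord_recl big_ord0 addr0 /bU /bV /=.
  by rewrite bin0 subn0 bincoef0 muln0 addn0 !expr0 !mul1r !mulr1.
apply/funext => s; rewrite iterS IH (lieD_lie (lieD_Z _ (lieD_bcf k d j s))).
by rewrite mulrA -natrM mulnC -factS.
Qed.

Lemma iter_lie_nminus k d j :
  iter j (lie (nminus R)) (fun s => (Fkm k d s)^*%C) =
  (fun s => (j`!%:R * bcf k d j s)^*%C).
Proof.
elim: j => [|j IH].
  apply/funext => s; exact: (congr1 (fun F => (F s)^*%C) (iter_lie_nplus k d 0)).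
apply/funext => s; rewrite iterS IH (lieD_lie_conj (lieD_Z _ (lieD_bcf k d j s))).
by rewrite mulrA -natrM mulnC -factS.
Qed.

(* On the diagonal subgroup the function is, up to a nonzero factor, a        *)
(* nonzero polynomial in [T = ga / de], which takes infinitely many values.   *)
Lemma bcf_neq0 k d j : (0 < d)%N -> exists s, bcf k d j s != 0.
Proof.
have aux (K : fieldType) (A T c b t : K) u v i : c != 0 ->
    A * (T * c) ^+ u * c ^+ i * (b * (T * c) ^+ v * (t * c^-1 ^+ v)) =
    t * (c ^+ u * c ^+ i) * (A * b * (T ^+ u * T ^+ v)).
  by move=> /(expf_neq0 v) c0; rewrite !exprMn exprVn; field.
have tanhE (E : R) : 0 < E -> (E - E^-1) / 2 = (E * E - 1) / (E * E + 1) * ((E + E^-1) / 2).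
  move=> E0; have h1 : E != 0 by rewrite gt_eqF.
  have h2 : E * E + 1 != 0 by rewrite gt_eqF // addr_gt0 // mulr_gt0.
  by field; rewrite h1.
move=> d0; set M := (d + 2 * k)%N.
pose a := - (M%:R / 2) : R.
have a0 : a < 0 by rewrite oppr_lt0 divr_gt0 // ltr0n addn_gt0 d0.
pose m := minn j k.
pose P : {poly R} := \sum_(i < m.+1) ('C(k, i)%:R * bincoef a (j - i)) *: 'X^(k + j - 2 * i).
have mj : (m <= j)%N by exact: geq_minl.
have mk : (m <= k)%N by exact: geq_minr.
(* The lowest power of [P] comes from [i = m] alone. Its coefficient is nonzero, because [m <= k]
   and because [bincoef] does not vanish at a negative argument. *)
have P0 : P != 0.
  apply/eqP => /(congr1 (fun p : {poly R} => p`_(k + j - 2 * m))).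
  rewrite coef0 coef_sum big_ord_recr /= big1 ?add0r => [|[i /= im] _].
    rewrite coefZ coefXn eqxx mulr1 => /eqP.
    by rewrite mulf_eq0 (negbTE (bincoef_neq0 _ a0)) orbF pnatr_eq0 -leqn0 leqNgt bin_gt0 mk.
  rewrite coefZ coefXn; case: eqP => [|_]; last by rewrite mulr0.
  lia.
apply: contrapT => /forallNP h.
have root_T (t : R) : root P ((expR t - 1) / (expR t + 1)).
  have := h (diag_mp t) => /negP; rewrite negbK => /eqP.
  set s := diag_mp t; set T := _ / _.
  pose c : R := (expR (t / 2) + expR (- (t / 2))) / 2.
  have c0 : c != 0 by rewrite gt_eqF // divr_gt0 // addr_gt0 ?expR_gt0.
  have deE' : de (mp_g s) = c%:C.
    by rewrite /de !mxE /= subr0 mul0r.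
  have alE' : al (mp_g s) = c%:C by rewrite /al deE' /= oppr0.
  have gaE' : ga (mp_g s) = T%:C * c%:C.
    rewrite /ga !mxE /= addr0 mul0r -rmorphM /=; congr (_ %:C).
    rewrite /T /c [X in expR X - 1](splitr t) [X in expR X + 1](splitr t) expRD expRN.
    exact: tanhE (expR_gt0 _).
  have beE' : be (mp_g s) = T%:C * c%:C.
    by rewrite /be gaE' -rmorphM /= oppr0.
  have cC0 : c%:C != 0 :> R[i] by apply/eqP => -[] /eqP; rewrite (negbTE c0).
  have : bcf k d j s = (Th s)^-1 ^+ M * c%:C ^+ k * (P.[T])%:C.
    rewrite /P horner_sum rmorph_sum mulr_sumr /bcf.
    rewrite (big_ord_widen j.+1 (fun i => (Th s)^-1 ^+ M * c%:C ^+ k *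
      ((('C(k, i)%:R * bincoef a (j - i)) *: 'X^(k + j - 2 * i)).[T])%:C)) ?ltnS //.
    rewrite [RHS]big_mkcond; apply: eq_bigr => -[i /= ij] _.
    case: ltnP => im; last first.
      have ki : (k < i)%N by move: im ij; rewrite /m; lia.
      by rewrite bU_gt // mul0r.
    have ik : (i <= k)%N by move: im; rewrite /m; lia.
    rewrite hornerZ hornerXn /bU /bV -/M beE' alE' gaE'.
    have -> : (k + j - 2 * i = (k - i) + (j - i))%N by lia.
    have -> : ('C(k, i)%:R * bincoef a (j - i) * T ^+ (k - i + (j - i)))%:C =
        'C(k, i)%:R * (bincoef a (j - i))%:C * (T%:C ^+ (k - i) * T%:C ^+ (j - i)).
      by rewrite 2!rmorphM rmorphXn rmorph_nat -exprD.
    have -> : c%:C ^+ k = c%:C ^+ (k - i) * c%:C ^+ i :> R[i] by rewrite -exprD subnK.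
    have -> : (Th s)^-1 ^+ (M + 2 * (j - i)) = (Th s)^-1 ^+ M * c%:C^-1 ^+ (j - i).
      by rewrite exprD exprM [(Th s)^-1 ^+ 2]exprVn Th_sqr deE'.
    exact: aux.
  move=> -> /eqP; rewrite !mulf_eq0 !expf_eq0 invr_eq0 (negbTE (Th_neq0 s)) (negbTE cC0) !andbF /=.
  by move=> /eqP[] /eqP.
pose x (n : nat) : R := (expR n%:R - 1) / (expR n%:R + 1).
have x_inj : injective x.
  have p (n : nat) : expR n%:R + 1 != 0 :> R by rewrite gt_eqF // addr_gt0 ?expR_gt0.
  move=> n n' /eqP; rewrite /x eqr_div ?p // => /eqP e.
  have /expR_inj/eqP : expR n%:R = expR n'%:R :> R by lra.
  by rewrite eqr_nat => /eqP.
have rts : all (root P) [seq x n | n <- iota 0 (size P)].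
  by apply/allP => _ /mapP[n _ ->]; exact: root_T.
have urs : uniq [seq x n | n <- iota 0 (size P)] by rewrite map_inj_uniq ?iota_uniq.
by have := max_poly_roots P0 rts urs; rewrite size_map size_iota ltnn.
Qed.

End RaisingOperator.

(** * The invariant measure *)

Section Measurability.
Variable R : realType.
Local Notation mR := (measurableTypeR R).

Lemma open_prod_measurable (U : set (R * R)) : open U ->
  measurable (U : set (mR * mR)).
Proof.
move=> oU.
pose box (q : rat * rat * (rat * rat)) : set (mR * mR) :=
  `]ratr q.1.1, ratr q.1.2[%classic `*` `]ratr q.2.1, ratr q.2.2[%classic.
pose F q : set (mR * mR) := if `[< box q `<=` U >] then box q else set0.
have -> : U = \bigcup_q F q.
  apply/seteqP; split => [[x y] Uxy|p [q _]]; last first.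
    by rewrite /F; case: asboolP => // bU /bU.
  have : nbhs (x, y) U by exact: open_nbhs_nbhs.
  move=> /nbhs_ballP[e /= e0 he].
  have ex (t : R) : exists a b : rat, [/\ ratr a < t, t < ratr b &
      forall u, ratr a < u < ratr b -> ball t e u].
    have [a] := @rat_in_itvoo R (t - e) t ltac:(lra).
    have [b] := @rat_in_itvoo R t (t + e) ltac:(lra).
    rewrite !in_itv /= => /andP[b1 b2] /andP[a1 a2].
    exists a, b; split => // u /andP[u1 u2].
    by rewrite /ball /= ltr_norml; apply/andP; split; lra.
  have [a [b [ax xb hx]]] := ex x; have [c [d [cy yd hy]]] := ex y.
  exists ((a, b), (c, d)) => //; rewrite /F.
  have bx : box ((a, b), (c, d)) (x, y) by split; rewrite /= in_itv /=; apply/andP.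
  case: asboolP => // -[]; move=> [u v] [/=]; rewrite !in_itv /= => uab vcd.
  by apply: he; split; [exact: hx|exact: hy].
apply: countable_bigcupT_measurable => // q; rewrite /F; case: asboolP => // _.
by apply: measurableX; exact: measurable_itv.
Qed.

Definition HP : set (R * R) := [set p | 0 < p.2].

Lemma open_HP : open HP.
Proof.
have -> : HP = (@snd R R) @^-1` [set y : R | 0 < y] by [].
apply: open_comp; last exact: open_gt.
by move=> p _; exact: cvg_snd.
Qed.

Lemma measurable_HP : measurable (HP : set (mR * mR)).
Proof. exact: open_prod_measurable open_HP. Qed.

Lemma HP_continuous_measurable (f : R * R -> R) :
  (forall p, 0 < p.2 -> {for p, continuous f}) ->
  measurable_fun (HP : set (mR * mR)) (f : mR * mR -> R).
Proof.
move=> cf; apply: (measurability _ (measurable_realfun.RGenOpens.measurableE R)).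
move=> _ [_ [a [b ->] <-]]; apply: open_prod_measurable.
rewrite openE => p [/= p0 fp].
apply: filterI; first by apply: open_nbhs_nbhs; split => //; exact: open_HP.
have /cf h := p0; apply: h.
by apply: open_nbhs_nbhs; split => //; exact: interval_open.
Qed.

End Measurability.

(** * Substitutions in one variable *)

Section OneVariable.
Variable R : realType.
Local Notation mu := (@lebesgue_measure R).
Local Open Scope ereal_scope.

Lemma affine_substitution (a b : R) (G : R -> R) : (0 < a)%R -> continuous G ->
  (forall x, 0 <= G x)%R ->
  \int[mu]_x (G x)%:E = \int[mu]_x (G (a * x + b) * a)%:E.
Proof.
move=> a0 cG G0.
pose F (x : R) := (a * x + b)%R.
have dF (x : R) : is_derive x 1%R F a.
  have -> : F = (a *: (id : R -> R) + cst b)%R by apply/funext.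
  have := is_deriveD (is_deriveZ a (is_derive_id x 1%R)) (is_derive_cst b x 1%R).
  by rewrite addr0 /GRing.scale /= mulr1.
have F' : F^`()%classic = cst a.
  by apply/funext => x; rewrite derive1E; have [] := dF x.
rewrite (@increasing_ge0_integration_by_substitutionT _ F G) //.
- by apply: eq_integral => x _; rewrite F'.
- by move=> x y xy; rewrite /F ltrD2r ltr_pM2l.
- by rewrite F' => x; exact: cst_continuous.
- by rewrite F'; exact: is_cvg_cst.
- by rewrite F'; exact: is_cvg_cst.
- apply/cvgrNyPle => A; near=> x; rewrite /F.
  suff : (a * x <= A - b)%R by lra.
  rewrite -ler_pdivlMl // mulrC; near: x; apply: nbhs_ninfty_le; exact: num_real.
- apply/cvgryPge => A; near=> x; rewrite /F.
  suff : (A - b <= a * x)%R by lra.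
  rewrite -ler_pdivrMl // mulrC; near: x; apply: nbhs_pinfty_ge; exact: num_real.
Unshelve. all: by end_near. Qed.

Lemma reflection_integral (G : R -> \bar R) : measurable_fun [set: R] G ->
  (forall x, 0 <= G x) -> \int[mu]_x G (- x)%R = \int[mu]_x G x.
Proof.
move=> mG G0.
have -> : \int[mu]_x G x = \int[pushforward mu (-%R : _ -> measurableTypeR R)]_x G x.
  by apply: eq_measure_integral => A mA _; apply/esym/lebesgue_measureN.
rewrite ge0_integral_pushforward ?preimage_setT //.
Qed.

(** The two free constants let [y |-> c / y] carry one such exhaustion of the half-line exactly onto
    another. *)
Lemma positive_exhaustion (c1 c2 : R) (h : R -> \bar R) : (0 < c1)%R -> (0 < c2)%R ->
  measurable_fun (`]0%R, +oo[%classic : set R) h ->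
  (forall y, (0 < y)%R -> 0 <= h y) ->
  \int[mu]_(y in `[(c1 / n.+1%:R)%R, (c2 * n.+1%:R)%R]) h y @[n --> \oo] -->
  \int[mu]_(y in `]0%R, +oo[) h y.
Proof.
move=> c10 c20 mh h0.
pose F (n : nat) : set R := `[(c1 / n.+1%:R)%R, (c2 * n.+1%:R)%R]%classic.
have FE : `]0%R, +oo[%classic = \bigcup_n F n.
  apply/seteqP; split => [y|y [n _]] /=; rewrite !in_itv /= ?andbT.
    move=> y0; exists (maxn (Num.truncn (c1 / y)) (Num.truncn (y / c2))) => //.
    rewrite /F /= in_itv /=; apply/andP; split.
      rewrite ler_pdivrMr ?ltr0n // mulrC -ler_pdivrMr //.
      by apply/ltW/(lt_le_trans (truncnS_gt _)); rewrite ler_nat ltnS leq_maxl.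
    rewrite mulrC -ler_pdivrMr //.
    by apply/ltW/(lt_le_trans (truncnS_gt _)); rewrite ler_nat ltnS leq_maxr.
  by rewrite /F /= in_itv /= => /andP[h1 _]; apply: lt_le_trans h1; rewrite divr_gt0.
have FS n : F n `<=` `]0%R, +oo[%classic by rewrite FE; exact: bigcup_sup.
rewrite FE; apply: ge0_nondecreasing_set_cvg_integral.
- move=> m n mn; rewrite subsetEset => y; rewrite /F /= !in_itv /= => /andP[h1 h2].
  apply/andP; split.
    by apply: le_trans h1; rewrite ler_pM2l // lef_pV2 ?posrE ?ltr0n // ler_nat ltnS mn.
  by apply: (le_trans h2); rewrite ler_pM2l // ler_nat ltnS.
- by move=> n; exact: measurable_itv.
- by move=> n; apply: (measurable_funS _ (FS n) mh); exact: measurable_itv.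
- by move=> n y /FS; rewrite /= in_itv /= andbT => /h0.
Qed.

(** The measure [dy / y] is invariant under [y |-> c / y]. The decreasing substitution maps the
    interval from [1 / n] to [n] onto the one from [c / n] to [c n], and [n] tends to infinity. *)
Lemma inverse_substitution (c : R) (g : R -> R) : (0 < c)%R ->
  (forall y, 0 < y -> {for y, continuous g})%R -> (forall y, 0 < y -> 0 <= g y)%R ->
  \int[mu]_(y in `]0%R, +oo[) (g (c / y) / y)%:E = \int[mu]_(y in `]0%R, +oo[) (g y / y)%:E.
Proof.
move=> c0 cg g0.
pose G (x : R) := (g x / x)%R.
pose F (y : R) := (c / y)%R.
have cG (y : R) : (0 < y)%R -> {for y, continuous G}.
  move=> y0; apply: cvgM; first exact: cg.
  by apply: cvgV; [rewrite gt_eqF|exact: cvg_id].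
have dF (y : R) : (0 < y)%R -> is_derive y 1%R F (- (c / y ^+ 2))%R.
  move=> y0; have y1 : y != 0%R by rewrite gt_eqF.
  have := is_deriveZ c (@is_deriveV R (id : R -> R) y 1%R 1%R y1 (is_derive_id y 1%R)).
  congr (is_derive _ _ _ _).
  by rewrite /GRing.scale /= mulr1 mulrN.
have cF (y : R) : (0 < y)%R -> {for y, continuous F}.
  move=> y0; apply: cvgM; first exact: cvg_cst.
  by apply: cvgV; [rewrite gt_eqF|exact: cvg_id].
have cGF (y : R) : (0 < y)%R -> {for y, continuous (fun y : R => g (c / y) / y)%R}.
  move=> y0; apply: cvgM; last by apply: cvgV; [rewrite gt_eqF|exact: cvg_id].
  apply: (@cvg_comp _ _ _ F g (nbhs y) (nbhs (F y))); first exact: cF.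
  by apply: cg; rewrite divr_gt0.
have cF' (y : R) : (0 < y)%R -> {for y, continuous F^`()%classic}.
  move=> y0; have E (x : R) : (0 < x)%R -> F^`()%classic x = (- (c / x ^+ 2))%R.
    by move=> x0; rewrite derive1E; have [_ ->] := dF x x0.
  rewrite /prop_for /continuous_at (E y y0).
  have c1 : (- (c / x ^+ 2))%R @[x --> y] --> (- (c / y ^+ 2))%R.
    apply: cvgN; apply: cvgM; first exact: cvg_cst.
    by apply: cvgV; [rewrite expf_neq0 // gt_eqF|exact: exprn_continuous].
  apply: cvg_trans c1; apply: near_eq_cvg.
  near=> x; rewrite E //; near: x; exact: lt_nbhsr.
have mG (h : R -> R) : (forall y, (0 < y)%R -> {for y, continuous h}) ->
    measurable_fun (`]0%R, +oo[%classic : set R) (EFin \o h).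
  move=> ch; apply/measurable_EFinP; apply: open_continuous_measurable_fun.
    exact: interval_open.
  by move=> y; rewrite inE /= in_itv /= andbT; exact: ch.
have h1 : \int[mu]_(y in `[(1 / n.+1%:R)%R, (1 * n.+1%:R)%R]) (g (c / y) / y)%:E @[n --> \oo] -->
    \int[mu]_(y in `]0%R, +oo[) (g (c / y) / y)%:E.
  apply: positive_exhaustion => //; first exact: mG.
  by move=> y y0; rewrite lee_fin divr_ge0 ?(ltW y0) // g0 // divr_gt0.
have h2 : \int[mu]_(y in `[(c / n.+1%:R)%R, (c * n.+1%:R)%R]) (g y / y)%:E @[n --> \oo] -->
    \int[mu]_(y in `]0%R, +oo[) (g y / y)%:E.
  apply: positive_exhaustion => //; first exact: mG.
  by move=> y y0; rewrite lee_fin divr_ge0 ?(ltW y0) // g0.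
have E : (fun n : nat => \int[mu]_(y in `[(1 / n.+1%:R)%R, (1 * n.+1%:R)%R]) (g (c / y) / y)%:E) =
    (fun n : nat => \int[mu]_(y in `[(c / n.+1%:R)%R, (c * n.+1%:R)%R]) (g y / y)%:E).
  apply/funext => n.
  set a := (1 / n.+1%:R)%R; set b := (1 * n.+1%:R)%R.
  have a0 : (0 < a)%R by rewrite divr_gt0.
  have ab : (a <= b)%R.
    rewrite /a /b !mul1r; apply: (@le_trans _ _ 1%R); last by rewrite ler1n.
    by rewrite invf_le1 ?ltr0n // ler1n.
  have b0 : (0 < b)%R by exact: lt_le_trans ab.
  have -> : (c / n.+1%:R = F b)%R by rewrite /F /b mul1r.
  have -> : (c * n.+1%:R = F a)%R by rewrite /F /a mul1r invrK.
  rewrite (@integration_by_substitution_decreasing _ F G a b) //.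
  - apply: eq_integral => y; rewrite inE /= in_itv /= => /andP[ay _].
    have y0 := lt_le_trans a0 ay.
    rewrite /= !fctE derive1E; have [_ ->] := dF y y0.
    rewrite /G /F opprK; congr (_ %:E); field; rewrite !gt_eqF //.
  - move=> x y; rewrite !in_itv /= => /andP[ax _] /andP[ay _] xy.
    have x0 := lt_le_trans a0 ax; have y0 := lt_le_trans a0 ay.
    by rewrite /F ltr_pM2l // ltf_pV2.
  - by move=> y; rewrite in_itv /= => /andP[ay _]; apply: cF'; exact: lt_trans ay.
  - by apply: (cvgP (F^`()%classic a)); apply: cvg_at_right_filter; exact: cF'.
  - by apply: (cvgP (F^`()%classic b)); apply: cvg_at_left_filter; exact: cF'.
  - split.
    + move=> y; rewrite in_itv /= => /andP[ay _].
      by have [] := dF y (lt_trans a0 ay).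
    + by apply: cvg_at_right_filter; exact: cF.
    + by apply: cvg_at_left_filter; exact: cF.
  - apply: continuous_in_subspaceT => y; rewrite inE /= in_itv /= => /andP[Fy _].
    by apply: cG; apply: lt_le_trans Fy; rewrite divr_gt0.
have -> : \int[mu]_(y in `]0%R, +oo[) (g y / y)%:E = lim (\int[mu]_(y in `[(c / n.+1%:R)%R, (c * n.+1%:R)%R]) (g y / y)%:E @[n --> \oo]).
  by apply/esym/cvg_lim.
by rewrite -E; apply/esym/cvg_lim.
Unshelve. all: by end_near. Qed.

End OneVariable.

(** * Iterated integrals over the half-plane *)

Section Tonelli.
Variable R : realType.
Local Notation mu := (@lebesgue_measure R).
Local Open Scope ereal_scope.

Variable phi : R * R -> R.
Hypothesis phi_cont : forall p, (0 < p.2)%R -> {for p, continuous phi}.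
Hypothesis phi_ge0 : forall p, (0 < p.2)%R -> (0 <= phi p)%R.

Let ephi := (EFin \o phi) \_ (@HP R).

Let mephi : measurable_fun setT ephi.
Proof.
apply/(measurable_restrictT _ (@measurable_HP R))/measurable_EFinP.
exact: HP_continuous_measurable.
Qed.

Let ephi_ge0 p : 0 <= ephi p.
Proof.
by apply: erestrict_ge0 => q /phi_ge0; rewrite lee_fin.
Qed.

Let ephi_sec (x y : R) : ephi (x, y) = ((fun y => (phi (x, y))%:E) \_ `]0%R, +oo[) y.
Proof. by rewrite /ephi !patchE /HP !mem_setE /= in_itv /= andbT. Qed.

Let HP_mkcond : \int[mu \x mu]_(p in @HP R) (phi p)%:E =
  \int[mu]_x \int[mu]_y ephi (x, y).
Proof. by rewrite integral_mkcond; exact: (fubini_tonelli1 (m1 := mu) (m2 := mu) ephi). Qed.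

Lemma HP_tonelli_xy : \int[mu \x mu]_(p in @HP R) (phi p)%:E =
  \int[mu]_x \int[mu]_(y in `]0%R, +oo[) (phi (x, y))%:E.
Proof.
rewrite HP_mkcond; apply: eq_integral => x _.
rewrite [RHS]integral_mkcond; apply: eq_integral => y _.
exact: ephi_sec.
Qed.

Lemma HP_tonelli_yx : \int[mu \x mu]_(p in @HP R) (phi p)%:E =
  \int[mu]_(y in `]0%R, +oo[) \int[mu]_x (phi (x, y))%:E.
Proof.
transitivity (\int[mu]_y \int[mu]_x ephi (x, y)).
  by rewrite HP_mkcond; exact: (fubini_tonelli (m1 := mu) (m2 := mu) ephi).
rewrite [RHS]integral_mkcond; apply: eq_integral => y _.
rewrite patchE; case: ifPn => y0.
  by apply: eq_integral => x _; rewrite ephi_sec patchE y0.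
by apply: integral0_eq => x _; rewrite ephi_sec patchE (negbTE y0).
Qed.

Lemma measurable_HP_section :
  measurable_fun [set: R] (fun x => \int[mu]_(y in `]0%R, +oo[) (phi (x, y))%:E).
Proof.
have := measurable_fun_fubini_tonelli_F (m2 := mu) ephi mephi ephi_ge0.
congr (measurable_fun _ _); apply/funext => x.
rewrite /fubini_F [RHS]integral_mkcond; apply: eq_integral => y _.
exact: ephi_sec.
Qed.

End Tonelli.

(** * Invariance of the hyperbolic measure *)

Section Invariance.
Variable R : realType.
Local Notation C := (R[i]^o).
Local Notation uhp := (uhp R).
Local Notation mu := (@lebesgue_measure R).
Implicit Types (z : uhp) (f : uhp -> R).

Definition hcont f := forall z, {for (z : R[i]), continuous (ext0 f : C -> R)}.

Lemma continuous_pair_complex : continuous (fun p : R * R => p.1 +i* p.2 : C).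
Proof.
move=> p; apply: (@cvg_complex _ _ (nbhs p)); [exact: cvg_fst|exact: cvg_snd].
Qed.

Lemma hcont_pair f (p : R * R) : hcont f -> 0 < p.2 ->
  {for p, continuous (fun q : R * R => ext0 f (q.1 +i* q.2))}.
Proof.
move=> cf p0; have c := cf (@UHP R (p.1 +i* p.2) p0).
exact: (@cvg_comp _ _ _ (fun q : R * R => q.1 +i* q.2) (ext0 f) (nbhs p)
  (nbhs (p.1 +i* p.2 : C)) _ (@continuous_pair_complex p) c).
Qed.

Lemma ext0_moebius f (g : SL2 R) (x y u v : R) : 0 < y ->
  anum g (x +i* y) / jfac g (x +i* y) = u +i* v ->
  ext0 (fun z => f (moebius g z)) (x +i* y) = ext0 f (u +i* v).
Proof.
move=> y0 e; rewrite -e.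
have -> : ext0 (fun z => f (moebius g z)) (x +i* y) = f (moebius g (@UHP R (x +i* y) y0)).
  by rewrite -(ext0E (fun z => f (moebius g z))).
by rewrite -(ext0E f).
Qed.

Lemma hcont_moebius f (g : SL2 R) : hcont f -> hcont (fun z => f (moebius g z)).
Proof.
move=> cf z.
have c1 : {for (z : R[i]), continuous ((fun w => anum g w / jfac g w) : C -> C)}.
  by have := @derivable_moebius R g z => /derivable1_diffP/differentiable_continuous.
have c2 := @cvg_comp _ _ _ (fun w => anum g w / jfac g w) (ext0 f)
   (nbhs (uhp_val z : C)) (nbhs (uhp_val (moebius g z) : C)) _ c1 (cf (moebius g z)).
rewrite /prop_for /continuous_at ext0E.
rewrite ext0E in c2.
apply: cvg_trans c2; apply: (@near_eq_cvg _ _ (nbhs (uhp_val z : C))).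
apply: filterS (near_uhp z) => w w0.
by rewrite -[w]/(uhp_val (UHP w0)) (ext0E (fun z => f (moebius g z))) -(ext0E f).
Qed.

Lemma det_mx2 (a b c d : R) : \det (mx2 a b c d) = (a * d - b * c)%R.
Proof.
rewrite (expand_det_row _ 0%R) !big_ord_recl big_ord0 addr0.
by rewrite /cofactor !det_mx11 !mxE /= expr0 expr1 mul1r mulN1r mulrN.
Qed.

Fact up_det (b : R) : \det (mx2 1 b 0 1) = 1%R.
Proof. by rewrite det_mx2; ring. Qed.
Definition up (b : R) : SL2 R := MkSL2 (up_det b).

Fact dg_det (a : R) (a0 : a != 0%R) : \det (mx2 a 0 0 a^-1) = 1%R.
Proof. by rewrite det_mx2 mulr0 subr0 mulfV. Qed.
Definition dg (a : R) (a0 : a != 0%R) : SL2 R := MkSL2 (dg_det a0).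

Fact sw_det : \det (mx2 0 (-1) 1 0) = 1%R :> R.
Proof. by rewrite det_mx2; ring. Qed.
Definition sw : SL2 R := MkSL2 sw_det.

Local Open Scope ereal_scope.

Definition jac f (p : R * R) : R := (ext0 f (p.1 +i* p.2) / p.2 ^+ 2)%R.

Lemma jac_cont f : hcont f -> forall p, (0 < p.2)%R -> {for p, continuous (jac f)}.
Proof.
move=> cf p p0; apply: cvgM; first exact: hcont_pair.
apply: cvgV; first by rewrite expf_neq0 // gt_eqF.
apply: (@cvg_comp _ _ _ (@snd R R) (fun y => y ^+ 2)%R (nbhs p) (nbhs p.2)).
  exact: cvg_snd.
exact: exprn_continuous.
Qed.

Lemma jac_ge0 f : (forall z, 0 <= f z)%R -> forall p, (0 < p.2)%R -> (0 <= jac f p)%R.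
Proof.
move=> f0 p p0; rewrite /jac divr_ge0 ?exprn_ge0 ?(ltW p0) //.
by rewrite -[p.1 +i* p.2]/(uhp_val (@UHP R (p.1 +i* p.2) p0)) ext0E.
Qed.

(* Polar-type coordinates [s = x / y] and [y]: the invariant measure becomes  *)
(* [ds dy / y], and [z |-> - 1 / z] acts by [s |-> - s] and an inversion of   *)
(* [y] depending on [s].                                                      *)
Let skew f (p : R * R) : R := (ext0 f ((p.1 * p.2) +i* p.2) / p.2)%R.

Let skew_cont f : hcont f -> forall p, (0 < p.2)%R -> {for p, continuous (skew f)}.
Proof.
move=> cf p p0; apply: cvgM; last first.
  by apply: cvgV; [rewrite gt_eqF|exact: cvg_snd].
apply: (@cvg_comp _ _ _ (fun q : R * R => (q.1 * q.2, q.2)%R)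
  (fun q : R * R => ext0 f (q.1 +i* q.2)) (nbhs p) (nbhs (p.1 * p.2, p.2)%R)).
  apply: (@cvg_pair _ _ _ (nbhs p) (nbhs (p.1 * p.2)%R) (nbhs p.2)); last exact: cvg_snd.
  by apply: cvgM; [exact: cvg_fst|exact: cvg_snd].
exact: (@hcont_pair f (p.1 * p.2, p.2)%R).
Qed.

Let skew_ge0 f : (forall z, 0 <= f z)%R -> forall p, (0 < p.2)%R -> (0 <= skew f p)%R.
Proof.
move=> f0 p p0; rewrite /skew divr_ge0 ?(ltW p0) //.
by rewrite -[X in ext0 f X]/(uhp_val (@UHP R ((p.1 * p.2)%R +i* p.2) p0)) ext0E.
Qed.

(** On each horizontal line [x = y s] is an affine substitution; Tonelli then restores the order in
    which [y] is the inner variable. *)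
Lemma dv_int_skew f : hcont f -> (forall z, 0 <= f z)%R ->
  dv_int f = \int[mu]_s \int[mu]_(y in `]0%R, +oo[) (skew f (s, y))%:E.
Proof.
move=> cf f0.
rewrite -(HP_tonelli_xy (skew_cont cf) (skew_ge0 f0)) (HP_tonelli_yx (skew_cont cf) (skew_ge0 f0)).
rewrite [LHS](HP_tonelli_yx (jac_cont cf) (jac_ge0 f0)).
apply: eq_integral => y; rewrite inE /= in_itv /= andbT => y0.
rewrite (@affine_substitution _ y 0 (fun x => jac f (x, y))) //.
- apply: eq_integral => s _; rewrite /jac /skew /= addr0 mulrC [(y * s)%R]mulrC; congr (_ %:E).
  by field; rewrite gt_eqF.
- move=> x; apply: (@cvg_comp _ _ _ (fun x => (x, y)) (jac f) (nbhs x) (nbhs (x, y))).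
    by apply: (@cvg_pair _ _ _ (nbhs x) (nbhs x) (nbhs y)); [exact: cvg_id|exact: cvg_cst].
  exact: (jac_cont cf).
- by move=> x; exact: jac_ge0.
Qed.

Definition invariant (g : SL2 R) := forall f, hcont f -> (forall z, 0 <= f z)%R ->
  dv_int (fun z => f (moebius g z)) = dv_int f.

Lemma invariant_mul g h : invariant g -> invariant h -> invariant (sl2_mul g h).
Proof.
move=> ig ih f cf f0; under eq_fun do rewrite moebius_mul.
by rewrite (ih (fun z => f (moebius g z))) ?ig //; exact: hcont_moebius.
Qed.

Lemma invariant_up b : invariant (up b).
Proof.
move=> f cf f0; have cfg := @hcont_moebius f (up b) cf.
rewrite [LHS](HP_tonelli_yx (jac_cont cfg) (@jac_ge0 (fun z => f (moebius (up b) z)) (fun z => f0 _))).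
rewrite [RHS](HP_tonelli_yx (jac_cont cf) (jac_ge0 f0)).
apply: eq_integral => y; rewrite inE /= in_itv /= andbT => y0.
rewrite [RHS](@affine_substitution _ 1 b (fun x => jac f (x, y))) //.
- apply: eq_integral => s _; rewrite mulr1 mul1r /jac /=; congr ((_ / _)%:E).
  apply: ext0_moebius => //; rewrite /anum /jfac !mxE /=.
  rewrite rmorph0 rmorph1 mul0r add0r divr1 mul1r.
  by apply/eqP; rewrite eq_complex /= addr0 !eqxx.
- move=> x; apply: (@cvg_comp _ _ _ (fun x => (x, y)) (jac f) (nbhs x) (nbhs (x, y))).
    by apply: (@cvg_pair _ _ _ (nbhs x) (nbhs x) (nbhs y)); [exact: cvg_id|exact: cvg_cst].
  exact: (jac_cont cf).
- by move=> x; exact: jac_ge0.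
Qed.

Let ray f (s y : R) : R := ext0 f ((s * y)%R +i* y).

Let ray_cont f (s : R) : hcont f -> forall y : R, (0 < y)%R -> {for y, continuous (ray f s)}.
Proof.
move=> cf y y0.
apply: (@cvg_comp _ _ _ (fun y : R => (s * y, y)%R)
  (fun q : R * R => ext0 f (q.1 +i* q.2)) (nbhs y) (nbhs (s * y, y)%R)).
  apply: (@cvg_pair _ _ _ (nbhs y) (nbhs (s * y)%R) (nbhs y)); last exact: cvg_id.
  by apply: cvgM; [exact: cvg_cst|exact: cvg_id].
exact: (@hcont_pair f (s * y, y)%R).
Qed.

Let ray_ge0 f (s : R) : (forall z, 0 <= f z)%R -> forall y : R, (0 < y)%R -> (0 <= ray f s y)%R.
Proof.
move=> f0 y y0.
by rewrite /ray -[X in ext0 f X]/(uhp_val (@UHP R ((s * y)%R +i* y) y0)) ext0E.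
Qed.

(** The map [z |-> a^2 z] fixes [s] and scales [y]. The scaling is the composite of the inversions
    [y |-> 1 / y] and [y |-> a^2 / y]. *)
Lemma invariant_dg a (a0 : a != 0%R) : invariant (dg a0).
Proof.
move=> f cf f0; have cfg := @hcont_moebius f (dg a0) cf.
have a2 : (0 < a ^+ 2)%R by rewrite exprn_even_gt0.
rewrite (dv_int_skew cfg (fun z => f0 _)) (dv_int_skew cf f0).
apply: eq_integral => s _.
transitivity (\int[mu]_(y in `]0%R, +oo[) (ray f s (a ^+ 2 / y) / y)%:E); last first.
  by apply: inverse_substitution => //; [exact: ray_cont|exact: ray_ge0].
rewrite -(@inverse_substitution _ 1 (fun y => ray f s (a ^+ 2 / y))%R) //.
- apply: eq_integral => y; rewrite inE /= in_itv /= andbT => y0.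
  rewrite /skew /ray /=; congr ((_ / _)%:E).
  apply: ext0_moebius => //; rewrite /anum /jfac !mxE /=.
  have y1 : y != 0%R by rewrite gt_eqF.
  by simpc; congr (_ +i* _); rewrite /=; field; rewrite ?a0 ?y1.
- move=> y y0; apply: (@cvg_comp _ _ _ (fun y : R => a ^+ 2 / y)%R (ray f s) (nbhs y) (nbhs (a ^+ 2 / y)%R)).
    apply: cvgM; first exact: cvg_cst.
    by apply: cvgV; [rewrite gt_eqF|exact: cvg_id].
  by apply: ray_cont => //; rewrite divr_gt0.
- by move=> y y0; apply: ray_ge0 => //; rewrite divr_gt0.
Qed.

Lemma invariant_sw : invariant sw.
Proof.
move=> f cf f0; have cfg := @hcont_moebius f sw cf.
rewrite (dv_int_skew cfg (fun z => f0 _)) (dv_int_skew cf f0).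
pose G s := \int[mu]_(y in `]0%R, +oo[) (skew f (s, y))%:E.
rewrite -[RHS](@reflection_integral _ G).
- apply: eq_integral => s _.
  (* For [z = y (s + i)] the imaginary part of [- 1 / z] is [1 / ((1 + s^2) y)], an inversion in [y]
     with this constant. *)
  have c0 : (0 < (1 + s ^+ 2)^-1)%R by rewrite invr_gt0 ltr_pwDl // sqr_ge0.
  rewrite /G /skew /=.
  rewrite -[RHS](@inverse_substitution _ _ (ray f (- s)) c0).
  + apply: eq_integral => y; rewrite inE /= in_itv /= andbT => y0.
    rewrite /ray /=; congr ((_ / _)%:E).
    apply: ext0_moebius => //; rewrite /anum /jfac !mxE /=.
    have y1 : y != 0%R by rewrite gt_eqF.
    have s1 : (1 + s ^+ 2 != 0)%R by rewrite gt_eqF // ltr_pwDl // sqr_ge0.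
    simpc; congr (_ +i* _); rewrite /=; field; rewrite y1 s1.
      by rewrite gt_eqF // ltr_wpDl ?sqr_ge0 // exprn_gt0.
    by rewrite gt_eqF // ltr_wpDl ?sqr_ge0 // exprn_gt0.
  + exact: ray_cont.
  + exact: ray_ge0.
- exact: (measurable_HP_section (skew_cont cf) (skew_ge0 f0)).
- move=> s; apply: integral_ge0 => y; rewrite /= in_itv /= andbT => y0.
  by rewrite lee_fin; exact: skew_ge0.
Qed.

(** Bruhat decomposition: translations and dilations give the matrices with [c = 0], and one factor
    [sw] reaches all the others. *)
Lemma invariant_SL2 g : invariant g.
Proof.
have E := sl2_detE g.
set a := g 0%R 0%R in E; set b := g 0%R 1%R in E; set c := g 1%R 0%R in E; set d := g 1%R 1%R in E.
have mxE2 (A B : 'M[R]_2) : (forall i j : 'I_2, ((i == 0%R) || (i == 1%R)) && ((j == 0%R) || (j == 1%R)) -> A i j = B i j) -> A = B :> 'M[R]_2.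
  move=> h; apply/matrixP => i j; apply: h.
  by case: i => -[|[|//]] /= ?; case: j => -[|[|//]] /= ?.
have [c0|c0] := eqVneq c 0%R.
  have a0 : a != 0%R by apply: contra_eq_neq E => ->; rewrite c0 mul0r mulr0 subrr eq_sym oner_eq0.
  have -> : g = sl2_mul (up (a * b)%R) (dg a0).
    apply: sl2_inj; apply: mxE2 => i j.
    rewrite [in RHS](sl2_mulE (up (a * b)%R) (dg a0)) !mxE.
    move=> /andP[/orP[] /eqP -> /orP[] /eqP ->] /=; rewrite -/a -/b -/c -/d.
    - by ring.
    - by field.
    - by rewrite c0; ring.
    - have -> : d = (a^-1)%R by apply: (mulfI a0); rewrite mulfV // -E c0; ring.
      by ring.
  by apply: invariant_mul; [exact: invariant_up|exact: invariant_dg].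
have -> : g = sl2_mul (up (a / c)%R) (sl2_mul sw (sl2_mul (dg c0) (up (d / c)%R))).
  apply: sl2_inj; apply: mxE2 => i j.
  rewrite [in RHS](sl2_mulE (up (a / c)%R) _) ![in RHS](sl2_mulE sw _) ![in RHS](sl2_mulE (dg c0) _) !mxE.
  move=> /andP[/orP[] /eqP -> /orP[] /eqP ->] /=; rewrite -/a -/b -/c -/d.
  - by field.
  - have -> : b = ((a * d - 1) / c)%R by rewrite -E; field.
    by field.
  - by field.
  - by field.
apply: invariant_mul; first exact: invariant_up.
apply: invariant_mul; first exact: invariant_sw.
by apply: invariant_mul; [exact: invariant_dg|exact: invariant_up].
Qed.

End Invariance.

(** * Continuity and integrability on the half-plane *)

Section Integrals.
Variable R : realType.
Local Notation C := (R[i]^o).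
Local Notation uhp := (uhp R).
Local Notation mu2 := (@lebesgue_measure R \x @lebesgue_measure R)%E.
Implicit Types (z : uhp) (f h : uhp -> R) (F G : uhp -> R[i]) (g : SL2 R).

Lemma ext0_comp (V W : nmodType) (P : V -> W) (f : uhp -> V) : P 0 = 0 ->
  ext0 (fun z => P (f z)) = P \o ext0 f.
Proof.
by move=> P0; apply/funext => w; rewrite /ext0 /=; case: insub => [z|] /=.
Qed.

Lemma ext0_op2 (V W U : nmodType) (P : V -> W -> U) (f : uhp -> V) (h : uhp -> W) :
  P 0 0 = 0 -> ext0 (fun z => P (f z) (h z)) = (fun w => P (ext0 f w) (ext0 h w)).
Proof.
by move=> P0; apply/funext => w; rewrite /ext0 /=; case: insub => [z|] /=.
Qed.

Definition ccont F := forall z, {for (z : R[i]), continuous (ext0 F : C -> C)}.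

Lemma ccont_holo F : holomorphic F -> ccont F.
Proof. by move=> hF z; exact: holomorphic_continuous. Qed.

Lemma ccontM F G : ccont F -> ccont G -> ccont (fun z => F z * G z).
Proof.
move=> cF cG z; have E := @ext0_op2 _ _ _ *%R F G (mulr0 0).
rewrite E.
exact: (forC_M (cF z) (cG z)).
Qed.

Lemma ccontD F G : ccont F -> ccont G -> ccont (fun z => F z + G z).
Proof.
move=> cF cG z; have E := @ext0_op2 _ _ _ +%R F G (addr0 0).
rewrite E.
exact: (forC_D (cF z) (cG z)).
Qed.

Lemma ccont_conj F : ccont F -> ccont (fun z => (F z)^*%C).
Proof.
move=> cF z; rewrite (@ext0_comp _ _ (@conjc R) F (conjc0 R)).
exact: (@cvg_comp _ _ _ (ext0 F) (@conjc R) (nbhs (uhp_val z : C))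
  (nbhs (ext0 F (uhp_val z) : C)) _ (cF z) (@continuous_conjc R (ext0 F z))).
Qed.

Lemma ccont_cst a : ccont (fun=> a).
Proof. exact: ccont_holo (@holomorphic_cst R a). Qed.

Lemma ccontN F : ccont F -> ccont (fun z => - F z).
Proof.
move=> cF; have := ccontM (@ccont_cst (-1)) cF.
by under eq_fun do rewrite mulN1r.
Qed.

Lemma hcont_Re F : ccont F -> hcont (fun z => complex.Re (F z)).
Proof.
move=> cF z; rewrite (@ext0_comp _ _ (@complex.Re R) F erefl).
exact: (@cvg_comp _ _ _ (ext0 F) (@complex.Re R) (nbhs (uhp_val z : C))
  (nbhs (ext0 F (uhp_val z) : C)) _ (cF z) (@continuous_Re R (ext0 F z))).
Qed.

Lemma hcont_Im F : ccont F -> hcont (fun z => complex.Im (F z)).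
Proof.
move=> cF z; rewrite (@ext0_comp _ _ (@complex.Im R) F erefl).
exact: (@cvg_comp _ _ _ (ext0 F) (@complex.Im R) (nbhs (uhp_val z : C))
  (nbhs (ext0 F (uhp_val z) : C)) _ (cF z) (@continuous_Im R (ext0 F z))).
Qed.

Lemma hcontM f h : hcont f -> hcont h -> hcont (fun z => f z * h z).
Proof.
move=> cf ch z; have E := @ext0_op2 _ _ _ *%R f h (mulr0 0).
rewrite E.
exact: (@cvgM R _ (nbhs (uhp_val z : C)) _ _ _ _ _ (cf z) (ch z)).
Qed.

Lemma hcontD f h : hcont f -> hcont h -> hcont (fun z => f z + h z).
Proof.
move=> cf ch z; have E := @ext0_op2 _ _ _ +%R f h (addr0 0).
rewrite E.
exact: (@cvgD R R _ (nbhs (uhp_val z : C)) _ _ _ _ _ (cf z) (ch z)).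
Qed.

Lemma hcontN f : hcont f -> hcont (fun z => - f z).
Proof.
move=> cf z; rewrite (@ext0_comp _ _ -%R f (oppr0 _)).
exact: (@cvgN R R _ (nbhs (uhp_val z : C)) _ _ _ (cf z)).
Qed.

Lemma hcont_max0 f : hcont f -> hcont (fun z => Num.max (f z) 0).
Proof.
move=> cf z; rewrite (@ext0_comp _ _ (fun x : R => Num.max x 0) f (maxxx 0)).
have cm : {for ext0 f (uhp_val z), continuous (fun x : R => Num.max x 0)}.
  exact: (@continuous_max _ _ id (cst 0) _ (@cvg_id _ _) (@cvg_cst _ _ _ _ _)).
exact: (@cvg_comp _ _ _ (ext0 f) (fun x : R => Num.max x 0) (nbhs (uhp_val z : C))
  (nbhs (ext0 f (uhp_val z))) _ (cf z) cm).
Qed.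

Lemma ccont_RC f : hcont f -> ccont (fun z => (f z)%:C).
Proof.
move=> cf z; rewrite (@ext0_comp _ _ (real_complex R) f erefl).
exact: (@cvg_comp _ _ _ (ext0 f) (real_complex R) (nbhs (uhp_val z : C))
  (nbhs (ext0 f (uhp_val z))) _ (cf z) (@continuous_real_complex R (ext0 f z))).
Qed.

Lemma ccont_moebius F g : ccont F -> ccont (fun z => F (moebius g z)).
Proof.
move=> cF; have c1 := @hcont_moebius R _ g (hcont_Re cF); have c2 := @hcont_moebius R _ g (hcont_Im cF).
have -> : (fun z => F (moebius g z)) = (fun z =>
    (complex.Re (F (moebius g z)))%:C + 'i%C * (complex.Im (F (moebius g z)))%:C).
  by apply/funext => z; rewrite -complexE.
exact: (ccontD (ccont_RC c1) (ccontM (@ccont_cst 'i%C) (ccont_RC c2))).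
Qed.

Lemma hcont_ypow d : hcont (@ypow R d).
Proof.
move=> z; rewrite /prop_for /continuous_at ext0E.
have z0 := uhp_im z.
have c1 : complex.Im w `^ (d%:R / 2) @[w --> (uhp_val z : C)] --> complex.Im z `^ (d%:R / 2).
  have -> : (fun w : C => complex.Im w `^ (d%:R / 2)) =
      (fun y : R => y `^ (d%:R / 2)) \o (@complex.Im R) by [].
  apply: (@cvg_comp _ _ _ (@complex.Im R) (fun y : R => y `^ (d%:R / 2)) (nbhs (uhp_val z : C))
    (nbhs (complex.Im z))); first exact: continuous_Im.
  have c2 : expR (d%:R / 2 * ln y) @[y --> complex.Im z] --> expR (d%:R / 2 * ln (complex.Im z)).
    apply: (@cvg_comp _ _ _ (fun y : R => d%:R / 2 * ln y) (@expR R) (nbhs (complex.Im z))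
      (nbhs (d%:R / 2 * ln (complex.Im z)))); last exact: continuous_expR.
    by apply: cvgM; [exact: cvg_cst|exact: continuous_ln].
  have -> : complex.Im z `^ (d%:R / 2) = expR (d%:R / 2 * ln (complex.Im z)).
    by rewrite /powR gt_eqF.
  apply: cvg_trans c2; apply: near_eq_cvg.
  near=> y; rewrite /powR gt_eqF //; near: y; exact: lt_nbhsr.
apply: cvg_trans c1; apply: (@near_eq_cvg _ _ (nbhs (uhp_val z : C))).
apply: filterS (near_uhp z) => w w0.
by rewrite -[w]/(uhp_val (UHP w0)) ext0E.
Unshelve. all: by end_near. Qed.

Local Open Scope ereal_scope.

Definition hInt f := mu2.-integrable (@HP R) (fun p => (jac f p)%:E).

Lemma dv_intE f : dv_int f = \int[mu2]_(p in @HP R) (jac f p)%:E.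
Proof. by []. Qed.

Lemma measurable_jac f : hcont f -> measurable_fun (@HP R : set (measurableTypeR R * measurableTypeR R)) (fun p => (jac f p)%:E).
Proof.
by move=> cf; apply/measurable_EFinP; apply: HP_continuous_measurable; exact: (@jac_cont R f cf).
Qed.

Lemma dv_int_posneg f : dv_int f =
  dv_int (fun z => Num.max (f z) 0%R) - dv_int (fun z => Num.max (- f z)%R 0%R).
Proof.
have jmax (u : uhp -> R) (p : R * R) : (0 < p.2)%R ->
    jac (fun z => Num.max (u z) 0%R) p = Num.max (jac u p) 0%R.
  move=> p0; rewrite /jac (@ext0_comp _ _ (fun x : R => Num.max x 0%R) u (maxxx 0%R)) /=.
  by rewrite maxr_pMl ?mul0r // invr_ge0 exprn_ge0 // ltW.
have jopp p : jac (fun z => - f z)%R p = (- jac f p)%R.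
  by rewrite /jac (@ext0_comp _ _ -%R f (oppr0 _)) mulNr.
rewrite !dv_intE integralE; congr (_ - _); apply: eq_integral => p; rewrite inE /= => p0.
  by rewrite funeposE jmax // EFin_max.
by rewrite funenegE (jmax (fun z => - f z)%R) // jopp EFin_max.
Qed.

(** The extended integral is the difference of those of the positive and negative parts, so
    invariance for nonnegative functions gives it for all continuous ones, integrable or not. *)
Lemma dv_int_moebius f g : hcont f -> dv_int (fun z => f (moebius g z)) = dv_int f.
Proof.
move=> cf; rewrite dv_int_posneg [RHS]dv_int_posneg; congr (_ - _).
- apply: (@invariant_SL2 R g (fun z => Num.max (f z) 0%R)); first exact: hcont_max0.
  by move=> z; rewrite le_max lexx orbT.
- apply: (@invariant_SL2 R g (fun z => Num.max (- f z)%R 0%R)).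
    exact: (hcont_max0 (hcontN cf)).
  by move=> z; rewrite le_max lexx orbT.
Qed.

Lemma jac_le f h p : (0 < p.2)%R -> (forall z, f z <= h z)%R -> (jac f p <= jac h p)%R.
Proof.
move=> p0 fh; rewrite /jac ler_wpM2r ?invr_ge0 ?exprn_ge0 ?(ltW p0) //.
by rewrite -[p.1 +i* p.2]/(uhp_val (@UHP R (p.1 +i* p.2) p0)) !ext0E.
Qed.

Lemma jac_norm f p : `|jac f p|%R = jac (fun z => `|f z|%R) p.
Proof.
rewrite /jac (@ext0_comp _ _ (fun x : R => `|x|%R) f (normr0 _)) /= normrM; congr (_ * _)%R.
by rewrite ger0_norm // invr_ge0 sqr_ge0.
Qed.

Lemma hInt_ge0 h : hcont h -> (forall z, 0 <= h z)%R -> dv_int h < +oo -> hInt h.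
Proof.
move=> ch h0 hfin; apply/integrableP; split; first exact: measurable_jac.
suff -> : \int[mu2]_(p in @HP R) `|(jac h p)%:E| = dv_int h by [].
apply: eq_integral => p; rewrite inE /= => p0.
by rewrite /= ger0_norm //; exact: jac_ge0.
Qed.

Lemma hInt_le f h : hcont f -> hcont h -> (forall z, `|f z| <= h z)%R ->
  dv_int h < +oo -> hInt f.
Proof.
move=> cf ch fh hfin.
have h0 z : (0 <= h z)%R by exact: le_trans (fh z).
apply: (le_integrable _ _ _ (hInt_ge0 ch h0 hfin)).
- exact: measurable_HP.
- exact: measurable_jac.
- move=> p p0; rewrite /= lee_fin jac_norm ger0_norm ?jac_ge0 //.
  exact: jac_le.
Qed.

Lemma jacD f h p : jac (fun z => f z + h z)%R p = (jac f p + jac h p)%R.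
Proof. by rewrite /jac (@ext0_op2 _ _ _ +%R f h (addr0 _)) mulrDl. Qed.

Lemma jacZ r f p : jac (fun z => r * f z)%R p = (r * jac f p)%R.
Proof. by rewrite /jac (@ext0_comp _ _ ( *%R r) f (mulr0 _)) /= mulrA. Qed.

Lemma hIntD f h : hInt f -> hInt h -> hInt (fun z => f z + h z)%R.
Proof.
move=> If Ih; have := integrableD (@measurable_HP R) If Ih.
by congr (integrable _ _ _); apply/funext => p; rewrite jacD EFinD.
Qed.

Lemma hIntZ r f : hInt f -> hInt (fun z => r * f z)%R.
Proof.
move=> If; have := integrableZl (@measurable_HP R) r If.
by congr (integrable _ _ _); apply/funext => p; rewrite jacZ EFinM.
Qed.

Definition Rdv f : R := fine (dv_int f).

Lemma RdvD f h : hInt f -> hInt h -> Rdv (fun z => f z + h z)%R = (Rdv f + Rdv h)%R.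
Proof.
move=> If Ih; rewrite -[RHS](RintegralD (@measurable_HP R) If Ih); congr fine.
by apply: eq_integral => p _; rewrite -/(jac _ p) jacD.
Qed.

Lemma RdvZ r f : hInt f -> Rdv (fun z => r * f z)%R = (r * Rdv f)%R.
Proof.
move=> If; rewrite -[RHS](RintegralZl r (@measurable_HP R) If); congr fine.
by apply: eq_integral => p _; rewrite -/(jac _ p) jacZ.
Qed.

Lemma Rdv_le f h : hcont f -> hcont h -> (forall z, `|f z| <= h z)%R ->
  dv_int h < +oo -> (`|Rdv f| <= Rdv h)%R.
Proof.
move=> cf ch fh hfin; have If := hInt_le cf ch fh hfin.
have h0 z : (0 <= h z)%R by exact: le_trans (fh z).
have Ih := hInt_ge0 ch h0 hfin.
apply: le_trans (le_normr_Rintegral (@measurable_HP R) If) _.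
apply: le_Rintegral => //; [exact: measurable_HP|exact: integrable_norm|].
move=> p p0; rewrite -/(jac f p) -/(jac h p) jac_norm; exact: jac_le.
Qed.

End Integrals.

(** * Square-integrable functions *)

Section ComplexIntegrals.
Variable R : realType.
Local Notation C := (R[i]^o).
Local Notation uhp := (uhp R).
Implicit Types (z : uhp) (f h : uhp -> R) (F G : uhp -> R[i]) (g : SL2 R) (s t : Mp R) (d : nat).

Lemma dv_int_lty f : hInt f -> (dv_int f < +oo)%E.
Proof. by move=> If; apply: integrable_lty => //; exact: measurable_HP. Qed.

Definition cInt F := hInt (fun z => complex.Re (F z)) /\ hInt (fun z => complex.Im (F z)).

Lemma dv_intCE F : dv_intC F = Rdv (fun z => complex.Re (F z)) +i* Rdv (fun z => complex.Im (F z)).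
Proof. by []. Qed.

Lemma ReD (x y : R[i]) : complex.Re (x + y) = complex.Re x + complex.Re y.
Proof. by case: x y => [a b] []. Qed.

Lemma ImD (x y : R[i]) : complex.Im (x + y) = complex.Im x + complex.Im y.
Proof. by case: x y => [a b] []. Qed.

Lemma dv_intCD F G : cInt F -> cInt G ->
  dv_intC (fun z => F z + G z) = dv_intC F + dv_intC G.
Proof.
move=> [F1 F2] [G1 G2]; rewrite !dv_intCE.
have -> : (fun z => complex.Re (F z + G z)) = (fun z => complex.Re (F z) + complex.Re (G z)).
  by apply/funext => z; rewrite ReD.
have -> : (fun z => complex.Im (F z + G z)) = (fun z => complex.Im (F z) + complex.Im (G z)).
  by apply/funext => z; rewrite ImD.
by rewrite !RdvD.
Qed.

Lemma ReZ (a x : R[i]) :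
  complex.Re (a * x) = complex.Re a * complex.Re x + - complex.Im a * complex.Im x.
Proof. by case: a x => [a b] [x y] /=; ring. Qed.

Lemma ImZ (a x : R[i]) :
  complex.Im (a * x) = complex.Re a * complex.Im x + complex.Im a * complex.Re x.
Proof. by case: a x => [a b] [x y] /=; ring. Qed.

Lemma dv_intCZ a F : cInt F -> dv_intC (fun z => a * F z) = a * dv_intC F.
Proof.
move=> [F1 F2]; rewrite !dv_intCE.
have -> : (fun z => complex.Re (a * F z)) =
    (fun z => complex.Re a * complex.Re (F z) + - complex.Im a * complex.Im (F z)).
  by apply/funext => z; rewrite ReZ.
have -> : (fun z => complex.Im (a * F z)) =
    (fun z => complex.Re a * complex.Im (F z) + complex.Im a * complex.Re (F z)).
  by apply/funext => z; rewrite ImZ.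
rewrite (RdvD (hIntZ _ F1) (hIntZ _ F2)) (RdvD (hIntZ _ F2) (hIntZ _ F1)) !RdvZ //.
by case: a => a b; simpc; congr (_ +i* _); ring.
Qed.

(** This holds without integrability: if one of the two parts has infinite integral, [fine] returns
    0 on both sides. Hence [dv_intC_conj] and [dot_sym] are unconditional. *)
Lemma RdvN f : Rdv (fun z => - f z) = - Rdv f.
Proof.
rewrite /Rdv dv_int_posneg [in RHS]dv_int_posneg.
have -> : (fun z => Num.max (- - f z) 0) = (fun z => Num.max (f z) 0).
  by apply/funext => z; rewrite opprK.
set A := dv_int _; set B := dv_int _.
have A0 : (0 <= A)%E.
  by apply: integral_ge0 => p p0; rewrite lee_fin; apply: jac_ge0 => // z; rewrite le_max lexx orbT.
have B0 : (0 <= B)%E.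
  by apply: integral_ge0 => p p0; rewrite lee_fin; apply: jac_ge0 => // z; rewrite le_max lexx orbT.
by case: A A0 => [a| |] // _; case: B B0 => [b| |] //= _; rewrite ?oppr0 // opprB.
Qed.

Lemma dv_intC_conj F : dv_intC (fun z => (F z)^*%C) = (dv_intC F)^*%C.
Proof.
rewrite !dv_intCE.
have -> : (fun z => complex.Re (F z)^*%C) = (fun z => complex.Re (F z)).
  by apply/funext => z; case: (F z).
have -> : (fun z => complex.Im (F z)^*%C) = (fun z => - complex.Im (F z)).
  by apply/funext => z; case: (F z).
by rewrite RdvN.
Qed.

Lemma dv_intC_moebius F g : ccont F -> dv_intC (fun z => F (moebius g z)) = dv_intC F.
Proof.
move=> cF; rewrite !dv_intCE /Rdv.
rewrite (@dv_int_moebius R (fun z => complex.Re (F z)) g (hcont_Re cF)).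
by rewrite (@dv_int_moebius R (fun z => complex.Im (F z)) g (hcont_Im cF)).
Qed.

Lemma normRe_le (x : R[i]) (r : R) : `|x| <= r%:C -> `|complex.Re x| <= r.
Proof. by move=> h; rewrite -lecR; apply: le_trans h; exact: normc_ge_Re. Qed.

Lemma normIm_le (x : R[i]) (r : R) : `|x| <= r%:C -> `|complex.Im x| <= r.
Proof. by move=> h; rewrite -lecR; apply: le_trans h; exact: normc_ge_Im. Qed.

Lemma cInt_bound F h : ccont F -> hcont h -> (forall z, `|F z| <= (h z)%:C) ->
  (dv_int h < +oo)%E -> cInt F /\ `|dv_intC F| <= (2 * Rdv h)%:C.
Proof.
move=> cF ch Fh hfin.
have h1 z := normRe_le (Fh z); have h2 z := normIm_le (Fh z).
have c1 := hcont_Re cF; have c2 := hcont_Im cF.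
split; first by split; [exact: hInt_le c1 ch h1 hfin|exact: hInt_le c2 ch h2 hfin].
apply: le_trans (normC_le_ReIm _) _; rewrite dv_intCE lecR /= mulr_natl mulr2n lerD //.
  exact: (Rdv_le c1 ch h1 hfin).
exact: (Rdv_le c2 ch h2 hfin).
Qed.

Lemma normC_sq (x : R[i]) : `|x| ^+ 2 = (Normc.normc x ^+ 2)%:C.
Proof. by rewrite rmorphXn. Qed.

Definition nrm2 d F z : R := complex.Re (`|F z| ^+ 2) * ypow d z.

Lemma nrm2C d F z : (nrm2 d F z)%:C = `|F z| ^+ 2 * (ypow d z)%:C.
Proof.
rewrite /nrm2 rmorphM; congr (_ * _).
by rewrite normC_sq.
Qed.

Lemma ypow_ge0 d z : 0 <= ypow d z. Proof. exact: powR_ge0. Qed.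

Lemma nrm2_ge0 d F z : 0 <= nrm2 d F z.
Proof.
rewrite -lecR nrm2C mulr_ge0 ?exprn_ge0 ?normr_ge0 //.
by have := ypow_ge0 d z; rewrite -lecR.
Qed.

Lemma hcont_nrm2 d F : ccont F -> hcont (nrm2 d F).
Proof.
move=> cF; have -> : nrm2 d F = (fun z => complex.Re (F z * (F z)^*%C) * ypow d z).
  by apply/funext => z; rewrite /nrm2 sqr_normC.
exact: (hcontM (hcont_Re (ccontM cF (ccont_conj cF))) (@hcont_ypow R d)).
Qed.

Definition L2 d F := ccont F /\ (dv_int (nrm2 d F) < +oo)%E.

Definition integrand d F G z : R[i] := F z * (G z)^*%C * (ypow d z)%:C.

Lemma ccont_integrand d F G : ccont F -> ccont G -> ccont (integrand d F G).
Proof.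
by move=> cF cG; exact: (ccontM (ccontM cF (ccont_conj cG)) (ccont_RC (@hcont_ypow R d))).
Qed.

Lemma normC_conj (x : R[i]) : `|x^*%C| = `|x|.
Proof. by case: x => a b; rewrite !normc_def /= sqrrN. Qed.

Lemma integrand_le d F G z : `|integrand d F G z| <= (nrm2 d F z + nrm2 d G z)%:C.
Proof.
have y0 : 0 <= (ypow d z)%:C :> R[i] by rewrite lecR ypow_ge0.
have -> : (nrm2 d F z + nrm2 d G z)%:C = (`|F z| ^+ 2 + `|G z| ^+ 2) * (ypow d z)%:C.
  by rewrite mulrDl -!nrm2C -rmorphD.
rewrite !normrM normC_conj (ger0_norm y0) ler_wpM2r //.
have a0 := normr_ge0 (F z); have b0 := normr_ge0 (G z).
move: (`|F z|) (`|G z|) a0 b0 => a b a0 b0.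
have [ab|ab] := real_leP (ger0_real a0) (ger0_real b0).
  by apply: (@le_trans _ _ (b ^+ 2)); rewrite ?lerDr ?exprn_ge0 // expr2 ler_wpM2r.
by apply: (@le_trans _ _ (a ^+ 2)); rewrite ?lerDl ?exprn_ge0 // expr2 ler_wpM2l // ltW.
Qed.

Lemma nrm2_sum_lty d F G : L2 d F -> L2 d G ->
  hcont (fun z => nrm2 d F z + nrm2 d G z) /\
  (dv_int (fun z => (nrm2 d F z + nrm2 d G z)%R) < +oo)%E.
Proof.
move=> [cF F2] [cG G2]; split; first exact: (hcontD (@hcont_nrm2 d F cF) (@hcont_nrm2 d G cG)).
apply: dv_int_lty; apply: hIntD.
  exact: hInt_ge0 (@hcont_nrm2 d F cF) (@nrm2_ge0 d F) F2.
exact: hInt_ge0 (@hcont_nrm2 d G cG) (@nrm2_ge0 d G) G2.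
Qed.

Lemma cInt_integrand d F G : L2 d F -> L2 d G -> cInt (integrand d F G).
Proof.
move=> LF LG; have [cs fs] := nrm2_sum_lty LF LG.
have cI := @ccont_integrand d F G LF.1 LG.1.
by have [] := cInt_bound cI cs (@integrand_le d F G) fs.
Qed.

Lemma L2_D d F G : L2 d F -> L2 d G -> L2 d (fun z => F z + G z).
Proof.
move=> LF LG; have [cs fs] := nrm2_sum_lty LF LG; have [cF _] := LF; have [cG _] := LG.
split; first exact: ccontD.
have Is : hInt (fun z => nrm2 d F z + nrm2 d G z).
  by apply: hInt_ge0 => // z; rewrite addr_ge0 ?nrm2_ge0.
have cs2 : hcont (fun z => 2 * (nrm2 d F z + nrm2 d G z)).
  have -> : (fun z => 2 * (nrm2 d F z + nrm2 d G z)) =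
     (fun z => (nrm2 d F z + nrm2 d G z) + (nrm2 d F z + nrm2 d G z)).
    by apply/funext => z; ring.
  exact: hcontD.
apply: dv_int_lty.
apply: (hInt_le (@hcont_nrm2 d (fun z => F z + G z) (ccontD cF cG)) cs2) => [z|]; last exact: dv_int_lty (hIntZ 2 Is).
rewrite ger0_norm ?nrm2_ge0 // -lecR.
have -> : (2 * (nrm2 d F z + nrm2 d G z))%:C = 2%:C * (`|F z| ^+ 2 + `|G z| ^+ 2) * (ypow d z)%:C.
  by rewrite -mulrA [X in _ = _ * X]mulrDl -!nrm2C -rmorphD -rmorphM.
rewrite nrm2C.
rewrite ler_wpM2r ?lecR ?ypow_ge0 //.
apply: (@le_trans _ _ ((`|F z| + `|G z|) ^+ 2)).
  by apply: lerXn2r; rewrite ?nnegrE ?addr_ge0 ?normr_ge0 // ler_normD.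
have -> : 2%:C = 2 :> R[i] by rewrite rmorph_nat.
rewrite -subr_ge0.
have -> : 2 * (`|F z| ^+ 2 + `|G z| ^+ 2) - (`|F z| + `|G z|) ^+ 2 = (`|F z| - `|G z|) ^+ 2 by ring.
by rewrite real_exprn_even_ge0 // rpredB // normr_real.
Qed.

Lemma L2_Z d a F : L2 d F -> L2 d (fun z => a * F z).
Proof.
move=> [cF F2]; split; first exact: ccontM (@ccont_cst R a) cF.
have IF := hInt_ge0 (@hcont_nrm2 d F cF) (@nrm2_ge0 d F) F2.
have := dv_int_lty (hIntZ (complex.Re (`|a| ^+ 2)) IF); congr (dv_int _ < _)%E.
apply/funext => z; rewrite /nrm2 mulrA; congr (_ * _).
by rewrite normrM exprMn !normC_sq -rmorphM.
Qed.

Lemma dotE d F G : dot d F G = dv_intC (integrand d F G). Proof. by []. Qed.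

Lemma dotDl d F F' G : L2 d F -> L2 d F' -> L2 d G ->
  dot d (fun z => F z + F' z) G = dot d F G + dot d F' G.
Proof.
move=> LF LF' LG; rewrite !dotE -dv_intCD; try exact: cInt_integrand.
by congr dv_intC; apply/funext => z; rewrite /integrand !mulrDl.
Qed.

Lemma dotZl d a F G : L2 d F -> L2 d G -> dot d (fun z => a * F z) G = a * dot d F G.
Proof.
move=> LF LG; rewrite !dotE -dv_intCZ; last exact: cInt_integrand.
by congr dv_intC; apply/funext => z; rewrite /integrand !mulrA.
Qed.

Lemma dot_sym d F G : dot d G F = (dot d F G)^*%C.
Proof.
rewrite !dotE -dv_intC_conj; congr dv_intC; apply/funext => z.
rewrite /integrand !rmorphM; congr (_ * _); last by rewrite /= oppr0.
by rewrite mulrC; congr (_ * _); case: (G z) => a b; rewrite /= opprK.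
Qed.

Lemma dot_conj d F G : dot d (fun z => (F z)^*%C) (fun z => (G z)^*%C) = (dot d F G)^*%C.
Proof.
rewrite !dotE -dv_intC_conj; congr dv_intC; apply/funext => z.
by rewrite /integrand !rmorphM; congr (_ * _); rewrite /= oppr0.
Qed.

(* The right action [s |-> pi(s^-1)].                                         *)
Definition op d s F z : R[i] := F (mp_act s z) * mp_eta s z ^- d.

Lemma op_mul d s t F : op d (s * t)%g F = op d t (op d s F).
Proof.
apply/funext => z; rewrite /op.
have -> : mp_act (s * t)%g z = mp_act s (mp_act t z) by exact: moebius_mul.
have -> : mp_eta (s * t)%g z = mp_eta s (mp_act t z) * mp_eta t z by [].
by rewrite exprMn invfM mulrA.
Qed.

Lemma op1 d F : op d 1%g F = F.
Proof.
apply/funext => z; rewrite /op.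
have -> : mp_act 1%g z = z by exact: moebius1.
have -> : mp_eta (1%g : Mp R) z = 1 by [].
by rewrite expr1n invr1 mulr1.
Qed.

Lemma holo_etaV d s : holomorphic (fun z => mp_eta s z ^- d).
Proof.
have h0 z : mp_eta s z ^+ d != 0 by rewrite expf_neq0 // mp_eta_neq0.
exact: (@holomorphicV R (fun z => mp_eta s z ^+ d) h0 (@holomorphicX R (mp_eta s) d (@mp_holo R s))).
Qed.

Lemma holo_op d s F : holomorphic F -> holomorphic (op d s F).
Proof.
move=> hF; exact: (holomorphicM (@holomorphic_moebius R F (mp_g s) hF) (@holo_etaV d s)).
Qed.

Lemma ccont_op d s F : ccont F -> ccont (op d s F).
Proof.
move=> cF; exact: (ccontM (@ccont_moebius R F (mp_g s) cF) (ccont_holo (@holo_etaV d s))).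
Qed.

Lemma im_moebius g z : complex.Im (moebius g z) * (Normc.normc (jfac g z)) ^+ 2 = complex.Im z.
Proof.
have E := sl2_detE g; have j0 := jfac_neq0 g z.
have J : (Normc.normc (jfac g z) ^+ 2)%:C = jfac g z * (jfac g z)^*%C by rewrite -normC_sq sqr_normC.
have e : (uhp_val (moebius g z)) * (Normc.normc (jfac g z) ^+ 2)%:C = anum g z * (jfac g z)^*%C.
  by rewrite J mulrA divfK.
have := congr1 (@complex.Im R) e.
have -> : complex.Im ((uhp_val (moebius g z)) * (Normc.normc (jfac g z) ^+ 2)%:C) =
    complex.Im (moebius g z) * (Normc.normc (jfac g z)) ^+ 2.
  by case: (uhp_val (moebius g z)) => a b /=; rewrite mulr0 add0r.
move=> ->; rewrite /anum /jfac.
set a := g 0 0 in E *; set b := g 0 1 in E *; set c := g 1 0 in E *; set d := g 1 1 in E *.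
case: (uhp_val z) => x y /=.
transitivity (y * (a * d - b * c)); first by ring.
by rewrite E mulr1.
Qed.

Lemma ypow_act d s z :
  ypow d (mp_act s z) * (Normc.normc (mp_eta s z) ^+ 2) ^+ d = ypow d z.
Proof.
have e := im_moebius (mp_g s) z.
set r := Normc.normc (mp_eta s z) ^+ 2.
have r0 : 0 <= r by exact: sqr_ge0.
have jr : Normc.normc (jfac (mp_g s) z) = r.
  by apply: (@complexI R); rewrite /r -normC_sq -normrX mp_sqr.
rewrite /ypow -/r -e jr powRM ?sqr_ge0 ?(ltW (uhp_im _)) //; congr (_ * _).
by rewrite -powR_mulrn // -[r ^+ 2]powR_mulrn // -powRrM mulrCA divff ?mulr1 ?pnatr_eq0.
Qed.

Lemma integrand_op d s F G z :
  integrand d (op d s F) (op d s G) z = integrand d F G (mp_act s z).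
Proof.
rewrite /integrand /op -(ypow_act d s z).
set w := mp_act s z; set e := mp_eta s z.
have e0 : e ^+ d != 0 by rewrite expf_neq0 // mp_eta_neq0.
have ec0 : (e^*%C) ^+ d != 0.
  by rewrite -rmorphXn -normr_gt0 normC_conj normr_gt0.
have -> : (ypow d w * (Normc.normc e ^+ 2) ^+ d)%:C = (ypow d w)%:C * (e ^+ d * (e^*%C) ^+ d).
  have h : (Normc.normc e ^+ 2)%:C = e * e^*%C by rewrite -normC_sq sqr_normC.
  by rewrite -exprMn -h -rmorphXn -rmorphM.
rewrite rmorphM fmorphV rmorphXn.
rewrite /=. move: (e ^+ d) (e^*%C ^+ d) (F w) ((G w)^*%C) ((ypow d w)%:C) e0 ec0 => A B X Y Z A0 B0.
by field; apply/andP.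
Qed.

(** Unitarity: the two automorphy factors turn [y^m] at [z] into [y^m] at the image point
    ([integrand_op]), and the measure is invariant. *)
Lemma dot_op d s F G : ccont F -> ccont G -> dot d (op d s F) (op d s G) = dot d F G.
Proof.
move=> cF cG; rewrite !dotE -(dv_intC_moebius (mp_g s) (@ccont_integrand d F G cF cG)).
by congr dv_intC; apply/funext => z; exact: integrand_op.
Qed.

Lemma L2_op d s F : L2 d F -> L2 d (op d s F).
Proof.
move=> [cF F2]; split; first exact: ccont_op.
have -> : nrm2 d (op d s F) = (fun z => nrm2 d F (moebius (mp_g s) z)).
  apply/funext => z; apply: (@complexI R).
  by rewrite !nrm2C !sqr_normC; exact: integrand_op.
by rewrite (@dv_int_moebius R (nrm2 d F) (mp_g s) (@hcont_nrm2 d F cF)).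
Qed.

End ComplexIntegrals.

(** * Finite integrals in one variable *)

Section OneVariableBounds.
Variable R : realType.
Local Notation mu := (@lebesgue_measure R).
Local Open Scope ereal_scope.

Lemma integral_exhaustion_le (F : nat -> set R) (h : R -> \bar R) (M : \bar R) :
  {homo F : n m / (n <= m)%N >-> (n <= m)%O} -> (forall n, measurable (F n)) ->
  (forall n, measurable_fun (F n) h) -> (forall n x, F n x -> 0 <= h x) ->
  (forall n, \int[mu]_(x in F n) h x <= M) ->
  \int[mu]_(x in \bigcup_n F n) h x <= M.
Proof.
move=> nd mF mh h0 hM.
have c := ge0_nondecreasing_set_cvg_integral (mu := mu) nd mF mh h0.
rewrite -(cvg_lim _ c) //; apply: lime_le; first by apply/cvg_ex; eexists; exact: c.
exact: nearW.
Qed.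

Lemma integral_oneDsqrV_lty : \int[mu]_x ((1 + x ^+ 2)^-1)%:E < +oo.
Proof.
pose F (n : nat) : set R := `[(- n.+1%:R)%R, n.+1%:R%R]%classic.
have FT : [set: R] = \bigcup_n F n.
  apply/seteqP; split => // x _; exists (Num.truncn `|x|%R) => //.
  rewrite /F /= in_itv /= -ler_norml; apply/ltW; exact: truncnS_gt.
have c1 (x : R) : (1 + x ^+ 2)%R != 0%R by rewrite gt_eqF // ltr_pwDl // sqr_ge0.
have cA : continuous (fun x : R => (1 + x ^+ 2)^-1)%R by exact: continuous_oneDsqrV.
rewrite FT; apply: le_lt_trans (ltry pi); apply: integral_exhaustion_le.
- move=> m n mn; rewrite subsetEset => x; rewrite /F /= !in_itv /= => /andP[h1 h2].
  have mnR : (m.+1%:R <= n.+1%:R :> R)%R by rewrite ler_nat ltnS.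
  by apply/andP; split; lra.
- by move=> n; exact: measurable_itv.
- move=> n; apply/measurable_EFinP; apply: measurable_funTS.
  exact: continuous_measurable_fun.
- by move=> n x _; rewrite lee_fin invr_ge0 addr_ge0 ?sqr_ge0.
- move=> n; rewrite /F (@continuous_FTC2 _ _ (@atan R)) //.
  + rewrite -EFinB lee_fin; have := atan_gtNpi2 (- n.+1%:R : R); have := atan_ltpi2 (n.+1%:R : R).
    by lra.
  + have : (0 < n.+1%:R :> R)%R by rewrite ltr0n.
    by lra.
  + by apply: continuous_subspaceT.
  + split; first by move=> x _; exact: derivable_atan.
      by apply: cvg_at_right_filter; exact: continuous_atan.
    by apply: cvg_at_left_filter; exact: continuous_atan.
  + by move=> x _; exact: derive1_atan.
Qed.

Lemma measurable_sqrtV :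
  measurable_fun (`]0%R, +oo[%classic : set R) (fun y => ((Num.sqrt y * (1 + y))^-1)%:E).
Proof.
apply/measurable_EFinP; apply: open_continuous_measurable_fun; first exact: interval_open.
move=> y; rewrite inE /= in_itv /= andbT => y0; apply: cvgV.
  by rewrite mulf_neq0 ?gt_eqF ?sqrtr_gt0 // addr_gt0.
apply: cvgM; first exact: sqrt_continuous.
by apply: cvgD; [exact: cvg_cst|exact: cvg_id].
Qed.

Lemma integral_sqrt_lty : \int[mu]_(y in `]0%R, +oo[) ((Num.sqrt y * (1 + y))^-1)%:E < +oo.
Proof.
pose h (y : R) : R := ((Num.sqrt y * (1 + y))^-1)%R.
pose H (y : R) : R := (2 * atan (Num.sqrt y))%R.
have s0 (y : R) : (0 < y)%R -> (Num.sqrt y != 0)%R by move=> y0; rewrite gt_eqF // sqrtr_gt0.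
have y1 (y : R) : (0 < y)%R -> (1 + y != 0)%R by move=> y0; rewrite gt_eqF // addr_gt0.
have ch (y : R) : (0 < y)%R -> {for y, continuous h}.
  move=> y0; apply: cvgV; first by rewrite mulf_neq0 ?s0 ?y1.
  apply: cvgM; first exact: sqrt_continuous.
  by apply: cvgD; [exact: cvg_cst|exact: cvg_id].
have dH (y : R) : (0 < y)%R -> is_derive y 1%R H (h y).
  move=> y0.
  have da : is_derive (Num.sqrt y) 1%R (@atan R) ((1 + Num.sqrt y ^+ 2)^-1)%R.
    by split; [exact: derivable_atan|rewrite -derive1E derive1_atan].
  have := is_deriveZ 2%R (@is_derive1_comp R (@atan R) Num.sqrt y _ _ da (is_derive1_sqrt y0)).
  congr (is_derive _ _ _ _).
  rewrite /GRing.scale /= /h sqr_sqrtr ?(ltW y0) //.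
  by field; rewrite s0 // y1.
have cH (y : R) : (0 < y)%R -> {for y, continuous H}.
  move=> y0; have [d _] := dH y y0.
  by apply: differentiable_continuous; exact/derivable1_diffP.
have c := @positive_exhaustion R 1%R 1%R (fun y => (h y)%:E) ltr01 ltr01.
have mh := measurable_sqrtV.
have h0 (y : R) : (0 < y)%R -> 0 <= (h y)%:E.
  by move=> y0; rewrite lee_fin invr_ge0 mulr_ge0 ?sqrtr_ge0 // addr_ge0 // ltW.
apply: le_lt_trans (ltry pi); apply: cvge_le (c mh h0).
exists 1%N => // n /= n1.
set a := (1 / n.+1%:R)%R; set b := (1 * n.+1%:R)%R.
have a0 : (0 < a)%R by rewrite divr_gt0.
have ab : (a < b)%R.
  rewrite /a /b !mul1r; apply: (@lt_trans _ _ 1%R); last by rewrite ltr1n ltnS.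
  by rewrite invf_lt1 ?ltr0n // ltr1n ltnS.
have b0 := lt_trans a0 ab.
rewrite (@continuous_FTC2 _ _ H) //.
- rewrite -EFinB lee_fin /H; have := atan_ltpi2 (Num.sqrt b).
  have : (0 <= atan (Num.sqrt a))%R by rewrite -atan0 le_atan // sqrtr_ge0.
  by lra.
- apply: continuous_in_subspaceT => y; rewrite inE /= in_itv /= => /andP[ay _].
  by apply: ch; exact: lt_le_trans ay.
- split.
  + move=> y; rewrite in_itv /= => /andP[ay _].
    by have [] := dH y (lt_trans a0 ay).
  + by apply: cvg_at_right_filter; exact: cH.
  + by apply: cvg_at_left_filter; exact: cH.
- move=> y; rewrite in_itv /= => /andP[ay _].
  by rewrite derive1E; have [_ ->] := dH y (lt_trans a0 ay).
Qed.

End OneVariableBounds.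

(** * Square-integrability of the functions f_k *)

Section LowestWeight.
Variable R : realType.
Local Notation C := (R[i]^o).
Local Notation uhp := (uhp R).
Local Notation mu := (@lebesgue_measure R).
Local Notation mu2 := (@lebesgue_measure R \x @lebesgue_measure R)%E.
Implicit Types (z : uhp) (s : Mp R) (k d l : nat).

Definition fk k d z : R[i] := fkm k d z.

Lemma holo_fk k d : holomorphic (fk k d).
Proof.
have -> : fk k d = (fun z => cay z ^+ k * theta z ^- d).
  by apply/funext => z; rewrite /fk fkmE.
have h0 z : theta z ^+ d != 0 by rewrite expf_neq0 // theta_neq0.
apply: (holomorphicM (@holomorphicX R _ k (@holomorphic_cay R))).
exact: (holomorphicV h0 (@holomorphicX R _ d (@holomorphic_theta R))).
Qed.

Lemma norm_fk k d z : `|fk k d z| <= `|fk 0 d z|.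
Proof.
rewrite /fk !fkmE expr0 mul1r normrM normrX ler_piMl //.
by apply: exprn_ile1 => //; exact: ltW (norm_cay z).
Qed.

(** A product of one-variable functions, each integrable by an explicit arctangent primitive. A
    multiple of it dominates the density of [|f_0|^2] for every weight considered. *)
Let majorant (p : R * R) : R := (1 + p.1 ^+ 2)^-1 * (Num.sqrt p.2 * (1 + p.2))^-1.

Let majorant_cont (p : R * R) : 0 < p.2 -> {for p, continuous majorant}.
Proof.
move=> p0; apply: cvgM.
  apply: (@cvg_comp _ _ _ (@fst R R) (fun x : R => (1 + x ^+ 2)^-1) (nbhs p) (nbhs p.1)).
    exact: cvg_fst.
  exact: continuous_oneDsqrV.
apply: (@cvg_comp _ _ _ (@snd R R) (fun y : R => (Num.sqrt y * (1 + y))^-1) (nbhs p) (nbhs p.2)).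
  exact: cvg_snd.
apply: cvgV; first by rewrite mulf_neq0 ?gt_eqF ?sqrtr_gt0 // addr_gt0.
apply: cvgM; first exact: sqrt_continuous.
by apply: cvgD; [exact: cvg_cst|exact: cvg_id].
Qed.

Let majorant_ge0 (p : R * R) : 0 < p.2 -> 0 <= majorant p.
Proof.
move=> p0; apply: mulr_ge0; rewrite invr_ge0 ?addr_ge0 ?sqr_ge0 //.
by rewrite mulr_ge0 ?sqrtr_ge0 // addr_ge0 // ltW.
Qed.

Let majorant_lty : (\int[mu2]_(p in @HP R) (majorant p)%:E < +oo)%E.
Proof.
rewrite (HP_tonelli_xy majorant_cont majorant_ge0).
have B0 : (0 <= \int[mu]_(y in `]0%R, +oo[) ((Num.sqrt y * (1 + y))^-1)%:E)%E.
  apply: integral_ge0 => y; rewrite /= in_itv /= andbT => y0.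
  by rewrite lee_fin invr_ge0 mulr_ge0 ?sqrtr_ge0 // addr_ge0 // ltW.
have := integral_sqrt_lty R; move: B0.
set B := (\int[mu]_(y in _) _)%E => B0 Bfin.
have -> : (\int[mu]_x \int[mu]_(y in `]0%R, +oo[) (majorant (x, y))%:E =
   \int[mu]_x (B * ((1 + x ^+ 2)^-1)%:E))%E.
  apply: eq_integral => x _; rewrite muleC /B -ge0_integralZl //.
  - exact: measurable_sqrtV.
  - move=> y; rewrite /= in_itv /= andbT => y0.
    by rewrite lee_fin invr_ge0 mulr_ge0 ?sqrtr_ge0 // addr_ge0 // ltW.
  - by rewrite lee_fin invr_ge0 addr_ge0 ?sqr_ge0.
rewrite ge0_integralZl //.
- apply: lte_mul_pinfty => //; first by rewrite ge0_fin_numE.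
  exact: integral_oneDsqrV_lty.
- apply/measurable_EFinP; apply: continuous_measurable_fun; exact: continuous_oneDsqrV.
- by move=> x _; rewrite lee_fin invr_ge0 addr_ge0 ?sqr_ge0.
Qed.

Lemma norm_theta z : (Normc.normc (theta z)) ^+ 2 * 2 = Normc.normc ((z : R[i]) + 'i%C).
Proof.
apply: (@complexI R).
have n2 : `|2 * 'i%C| = 2%:C :> R[i].
  by rewrite normrM [X in _ * X]normc_def /= expr0n add0r expr1n sqrtr1 mulr1 ger0_norm ?ler0n // rmorph_nat.
rewrite rmorphM /= -[(Normc.normc (theta z) ^+ 2)%:C]normC_sq -normrX theta_sqr normrM normfV n2.
by rewrite divfK // rmorph_nat pnatr_eq0.
Qed.

Lemma nrm2_fk0 d z : nrm2 d (fk 0 d) z * (Normc.normc (theta z) ^+ 2) ^+ d = ypow d z.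
Proof.
have t0 := theta_neq0 z.
have h : (Normc.normc (theta z) ^+ 2)%:C = `|theta z| ^+ 2 by rewrite normC_sq.
apply: (@complexI R).
have -> : (nrm2 d (fk 0 d) z * (Normc.normc (theta z) ^+ 2) ^+ d)%:C =
    (nrm2 d (fk 0 d) z)%:C * (`|theta z| ^+ 2) ^+ d by rewrite -h -rmorphXn -rmorphM.
rewrite nrm2C /fk fkmE expr0 mul1r normfV normrX.
by rewrite exprVn mulrAC -!exprM mulnC mulVf ?mul1r // expf_neq0 // normr_eq0.
Qed.

Lemma ypow_sqrt d z : ypow d z = Num.sqrt (complex.Im z) ^+ d.
Proof.
have y0 := ltW (uhp_im z).
by rewrite /ypow mulrC powRrM powR12_sqrt // powR_mulrn // sqrtr_ge0.
Qed.

(** With [rho = |z + i|], the density of [|f_0|^2] is [2^d y^(l - 1/2) / rho^(2 l + 3)]. The bounds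
    [y <= rho^2], [1 + x^2 <= rho^2] and [1 + y <= rho] absorb respectively [2 l], 2 and 1 powers of
    [rho]. *)
Let nrm2_majorant l (x y : R) : 0 < y ->
  jac (nrm2 (2 * l + 3) (fk 0 (2 * l + 3))) (x, y) <= 2 ^+ (2 * l + 3) * majorant (x, y).
Proof.
move=> y0; set d := (2 * l + 3)%N.
have -> : jac (nrm2 d (fk 0 d)) (x, y) = nrm2 d (fk 0 d) (@UHP R (x +i* y) y0) / y ^+ 2.
  by rewrite /jac /= -[x +i* y]/(uhp_val (@UHP R (x +i* y) y0)) ext0E.
set z := UHP _.
pose rho := Normc.normc ((z : R[i]) + 'i%C).
have rhoE : rho ^+ 2 = x ^+ 2 + (1 + y) ^+ 2.
  by rewrite /rho /= sqr_sqrtr ?addr_ge0 ?sqr_ge0 // addr0 [y + 1]addrC.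
have rho_ge : 1 + y <= rho.
  rewrite -(ler_pXn2r (n := 2)) ?nnegrE ?addr_ge0 ?(ltW y0) ?sqrtr_ge0 //.
  by rewrite rhoE lerDr sqr_ge0.
have rho1 : 1 <= rho by apply: le_trans rho_ge; rewrite lerDl ltW.
have rho0 : 0 < rho by exact: lt_le_trans ltr01 rho1.
have tE : Normc.normc (theta z) ^+ 2 = rho / 2 by rewrite /rho -norm_theta mulfK.
have e := nrm2_fk0 d z; rewrite tE ypow_sqrt in e.
have hd : (rho / 2) ^+ d != 0 by rewrite expf_neq0 // mulf_neq0 ?gt_eqF.
have -> : nrm2 d (fk 0 d) z = Num.sqrt y ^+ d / (rho / 2) ^+ d by rewrite -e mulfK.
have s2 : Num.sqrt y ^+ 2 = y by rewrite sqr_sqrtr // ltW.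
set t := Num.sqrt y in s2 *.
have t0 : 0 < t by rewrite sqrtr_gt0.
rewrite expr_div_n invf_div /majorant /= -/t.
have -> : t ^+ d * (2 ^+ d / rho ^+ d) / y ^+ 2 =
   2 ^+ d * (t ^+ (2 * l) / t / rho ^+ d).
  rewrite /d -s2 exprD; field; rewrite !expf_neq0 ?gt_eqF //.
apply: ler_wpM2l; first exact: exprn_ge0.
have -> : (1 + x ^+ 2)^-1 * (t * (1 + y))^-1 = ((1 + x ^+ 2) * (1 + y))^-1 / t.
  by rewrite !invfM -!mulrA; congr (_ * _); rewrite mulrC.
rewrite mulrAC ler_wpM2r ?invr_ge0 ?(ltW t0) //.
have p1 : 0 < 1 + x ^+ 2 by rewrite ltr_pwDl // sqr_ge0.
have p2 : 0 < 1 + y by rewrite addr_gt0.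
rewrite ler_pdivrMr ?exprn_gt0 // ler_pdivlMl ?mulr_gt0 // /d exprD.
have -> : (1 + x ^+ 2) * (1 + y) * t ^+ (2 * l) = t ^+ (2 * l) * ((1 + x ^+ 2) * (1 + y)) by ring.
apply: ler_pM; rewrite ?exprn_ge0 ?(ltW t0) ?mulr_ge0 ?(ltW p1) ?(ltW p2) //.
  rewrite exprM s2 exprM; apply: lerXn2r; rewrite ?nnegrE ?sqr_ge0 ?(ltW y0) //.
  by rewrite rhoE; nra.
have -> : rho ^+ 3 = rho ^+ 2 * rho by ring.
apply: ler_pM; rewrite ?(ltW p1) ?(ltW p2) //.
by rewrite rhoE; nra.
Qed.

Lemma sq_integrable_fk k l : (dv_int (nrm2 (2 * l + 3) (fk k (2 * l + 3))) < +oo)%E.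
Proof.
set d := (2 * l + 3)%N.
have c0 : hcont (nrm2 d (fk 0 d)) := @hcont_nrm2 R d _ (ccont_holo (@holo_fk 0 d)).
have ck : hcont (nrm2 d (fk k d)) := @hcont_nrm2 R d _ (ccont_holo (@holo_fk k d)).
have f0 : (dv_int (nrm2 d (fk 0 d)) < +oo)%E.
  have cM (p : R * R) : 0 < p.2 -> {for p, continuous (fun p => 2 ^+ d * majorant p)}.
    by move=> p0; apply: cvgM; [exact: cvg_cst|exact: majorant_cont].
  apply: (@le_lt_trans _ _ (\int[mu2]_(p in @HP R) ((2 ^+ d)%:E * (majorant p)%:E))%E).
    rewrite dv_intE; apply: ge0_le_integral.
    - exact: measurable_HP.
    - by move=> p p0; rewrite lee_fin; apply: jac_ge0 => // z; exact: nrm2_ge0.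
    - exact: measurable_jac.
    - by apply/measurable_EFinP; apply: HP_continuous_measurable.
    - by move=> -[x y] /= y0; rewrite -EFinM lee_fin; exact: nrm2_majorant.
  rewrite ge0_integralZl //.
  - by apply: lte_mul_pinfty => //; rewrite lee_fin exprn_ge0.
  - exact: measurable_HP.
  by apply/measurable_EFinP; apply: HP_continuous_measurable.
suff h z : `|nrm2 d (fk k d) z| <= nrm2 d (fk 0 d) z by exact: dv_int_lty (hInt_le ck c0 h f0).
rewrite ger0_norm ?nrm2_ge0 // -lecR !nrm2C; apply: ler_wpM2r.
  by rewrite lecR ypow_ge0.
by apply: lerXn2r; rewrite ?nnegrE ?normr_ge0 // norm_fk.
Qed.

Lemma L2_fk k l : L2 (2 * l + 3) (fk k (2 * l + 3)).
Proof. by split; [exact: ccont_holo (@holo_fk _ _)|exact: sq_integrable_fk]. Qed.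

End LowestWeight.

(** * Orthogonality and the coefficients of the expansion *)

Section Coefficients.
Variable R : realType.
Local Notation C := (R[i]^o).
Local Notation uhp := (uhp R).
Local Notation mu := (@lebesgue_measure R).
Local Notation mu2 := (@lebesgue_measure R \x @lebesgue_measure R)%E.
Implicit Types (z : uhp) (F G : uhp -> R[i]) (s : Mp R) (k j : nat).

Variable l : nat.
Local Notation d := (2 * l + 3)%N.
Local Notation fk := (@fk R).

Lemma op_fk s k z : op d s (fk k d) z = fkm k d (mp_act s z) * mp_eta s z ^- d.
Proof. by []. Qed.

Lemma op_kappa_fk (t : R) k :
  op d (kappa t) (fk k d) = (fun z => expi (- ((d + 4 * k)%:R / 2 * t)) * fk k d z).
Proof. by apply/funext => z; rewrite op_fk fkm_kappa. Qed.

Lemma dotZr a F G : L2 d F -> L2 d G ->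
  dot d F (fun z => a * G z) = a^*%C * dot d F G.
Proof.
move=> LF LG; rewrite dot_sym dotZl // [dot d F G]dot_sym.
exact: (rmorphM (@conjc R)).
Qed.

(** The weights differ by [2 (k - j)]; at [t = pi / (2 (k - j))] the relative character is [-1], and
    unitarity of [kappa t] equates the product with its opposite. *)
Lemma dot_fk_orthogonal k j : k != j -> dot d (fk k d) (fk j d) = 0.
Proof.
move=> kj; have Lk := @L2_fk R k l; have Lj := @L2_fk R j l.
pose t : R := pi / (2 * (k%:R - j%:R)).
have kj0 : k%:R - j%:R != 0 :> R by rewrite subr_eq0 eqr_nat.
have := dot_op d (kappa t) Lk.1 Lj.1.
rewrite !op_kappa_fk (dotZl _ Lk (L2_Z _ Lj)) (dotZr _ Lk Lj).
rewrite mulrA -expiN -expiD.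
have -> : - ((d + 4 * k)%:R / 2 * t) + - - ((d + 4 * j)%:R / 2 * t) = - pi.
  have E (D i : nat) : (D + 4 * i)%:R = D%:R + 4 * i%:R :> R by rewrite natrD natrM.
  by rewrite !E /t; field.
rewrite expiN expi_pi; move: (dot _ _ _) => x.
by case: x => a b; simpc => -[h1 h2]; congr (_ +i* _); lra.
Qed.

(** A vanishing norm would make the density zero almost everywhere, whereas it is positive on a box
    of measure 1. *)
Lemma dot_fk_neq0 k : dot d (fk k d) (fk k d) != 0.
Proof.
have [ck Lk] := @L2_fk R k l; apply/eqP => /(congr1 (@complex.Re R)).
have cn := @hcont_nrm2 R d _ ck.
rewrite dotE dv_intCE /=.
have -> : (fun z => complex.Re (integrand d (fk k d) (fk k d) z)) = nrm2 d (fk k d).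
  by apply/funext => z; rewrite /integrand -sqr_normC -nrm2C.
move=> R0; have J0 p : 0 < p.2 -> 0 <= jac (nrm2 d (fk k d)) p.
  by move=> p0; apply: jac_ge0 => // z; exact: nrm2_ge0.
have I0 : (\int[mu2]_(p in @HP R) `|(jac (nrm2 d (fk k d)) p)%:E| = 0)%E.
  have -> : (\int[mu2]_(p in @HP R) `|(jac (nrm2 d (fk k d)) p)%:E| = dv_int (nrm2 d (fk k d)))%E.
    by apply: eq_integral => p; rewrite inE => p0; rewrite gee0_abs // lee_fin J0.
  rewrite -[LHS]fineK; first by rewrite -/(Rdv _) R0.
  rewrite ge0_fin_numE //; apply: integral_ge0 => p p0.
  by rewrite lee_fin J0.
have [N [mN N0 sN]] := (ae_eq_integral_abs _ (@measurable_HP R) (measurable_jac cn)).1 I0.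
(* The box stays away from [i], the only point where [cay], and hence [f_k], can vanish. *)
pose A : set (R * R) := `]0, 1[%classic `*` `]2, 3[%classic.
have AN : A `<=` N.
  move=> p [/=]; rewrite !in_itv /= => /andP[x0 x1] /andP[y2 y3]; apply: sN => /= h.
  have p0 : 0 < p.2 by lra.
  have q0 : p.2 ^+ 2 != 0 by rewrite expf_neq0 // gt_eqF.
  have [/eqP] : (jac (nrm2 d (fk k d)) p)%:E = 0%E by exact: h.
  rewrite /jac mulf_eq0 invr_eq0 (negPf q0) orbF.
  rewrite -[p.1 +i* p.2]/(uhp_val (@UHP R (p.1 +i* p.2) p0)) ext0E => /eqP/(congr1 (real_complex R)).
  set z := UHP _; rewrite nrm2C => /eqP; rewrite /fk fkmE; apply/negP.
  have cz : cay z != 0.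
    rewrite mulf_neq0 ?invr_neq0 ?uhpDi_neq0 // subr_eq0; apply/eqP => /(congr1 (@complex.Im R)) /=; lra.
  rewrite mulf_neq0 ?expf_neq0 ?normr_eq0 ?mulf_neq0 ?expf_neq0 ?invr_neq0 ?theta_neq0 //.
    by rewrite expf_neq0 // theta_neq0.
  by rewrite (fmorph_eq0 (real_complex R)) gt_eqF // powR_gt0.
have mA : measurable A by apply: measurableX; exact: measurable_itv.
have : (mu2 A <= mu2 N)%E by apply: le_measure; rewrite ?inE.
have E1 : mu `]0, 1[%classic = 1%E by rewrite lebesgue_measure_itv /= lte01 oppr0 adde0.
have E2 : mu `]2, 3[%classic = 1%E.
  rewrite lebesgue_measure_itv /= lte_fin ltr_nat /= -EFinB; congr EFin; ring.
pose A1 : set R := `]0, 1[%classic; pose A2 : set R := `]2, 3[%classic.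
have E : mu2 A = (mu A1 * mu A2)%E.
  by apply: product_measure1E; exact: measurable_itv.
by rewrite N0 E E1 E2 mule1 leNgt lte01.
Qed.

Lemma dot_sum n (a : 'I_n -> R[i]) (F : 'I_n -> uhp -> R[i]) G :
  (forall i, L2 d (F i)) -> L2 d G ->
  L2 d (fun z => \sum_i a i * F i z) /\
  dot d (fun z => \sum_i a i * F i z) G = \sum_i a i * dot d (F i) G.
Proof.
move=> LF LG; elim: n a F LF => [|n IH] a F LF.
  have E : (fun z => \sum_(i < 0) a i * F i z) = (fun z : uhp => 0 * G z).
    by apply/funext => z; rewrite big_ord0 mul0r.
  rewrite E; split; first exact: L2_Z.
  by rewrite (dotZl 0 LG LG) mul0r big_ord0.
have [L E] := IH (fun i => a (widen_ord (leqnSn n) i)) _ (fun i => LF (widen_ord (leqnSn n) i)).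
have E' : (fun z => \sum_(i < n.+1) a i * F i z) = (fun z =>
   \sum_(i < n) a (widen_ord (leqnSn n) i) * F (widen_ord (leqnSn n) i) z + a ord_max * F ord_max z).
  by apply/funext => z; rewrite big_ord_recr.
rewrite E'; split; first exact: (L2_D L (L2_Z _ (LF ord_max))).
by rewrite (dotDl L (L2_Z _ (LF ord_max)) LG) E (dotZl _ (LF ord_max) LG) big_ord_recr.
Qed.

(** By orthogonality the approximating polynomial contributes exactly its [j]-th coefficient. Since
    [|f_j| <= |f_0|], the error contributes at most [e] times a constant multiple of the squared
    norm of [f_0], and [e] is arbitrary. *)
Lemma dot_expansion F j (b : R[i]) : L2 d F ->
  (forall e : R, 0 < e -> exists p : {poly R[i]}, p`_j = b /\
    forall z, `|F z - \sum_(i < size p) p`_i * fk i d z| <= e%:C * `|fk 0 d z|) ->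
  dot d F (fk j d) = b * dot d (fk j d) (fk j d).
Proof.
move=> LF hF; have Lj := @L2_fk R j l; have L0 := @L2_fk R 0 l.
have c0 : hcont (nrm2 d (fk 0 d)) := @hcont_nrm2 R d _ L0.1.
pose K := 2 * Rdv (nrm2 d (fk 0 d)).
have K0 : 0 <= K.
  apply: mulr_ge0 => //; apply: fine_ge0; apply: integral_ge0 => p p0.
  by rewrite lee_fin; apply: jac_ge0 => // z; exact: nrm2_ge0.
have key (e : R) : 0 < e -> `|dot d F (fk j d) - b * dot d (fk j d) (fk j d)| <= (e * K)%:C.
  move=> e0; have [p [pj hp]] := hF e e0.
  have [Lp Ep] := dot_sum (fun i : 'I_(size p) => p`_i) (fun i : 'I_(size p) => @L2_fk R i l) Lj.
  pose G z := F z + -1 * \sum_(i < size p) p`_i * fk i d z.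
  have LG : L2 d G := L2_D LF (L2_Z (-1) Lp).
  have EG : dot d G (fk j d) = dot d F (fk j d) - b * dot d (fk j d) (fk j d).
    rewrite (dotDl LF (L2_Z (-1) Lp) Lj) (dotZl (-1) Lp Lj) Ep mulN1r; congr (_ - _).
    have [jp|jp] := ltnP j (size p).
      rewrite (bigD1 (Ordinal jp)) //= pj big1 ?addr0 // => i ij.
      by rewrite dot_fk_orthogonal ?mulr0.
    have b0 : b = 0 by rewrite -pj nth_default.
    rewrite b0 mul0r big1 // => -[i /= ip] _.
    by rewrite dot_fk_orthogonal ?mulr0 // neq_ltn (leq_trans ip jp).
  rewrite -EG dotE.
  have h1 z : `|integrand d G (fk j d) z| <= (e * nrm2 d (fk 0 d) z)%:C.
    have y0 : 0 <= (ypow d z)%:C :> R[i] by rewrite lecR ypow_ge0.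
    have -> : (e * nrm2 d (fk 0 d) z)%:C = e%:C * `|fk 0 d z| * `|fk 0 d z| * (ypow d z)%:C.
      by rewrite -[e%:C * _ * _]mulrA -expr2 -mulrA -nrm2C -rmorphM.
    have E (a c y : R[i]) : 0 <= y -> `|a * c^*%C * y| = `|a| * `|c| * y.
      by move=> yy; rewrite normrM normrM normC_conj (ger0_norm yy).
    rewrite /integrand (E _ _ _ y0); apply: ler_wpM2r => //.
    apply: ler_pM => //; last exact: norm_fk.
    by rewrite /G mulN1r; exact: hp.
  have ce : hcont (fun z => e * nrm2 d (fk 0 d) z).
    have -> : (fun z => e * nrm2 d (fk 0 d) z) = (fun z => complex.Re e%:C * nrm2 d (fk 0 d) z) by [].
    exact: (hcontM (hcont_Re (@ccont_cst R e%:C)) c0).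
  have I0 := hInt_ge0 c0 (@nrm2_ge0 R d (fk 0 d)) L0.2.
  have [_] := cInt_bound (@ccont_integrand R d G (fk j d) LG.1 Lj.1) ce h1 (dv_int_lty (hIntZ e I0)).
  by rewrite RdvZ // mulrCA.
apply/eqP; rewrite -subr_eq0 -normr_le0.
set x := _ - _ in key *.
suff : Normc.normc x <= 0 by rewrite -lecR.
apply/ler_addgt0Pr => e e0; rewrite add0r -lecR.
have p : 0 < K + 1 by rewrite ltr_pwDr.
apply: le_trans (key (e / (K + 1)) (divr_gt0 e0 p)) _.
rewrite lecR mulrAC ler_pdivrMr // ler_wpM2l ?(ltW e0) //.
by rewrite lerDl.
Qed.

Lemma dot_op_fk s k j : dot d (op d s (fk k d)) (fk j d) =
  bcf k d j s * dot d (fk j d) (fk j d).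
Proof.
apply: dot_expansion; first exact: L2_op (@L2_fk R k l).
move=> e e0; have [p [pj hp]] := fkm_expansion k d s j e0.
by exists p; split.
Qed.

End Coefficients.

(** * Weight vectors *)

Section WeightVectors.
Variable R : realType.
Local Notation C := (R[i]^o).
Local Notation uhp := (uhp R).
Local Notation I := (uhp_i R).
Implicit Types (z : uhp) (s : Mp R) (t y : R).

Lemma expi_surj (x : R[i]) : `|x| = 1 -> exists t, x = expi t.
Proof.
move=> x1; have : (Normc.normc x) = 1 by apply: (@complexI R).
case: x {x1} => a b /= /(congr1 (fun u : R => u ^+ 2)).
rewrite sqr_sqrtr ?addr_ge0 ?sqr_ge0 // expr1n => ab.
have a1 : -1 <= a <= 1.
  by rewrite -ler_norml -(ler_pXn2r (n := 2)) ?nnegrE // expr1n real_normK ?num_real // -ab lerDl sqr_ge0.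
have s : sin (acos a) = `|b|.
  by rewrite sin_acos // -ab addrC addKr sqrtr_sqr.
have [b0|b0] := leP 0 b.
  by exists (acos a); rewrite /expi acosK ?s ?ger0_norm // in_itv.
exists (- acos a); rewrite /expi cosN sinN acosK ?s ?ltr0_norm ?opprK // in_itv.
Qed.

Lemma cderiv_expi (a : R) : cderiv (fun t => expi (a * t)) 0 (0 +i* a).
Proof.
have hl : is_derive (0 : R) 1 ( *%R a : R -> R) a.
  by have := @is_deriveZ R R R id a 0 1 1 (is_derive_id _ _); rewrite /GRing.scale /= mulr1.
have hc : is_derive (0 : R) 1 (fun t : R => cos (a * t)) 0.
  have := @is_derive1_comp R _ _ _ _ _ (is_derive_cos (a * 0)) hl.
  by rewrite mulr0 sin0 oppr0 mul0r.
have hs : is_derive (0 : R) 1 (fun t : R => sin (a * t)) a.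
  have := @is_derive1_comp R _ _ _ _ _ (is_derive_sin (a * 0)) hl.
  by rewrite mulr0 cos0 mul1r.
have := cderivD (cderiv_real hc) (cderivZ 'i%C (cderiv_real hs)).
congr cderiv; last by simpc.
by apply/funext => t; rewrite /expi; simpc.
Qed.

Lemma cderiv_rotation z : cderiv (fun t => mp_act (kappa t) z : R[i]) 0 (- (1 + (z : R[i]) ^+ 2)).
Proof.
have dc := cderiv_real (is_derive_cos (0 : R)); have ds := cderiv_real (is_derive_sin (0 : R)).
rewrite sin0 oppr0 in dc; rewrite cos0 in ds.
have j0 := jfac_neq0 (Defs.rot 0) z.
have E : (fun t => mp_act (kappa t) z : R[i]) =
  (fun t => ((z : R[i]) * (cos t)%:C + - (sin t)%:C) * (((z : R[i]) * (sin t)%:C + (cos t)%:C))^-1).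
  apply/funext => t; rewrite /mp_act /= /anum /jfac !mxE /=.
  by congr (_ / _); rewrite mulrC ?rmorphN.
have d1 := cderivD (cderivZ (z : R[i]) dc) (cderivN ds).
have d2 := cderivD (cderivZ (z : R[i]) ds) dc.
have n0 : (z : R[i]) * (sin 0)%:C + (cos 0)%:C != 0 by rewrite sin0 cos0 mulr0 add0r oner_eq0.
have := cderivM d1 (cderivV d2 n0).
rewrite E; congr cderiv; rewrite sin0 cos0 /=.
have -> : (0 : R)%:C = 0 by []. have -> : (1 : R)%:C = 1 by [].
by field.
Qed.

Lemma cay_kappa t z : cay (mp_act (kappa t) z) = expi (- (2 * t)) * cay z.
Proof.
rewrite cay_moebius /be /al ga_rot de_rot conjc0 mul0r addr0 add0r.
rewrite -expiN mulrAC expiV -expiD.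
by congr (expi _ * _); ring.
Qed.

Lemma cay_inj z (w : uhp) : cay z = cay w -> z = w.
Proof.
move=> e; apply: val_inj => /=.
have h1 := uhpDi_cay z; have h2 := uhpDi_cay w; rewrite e in h1.
have h3 := uhpDi_neq0 w; have h4 := uhpDi_neq0 z.
have h5 := twoi_neq0 R.
have : ((w : R[i]) + 'i%C) * ((z : R[i]) - 'i%C) = ((z : R[i]) + 'i%C) * ((w : R[i]) - 'i%C).
  by rewrite -h1 -h2 mulrCA.
move: (uhp_val z) (uhp_val w) h5 => a b h5 /eqP; rewrite -subr_eq0.
have -> : (b + 'i%C) * (a - 'i%C) - (a + 'i%C) * (b - 'i%C) = (2 * 'i%C) * (a - b) by ring.
by rewrite mulf_eq0 (negbTE h5) subr_eq0 => /eqP.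
Qed.

Lemma iline_im y : 0 < y -> 0 < complex.Im ('i%C * y%:C : R[i]).
Proof. by move=> y0; simpc. Qed.

(** Polar coordinates of the disc: a rotation takes [cay z] to the positive radius [r], which is the
    image of [i y] for [y = (1 + r) / (1 - r)]. *)
Lemma cartan z : z <> I -> exists t y (y1 : 1 < y),
  z = mp_act (kappa t) (UHP (iline_im (lt_trans ltr01 y1))).
Proof.
move=> zi; have c1 := norm_cay z.
pose r := Normc.normc (cay z).
have r1 : r < 1 by rewrite -ltcR.
have c0 : cay z != 0.
  by apply/eqP => c0; apply: zi; apply: cay_inj; rewrite cayi.
have r0 : 0 < r by rewrite -ltcR; rewrite -[r%:C]/(`|cay z|) normr_gt0.
have [t Et] : exists t, cay z / r%:C = expi t.
  apply: expi_surj; rewrite normrM normfV -[r%:C]/(`|cay z|) normr_id divff //.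
  by rewrite normr_eq0.
have d0 : 1 - r != 0 by rewrite subr_eq0 gt_eqF.
have y1 : 1 < (1 + r) / (1 - r) by rewrite ltr_pdivlMr; lra.
exists (- (t / 2)), ((1 + r) / (1 - r)), y1; apply: cay_inj.
rewrite cay_kappa; have -> : - (2 * - (t / 2)) = t by field.
have rc : r%:C != 0 by rewrite (fmorph_eq0 (real_complex R)) gt_eqF.
rewrite -Et -[LHS](divfK rc); congr (_ * _).
have h5 : 'i%C != 0 :> R[i] by apply: contra (twoi_neq0 R) => /eqP->; rewrite mulr0.
have E (F : fieldType) (a x : F) : a != 0 -> (a * x - a) / (a * x + a) = (x - 1) / (x + 1).
  by move=> a0; rewrite -{2}[a]mulr1 -{4}[a]mulr1 -mulrBr -mulrDr -mulf_div divff // mul1r.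
rewrite /cay [in RHS]/= (E _ _ _ h5).
have -> : ((1 + r) / (1 - r))%:C - 1 = ((1 + r) / (1 - r) - 1)%:C :> R[i] by rewrite rmorphB.
have -> : ((1 + r) / (1 - r))%:C + 1 = ((1 + r) / (1 - r) + 1)%:C :> R[i] by rewrite rmorphD.
rewrite -fmorph_div; congr (_ %:C).
field; apply/andP; split=> //; apply: lt0r_neq0; lra.
Qed.

(* By the differential equation of [weight_ode], [U / cay^j] is constant      *)
(* along any path, [p] being its velocity.                                    *)
Lemma weight_identity (F : fieldType) (D w a n u p X : F) :
  w + a != 0 -> w - a != 0 -> D * ((w + a) * (w - a)) = 2 * n * a * u ->
  u * (n * X / ((w + a) / (w - a)) *
    ((w + a) * (- (p + 0) / (w - a) ^+ 2) + (p + 0) / (w - a))) + D * p * X = 0.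
Proof.
move=> n1 n2 o; have -> : D = 2 * n * a * u / ((w + a) * (w - a)).
  by rewrite -o mulfK // mulf_neq0.
by field; apply/andP; split.
Qed.

Section Classification.
Variables (U : uhp -> R[i]) (j : nat).
Hypothesis hU : holomorphic U.
Hypothesis wU : forall t z, U (mp_act (kappa t) z) = expi (- (2 * j%:R * t)) * U z.

Let DU z : R[i] := 'D_1 (ext0 U : C -> C) (z : R[i]).

Let isDU z : is_derive ((z : R[i]) : C) 1 (ext0 U : C -> C) (DU z : C).
Proof. by apply: DeriveDef; [exact: hU|]. Qed.

(* The derivative along a [K]-orbit determines the complex derivative.        *)
Lemma weight_ode z : DU z * (1 + (z : R[i]) ^+ 2) = 2 * j%:R * 'i%C * U z.
Proof.
have K0 : mp_act (kappa 0) z = z by rewrite kappa0; exact: moebius1.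
have d0 : is_derive ((mp_act (kappa 0) z : R[i]) : C) 1 (ext0 U : C -> C) (DU z : C).
  by rewrite K0; exact: isDU.
have := cderiv_comp d0 (cderiv_rotation z).
have -> : ext0 U \o (fun t => mp_act (kappa t) z : R[i]) = (fun t => U z * expi (- (2 * j%:R) * t)).
  apply/funext => t; transitivity (U (mp_act (kappa t) z)); first exact: ext0E.
  by rewrite wU mulNr mulrC.
move/cderiv_cvg_Cderive; rewrite (cderiv_cvg_Cderive (cderivZ (U z) (cderiv_expi _))).
move=> /(congr1 -%R); rewrite mulrN opprK => <-.
have -> : 0 +i* - (2 * j%:R) = - (2 * j%:R * 'i%C) :> R[i].
  have -> : 2 * j%:R = (2 * j%:R)%:C :> R[i] by rewrite rmorphM !rmorph_nat.
  by simpc.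
by rewrite mulrN opprK mulrC.
Qed.

(** By [weight_ode] the derivative of [U / cay^j] vanishes along the segment joining the two points,
    and [cderiv_bound] with bound 0 concludes. The condition [y > 1] keeps [cay] away from its zero
    [i]. *)
Lemma weight_iline y0 y1 (h0 : 1 < y0) (h1 : 1 < y1) :
  U (UHP (iline_im (lt_trans ltr01 h0))) / cay ('i%C * y0%:C) ^+ j =
  U (UHP (iline_im (lt_trans ltr01 h1))) / cay ('i%C * y1%:C) ^+ j.
Proof.
pose ell (x : R) : R := y0 + x * (y1 - y0).
have ell1 x : 0 <= x <= 1 -> 1 < ell x.
  move=> /andP[x0 x1]; rewrite /ell; have [le|/ltW le] := leP y0 y1.
    have : 0 <= x * (y1 - y0) by rewrite mulr_ge0 // subr_ge0.
    lra.
  have : 0 <= (1 - x) * (y0 - y1) by rewrite mulr_ge0 ?subr_ge0.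
  nra.
pose p : R[i] := 'i%C * (y1 - y0)%:C.
pose f x : R[i] := 'i%C * (ell x)%:C.
have df x : cderiv f x p.
  have : is_derive x 1 ell (y1 - y0).
    have h1' := @is_deriveZ R R R id (y1 - y0) x 1 1 (is_derive_id x 1).
    have := is_deriveD (is_derive_cst y0 x 1) h1'.
    congr (is_derive _ _ _ _); last by rewrite add0r /GRing.scale /= mulr1.
    by apply/funext => u; rewrite /= /ell mulrC.
  by move=> /cderiv_real/(cderivZ 'i%C).
pose e x : R[i] := (f x + 'i%C) / (f x - 'i%C).
have key x : 0 <= x <= 1 -> cderiv (fun x => ext0 U (f x) * e x ^+ j) x 0.
  move=> /ell1 x1; pose z := UHP (iline_im (lt_trans ltr01 x1)).
  have fz : f x = z by [].
  have n1 := uhpDi_neq0 z.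
  have n2 : f x - 'i%C != 0.
    by rewrite subr_eq0; apply/eqP => /(congr1 (@complex.Im R)) /=; lra.
  have d1 := cderiv_comp (isDU z) (df x).
  have d2 := cderivM (cderivD (df x) (cderiv_cst 'i%C x)) (cderivV (cderivD (df x) (cderiv_cst (- 'i%C) x)) n2).
  have := cderivM d1 (cderivX j d2); congr cderiv.
  have e0 : ext0 U (f x) = U z by exact: (ext0E U z).
  have o := weight_ode z.
  have ex0 : e x != 0 by rewrite mulf_neq0 ?invr_neq0.
  have E (n : nat) (y : R[i]) : y != 0 -> n%:R * y ^+ n.-1 = n%:R * y ^+ n / y.
    by case: n => [|n] yn0; rewrite ?mul0r //= exprSr mulrA mulfK.
  rewrite [(_ \o _) x]e0 -/(e x) (E _ _ ex0) /e.
  rewrite -[uhp_val z]/(f x) in o n1; move: (e x ^+ j) o => X.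
  have i2 : 'i%C ^+ 2 = -1 :> R[i] by rewrite sqr_i.
  move: (f x) (DU z) (U z) ('i%C) i2 n1 n2 => w D u ii i2 n1 n2.
  have -> : 1 + w ^+ 2 = (w + ii) * (w - ii) by rewrite -(opprK 1) -i2; ring.
  exact: weight_identity.
have := @cderiv_bound R (fun x => ext0 U (f x) * e x ^+ j) (fun=> 0) 0 key.
rewrite mulr0 normr0 lexx => /(_ (fun _ _ => isT)).
rewrite normr_le0 subr_eq0 => /eqP.
have f0 : f 0 = 'i%C * y0%:C by rewrite /f /ell mul0r addr0.
have f1 : f 1 = 'i%C * y1%:C by rewrite /f /ell mul1r addrC subrK.
rewrite /e f0 f1.
rewrite -[ext0 U ('i%C * y0%:C)]/(ext0 U (uhp_val (UHP (iline_im (lt_trans ltr01 h0))))).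
rewrite -[ext0 U ('i%C * y1%:C)]/(ext0 U (uhp_val (UHP (iline_im (lt_trans ltr01 h1))))).
rewrite !ext0E => E; rewrite /cay -!exprVn !invf_div; exact: esym E.
Qed.

(** The constant is read off on the ray [i y] with [y > 1]; rotations carry it to every point but
    [i]. *)
Lemma weight_vector : exists c, forall z, U z = c * cay z ^+ j.
Proof.
pose c := U (UHP (iline_im (lt_trans ltr01 (ltr1n R 2)))) / cay ('i%C * 2%:C) ^+ j.
have cn y (y1 : 1 < y) : cay ('i%C * y%:C) != 0.
  rewrite -(cayi R); apply/eqP => /(@cay_inj (UHP (iline_im (lt_trans ltr01 y1))) I).
  by move=> /(congr1 (fun z : uhp => complex.Im z)) /=; lra.
have line y (y1 : 1 < y) : U (UHP (iline_im (lt_trans ltr01 y1))) = c * cay ('i%C * y%:C) ^+ j.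
  by rewrite /c (weight_iline _ y1) divfK // expf_neq0 // cn.
pose D z := U z - c * cay z ^+ j.
have Dline y (y1 : 1 < y) : D (UHP (iline_im (lt_trans ltr01 y1))) = 0.
  by rewrite /D line subrr.
exists c => z; have [->|zi] := pselect (z = I); last first.
  have [t [y [y1 ->]]] := cartan zi.
  rewrite wU cay_kappa line [in RHS]exprMn mulrCA -expiM.
  by congr (_ * (expi _ * _)); ring.
(* The point [i] is fixed by [K] and is reached by continuity, as the limit of the ray for [y]
   tending to 1 from above. *)
apply/eqP; rewrite -subr_eq0 -/(D I); apply/eqP; apply: contrapT => /eqP DI.
have cD : ccont D.
  have hc := @holomorphicM R _ _ (@holomorphic_cst R c) (@holomorphicX R _ j (@holomorphic_cay R)).
  exact: (ccontD (ccont_holo hU) (ccontN (ccont_holo hc))).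
have cphi : {for (1 : R), continuous (fun y : R => ext0 D ('i%C * y%:C) : C)}.
  have h : {for (1 : R), continuous (fun y : R => 'i%C * y%:C : C)}.
    exact: (forC_M (forC_cst 'i%C (1 : R)) (@continuous_real_complex R 1)).
  apply: (@cvg_comp _ _ _ (fun y : R => 'i%C * y%:C : C) (ext0 D) (nbhs (1 : R)) _ _ h).
  have := cD I; rewrite /prop_for /continuous_at.
  by have -> : 'i%C * (1 : R)%:C = (I : R[i]) by rewrite mulr1.
have D1 : ext0 D ('i%C * (1 : R)%:C) != 0.
  have -> : 'i%C * (1 : R)%:C = (I : R[i]) by rewrite mulr1.
  by rewrite ext0E.
have n1 := @cvgC_neq0 R _ (nbhs (1 : R)) _ _ _ cphi D1.
have nr : \forall y \near (1 : R)^'+, ext0 D ('i%C * y%:C) != 0.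
  by apply: (@cvg_within _ (nbhs (1 : R))); exact: n1.
have pr : \forall y \near (1 : R)^'+, 1 < y by exact: nbhs_right_gt.
have [y [/eqP hy y1]] := filter_ex (filterI nr pr).
apply: hy.
exact: (etrans (ext0E D (UHP (iline_im (lt_trans ltr01 y1)))) (Dline _ y1)).
Qed.

End Classification.

End WeightVectors.

(** * Projection of K-finite vectors *)

Section DyadicAveraging.
Variables (K : numFieldType) (R : realType) (X : Type) (T : R -> (X -> K) -> X -> K) (P : R).
Implicit Types (u v : X -> K) (t : R).
Hypothesis T_lin : forall t (a b : K) u v,
  T t (fun x => a * u x + b * v x) = (fun x => a * T t u x + b * T t v x).
Hypothesis TD : forall s t u, T (s + t) u = T s (T t u).
Hypothesis TP : forall u, T P u = u.
Variables (n : nat) (e : 'I_n -> X -> K) (v : X -> K).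
Hypothesis v_span : forall t, exists a : 'I_n -> K, forall x, T t v x = \sum_i a i * e i x.

Let h (p : nat) : R := P / 2 ^+ p.

Let h_half p : h p = h p.+1 + h p.+1.
Proof. by rewrite /h exprS; field; rewrite expf_neq0. Qed.

(* [E p] is the average of [v] over the cyclic group generated by [T (h p)].  *)
Let E := fix E (p : nat) : X -> K :=
  if p is q.+1 then (fun x => 2^-1 * E q x + 2^-1 * T (h q.+1) (E q) x) else v.

Let E_fix p : T (h p) (E p) = E p.
Proof.
elim: p => [|p IH]; first by rewrite /h expr0 divr1 TP.
by rewrite /= T_lin -TD -h_half IH; apply/funext => x; rewrite addrC.
Qed.

Let fix_le u p q : (q <= p)%N -> T (h p) u = u -> T (h q) u = u.
Proof.
move=> qp; rewrite -(subnK qp); elim: (p - q)%N => [//|m IH].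
rewrite addSn => hm; apply: IH.
by rewrite h_half TD hm.
Qed.

Let E_span p t : exists a : 'I_n -> K, forall x, T t (E p) x = \sum_i a i * e i x.
Proof.
elim: p t => [|p IH] t; first exact: v_span.
have [a ha] := IH t; have [b hb] := IH (t + h p.+1).
exists (fun i => 2^-1 * a i + 2^-1 * b i) => x.
rewrite /= T_lin -TD ha hb !mulr_sumr -big_split /=.
by apply: eq_bigr => i _; rewrite mulrDl !mulrA.
Qed.

Let T0 u : T 0 u = u.
Proof. by rewrite -[X in T 0 X]TP -TD add0r TP. Qed.

Let delta p x : K := E p x - E p.+1 x.

Let delta_lin p : delta p = (fun x => 1 * E p x + (-1) * E p.+1 x).
Proof. by apply/funext => x; rewrite mul1r mulN1r. Qed.

Let delta_anti p x : T (h p.+1) (delta p) x = - delta p x.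
Proof.
rewrite delta_lin T_lin E_fix /=.
by rewrite mul1r; field.
Qed.

Let delta_fix p q : (p < q)%N -> T (h p.+1) (delta q) = delta q.
Proof.
move=> pq; rewrite delta_lin T_lin !(@fix_le _ _ p.+1 _ (E_fix _)) //.
exact: leqW.
Qed.

Let delta_span p : exists a : 'I_n -> K, forall x, delta p x = \sum_i a i * e i x.
Proof.
have [a ha] := E_span p 0; have [b hb] := E_span p.+1 0.
exists (fun i => a i - b i) => x; rewrite /delta -(T0 (E p)) ha -(T0 (E p.+1)) hb -sumrB.
by apply: eq_bigr => i _; rewrite mulrBl.
Qed.

Let T_sum m (c : 'I_m -> K) (f : 'I_m -> X -> K) t :
  T t (fun x => \sum_i c i * f i x) = (fun x => \sum_i c i * T t (f i) x).
Proof.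
elim: m c f => [|m IH] c f.
  have := T_lin t 0 0 v v.
  have -> : (fun x => 0 * v x + 0 * v x) = (fun x => \sum_(i < 0) c i * f i x).
    by apply/funext => x; rewrite !mul0r addr0 big_ord0.
  by move->; apply/funext => x; rewrite !mul0r addr0 big_ord0.
have e1 (F : 'I_m.+1 -> X -> K) : (fun x => \sum_(i < m.+1) c i * F i x) =
    (fun x => 1 * \sum_(i < m) c (widen_ord (leqnSn m) i) * F (widen_ord (leqnSn m) i) x + c ord_max * F ord_max x).
  by apply/funext => x; rewrite big_ord_recr mul1r.
by rewrite (e1 f) T_lin IH -(e1 (fun i => T t (f i))).
Qed.

(* The nonzero differences [delta p] are linearly independent, since          *)
(* [T (h p.+1)] negates [delta p] and fixes the later ones; but they all lie  *)
(* in the span of [n] functions.                                              *)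
Let stabilizes : exists p0, forall p, (p0 <= p)%N -> E p.+1 = E p.
Proof.
apply: contrapT => /forallNP H.
have {}H p0 : exists p, (p0 <= p)%N /\ exists x, delta p x != 0.
  have /existsNP[p /not_implyP[pp hp]] := H p0; exists p; split => //.
  apply: contrapT => /forallNP hx; apply: hp; apply/funext => x.
  by have /negP := hx x; rewrite negbK subr_eq0 => /eqP ->.
have [f hf] := choice H.
pose g := fix g (i : nat) : nat := if i is k.+1 then f (g k).+1 else f 0%N.
have gx i : exists x, delta (g i) x != 0.
  by case: i => [|i]; [have [] := hf 0%N|have [] := hf (g i).+1].
have gS i : (g i < g i.+1)%N by have [] := hf (g i).+1.
have gm i k : (i < k)%N -> (g i < g k)%N.
  elim: k => // k IH; rewrite ltnS leq_eqVlt => /orP[/eqP->//|/IH ik].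
  exact: ltn_trans ik (gS k).
have [A hA] := choice (fun i : 'I_n.+1 => delta_span (g i)).
pose M : 'M[K]_(n.+1, n) := \matrix_(i, k) A i k.
have : kermx M != 0.
  rewrite kermx_eq0 /row_free; apply: contraNneq (negbT (ltnn n)) => rM.
  by rewrite -{1}rM; exact: rank_leq_col.
case/rowV0Pn => r /sub_kermxP rM r0.
(* In a relation whose first nonzero coefficient is at [i0], applying [T (h (g i0).+1)] and
   subtracting leaves twice the term of index [i0]. *)
have [i0 ri0 imin] : exists2 i0 : 'I_n.+1, r 0 i0 != 0 & forall i : 'I_n.+1, (i < i0)%N -> r 0 i = 0.
  have [i1 hi1] : exists i, r 0 i != 0.
    apply: contrapT => /forallNP hr; move/eqP: r0; apply; apply/rowP => i; rewrite mxE.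
    by have /negP := hr i; rewrite negbK => /eqP.
  case: (@arg_minnP _ i1 (fun i => r 0 i != 0) (fun i : 'I_n.+1 => val i) hi1) => i ri imin; exists i => // k ki.
  apply/eqP; apply: contraTT ki => rk; rewrite -leqNgt; exact: imin.
have sum0 : (fun x => \sum_i r 0 i * delta (g i) x) = (fun x => 0 * v x + 0 * v x).
  apply/funext => x; rewrite !mul0r addr0.
  transitivity (\sum_(k < n) (r *m M) 0 k * e k x); last first.
    by rewrite rM big1 // => k _; rewrite mxE mul0r.
  under eq_bigr do rewrite hA mulr_sumr.
  rewrite exchange_big /=; apply: eq_bigr => k _; rewrite mxE mulr_suml.
  by apply: eq_bigr => i _; rewrite mxE mulrA.
have sumT := congr1 (T (h (g i0).+1)) sum0; rewrite T_sum T_lin in sumT.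
have [x hx] := gx i0.
have s1 : \sum_i r 0 i * delta (g i) x = 0 by have := congr1 (@^~ x) sum0; rewrite /= !mul0r addr0.
have s2 : \sum_i r 0 i * T (h (g i0).+1) (delta (g i)) x = 0.
  by have := congr1 (@^~ x) sumT; rewrite /= !mul0r addr0.
have : \sum_i r 0 i * (delta (g i) x - T (h (g i0).+1) (delta (g i)) x) = 0.
  by under eq_bigr do rewrite mulrBr; rewrite sumrB s1 s2 subrr.
rewrite (bigD1 i0) //= big1 ?addr0 => [|i ii0].
  rewrite delta_anti opprK => /eqP; rewrite mulf_eq0 (negbTE ri0) /= -mulr2n mulrn_eq0 /=.
  by rewrite (negbTE hx).
have [ltii|ltii|eqii] := ltngtP i i0.
- by rewrite imin ?mul0r.
- by rewrite delta_fix ?subrr ?mulr0 //; exact: gm.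
- by case/eqP: ii0; exact/val_inj.
Qed.

(** The stable average is fixed by every dyadic step. [Q] carries along what the averaging must
    retain, such as holomorphy or the matrix coefficient being represented. *)
Lemma dyadic_projection (Q : (X -> K) -> Prop) : Q v -> (forall t u, Q u -> Q (T t u)) ->
  (forall u w, Q u -> Q w -> Q (fun x => 2^-1 * u x + 2^-1 * w x)) ->
  exists2 w, Q w & forall p m : nat, T (P / 2 ^+ p * m%:R) w = w.
Proof.
move=> Qv QT QD; have QE p : Q (E p) by elim: p => //= p IH; apply: QD => //; exact: QT.
have [p0 hp0] := stabilizes.
have Ep p : (p0 <= p)%N -> E p = E p0.
  move=> /subnK <-; elim: (p - p0)%N => // m IH.
  by rewrite addSn hp0 ?leq_addl.
exists (E p0) => // p m.
have hp : T (h p) (E p0) = E p0.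
  have [pp|pp] := leqP p0 p; first by rewrite -(Ep p pp) E_fix.
  exact: (fix_le (ltnW pp) (E_fix _)).
rewrite -/(h p); elim: m => [|m IH]; first by rewrite mulr0 T0.
by rewrite -addn1 natrD mulrDr mulr1 TD hp.
Qed.

End DyadicAveraging.

(** * From K-finite vectors to multiples of f_j *)

Section WeightProjection.
Variable R : realType.
Local Notation C := (R[i]^o).
Local Notation uhp := (uhp R).
Implicit Types (z : uhp) (s : Mp R) (t : R) (E u v : uhp -> R[i]).

(** The period in the double cover is twice that of the rotations, since [eta] of [kappa t] at [i]
    is [expi (t / 2)]. Half-integral characters are therefore trivial on it. *)
Lemma kappa_4pi : kappa (4 * pi : R) = 1%g.
Proof.
have e2 : expi (4 * pi / 2 : R) = 1.
  by rewrite -(@expi_2pi R 1); congr expi; field.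
have e4 : expi (4 * pi : R) = 1.
  by rewrite -(@expi_2pi R 2); congr expi; ring.
apply: mp_eq; last by rewrite kappa_etai e2.
apply: sl2_inj; apply/matrixP => a b; rewrite !mxE /=.
move: e4; rewrite /expi => -[-> ->]; rewrite oppr0.
by case: a => -[|[|//]] ? /=; case: b => -[|[|//]] ?.
Qed.

Lemma expi_continuous (a : R) t : {for t, continuous (fun t => expi (a * t) : C)}.
Proof.
have m : {for t, continuous (fun t : R => a * t)} by exact: mulrl_continuous.
apply: (@cvg_complex R _ (nbhs t)).
  exact: (@cvg_comp _ _ _ (fun t : R => a * t) _ (nbhs t) _ _ m (@continuous_cos R _)).
exact: (@cvg_comp _ _ _ (fun t : R => a * t) _ (nbhs t) _ _ m (@continuous_sin R _)).
Qed.

Lemma kappa_act_continuous t z : {for t, continuous (fun t => (mp_act (kappa t) z : R[i]) : C)}.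
Proof.
have cc : {for t, continuous (fun t => (cos t)%:C : C)}.
  exact: (@cvg_comp _ _ _ (@cos R) _ (nbhs t) _ _ (@continuous_cos R t) (@continuous_real_complex R _)).
have cs : {for t, continuous (fun t => (sin t)%:C : C)}.
  exact: (@cvg_comp _ _ _ (@sin R) _ (nbhs t) _ _ (@continuous_sin R t) (@continuous_real_complex R _)).
have E : (fun t => mp_act (kappa t) z : R[i]) =
  (fun t => ((cos t)%:C * (z : R[i]) + - (sin t)%:C) * (((sin t)%:C * (z : R[i]) + (cos t)%:C))^-1).
  by apply/funext => x; rewrite /mp_act /= /anum /jfac !mxE /= ?rmorphN.
have j0 : (sin t)%:C * (z : R[i]) + (cos t)%:C != 0.
  by have := jfac_neq0 (Defs.rot t) z; rewrite /jfac !mxE.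
have cz := forC_cst (uhp_val z) t.
rewrite E; exact: (forC_M (forC_D (forC_M cc cz) (forC_N cs)) (forC_V j0 (forC_D (forC_M cs cz) cc))).
Qed.

(** The dyadic multiples of [P] are dense in the nonnegative reals: the one just below [t] is within
    [P / 2^p] of it. *)
Lemma dyadic_constant (phi : R -> R[i]) (P : R) (a : R[i]) : 0 < P ->
  (forall t, {for t, continuous (phi : R -> C)}) ->
  (forall p m : nat, phi (P / 2 ^+ p * m%:R) = a) -> forall t, 0 <= t -> phi t = a.
Proof.
move=> P0 cphi hphi t t0; apply: contrapT => /eqP; rewrite -subr_eq0 => nz.
have c1 := forC_D (cphi t) (forC_cst (- a) t).
have [e /= e0 he] := (nbhs_ballP _ _).1 (@cvgC_neq0 R _ (nbhs t) _ _ _ c1 nz).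
have [p hp] : exists p : nat, P / 2 ^+ p < e.
  exists (Num.truncn (P / e)).+1.
  rewrite ltr_pdivrMr ?exprn_gt0 // mulrC -ltr_pdivrMr //.
  apply: lt_trans (truncnS_gt _) _.
  by rewrite -natrX ltr_nat ltn_expl.
have h0 : 0 < P / 2 ^+ p by rewrite divr_gt0 // exprn_gt0.
have /andP[m1 m2] := truncn_itv (divr_ge0 t0 (ltW h0)).
have : ball t e (P / 2 ^+ p * (Num.truncn (t / (P / 2 ^+ p)))%:R).
  move: (P / 2 ^+ p) hp h0 m1 m2 => q hp h0; move: (Num.truncn (t / q)) => m.
  rewrite ler_pdivlMr // ltr_pdivrMr // => m1 m2.
  have E : m.+1%:R * q = m%:R * q + q by rewrite -natr1 mulrDl mul1r.
  rewrite E in m2; rewrite /ball /= mulrC ger0_norm ?subr_ge0 //; lra.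
by move=> /he; rewrite /= hphi subrr eqxx.
Qed.

Variables (d j : nat).

(* Weight vectors are the common fixed points of the operators [twist t].     *)
Definition twist t u z : R[i] := expi ((d + 4 * j)%:R / 2 * t) * op d (kappa t) u z.

Lemma twist_lin t (a b : R[i]) u v :
  twist t (fun z => a * u z + b * v z) = (fun z => a * twist t u z + b * twist t v z).
Proof. by apply/funext => z; rewrite /twist /op; ring. Qed.

Lemma twistD r t u : twist (r + t) u = twist r (twist t u).
Proof.
have opZ s (a : R[i]) F z : op d s (fun z => a * F z) z = a * op d s F z by rewrite /op mulrA.
apply/funext => z; rewrite /twist (opZ _ _ (op d (kappa t) u)) addrC kappaD op_mul.
rewrite [_ * (t + r)]mulrDr expiD [RHS]mulrA; congr (_ * _); exact: mulrC.
Qed.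

Lemma twist_4pi u : twist (4 * pi) u = u.
Proof.
apply/funext => z; rewrite /twist kappa_4pi op1.
have -> : (d + 4 * j)%:R / 2 * (4 * pi) = pi *+ 2 * (d + 4 * j)%:R :> R by rewrite mulr2n; field.
by rewrite expi_2pi mul1r.
Qed.

(** Writing [u] as [u theta^d] times [f_0] lets the known weight of [f_0] absorb the automorphy
    factor; what remains is the plain rotation of a function on the half-plane. *)
Lemma twistE t u z : twist t u z =
  expi (2 * j%:R * t) * (u (mp_act (kappa t) z) * theta (mp_act (kappa t) z) ^+ d) * fk 0 d z.
Proof.
have h := fkm_kappa 0 d t z; rewrite fkmE expr0 mul1r in h.
have th : theta (mp_act (kappa t) z) ^+ d != 0 by rewrite expf_neq0 // theta_neq0.
rewrite /twist /op.
have -> : u (mp_act (kappa t) z) * mp_eta (kappa t) z ^- d =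
  u (mp_act (kappa t) z) * theta (mp_act (kappa t) z) ^+ d *
  (theta (mp_act (kappa t) z) ^- d * mp_eta (kappa t) z ^- d) by rewrite mulrA mulfK.
rewrite h mulrCA -/(fk 0 d z) [X in _ * X]mulrA -expiD [X in _ = X * _]mulrC -mulrA.
rewrite -[RHS]mulrA; congr (_ * (expi _ * _)).
have E (D i : nat) : (D + 4 * i)%:R = D%:R + 4 * i%:R :> R by rewrite natrD natrM.
by rewrite !E; field.
Qed.

(** The quotient [U] of [E] by [f_0] satisfies the weight relation at dyadic times, hence by
    continuity at all [t >= 0], and at negative times by inverting the rotation. Then
    [weight_vector] applies. *)
Lemma twist_fixed E : holomorphic E ->
  (forall p m : nat, twist (4 * pi / 2 ^+ p * m%:R) E = E) ->
  exists c, E = (fun z => c * fk j d z).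
Proof.
move=> hE hfix.
pose U z := E z * theta z ^+ d.
have hU : holomorphic U.
  exact: (@holomorphicM R E _ hE (@holomorphicX R _ d (@holomorphic_theta R))).
have cU : ccont U := @ccont_holo R U hU.
have f0 z : fk 0 d z != 0.
  by rewrite /fk fkmE expr0 mul1r invr_neq0 // expf_neq0 // theta_neq0.
have EU z : E z = U z * fk 0 d z.
  by rewrite /U /fk fkmE expr0 mul1r mulfK // expf_neq0 // theta_neq0.
have wpos t z : 0 <= t -> expi (2 * j%:R * t) * U (mp_act (kappa t) z) = U z.
  move: t; apply: (@dyadic_constant (fun t => expi (2 * j%:R * t) * U (mp_act (kappa t) z)) (4 * pi)).
  - by rewrite mulr_gt0 // pi_gt0.
  - move=> t; apply: (@forC_M R R (fun t => expi (2 * j%:R * t)) (fun t => U (mp_act (kappa t) z)) t).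
      exact: expi_continuous.
    have EE : (fun t => U (mp_act (kappa t) z)) = (fun t => ext0 U (mp_act (kappa t) z : R[i])).
      by apply/funext => x; rewrite ext0E.
    rewrite EE.
    exact: (@cvg_comp _ _ _ (fun t => mp_act (kappa t) z : R[i]) (ext0 U) (nbhs t) (nbhs ((mp_act (kappa t) z : R[i]) : C)) _
      (@kappa_act_continuous t z) (cU (mp_act (kappa t) z))).
  - by move=> p m; apply: (mulIf (f0 z)); rewrite -EU -[in RHS](hfix p m) twistE.
have wU t z : U (mp_act (kappa t) z) = expi (- (2 * j%:R * t)) * U z.
  have [t0|/ltW t0] := leP 0 t.
    by rewrite -[in RHS](wpos t z t0) mulrA -expiD addNr expi0 mul1r.
  have t1 : 0 <= - t by rewrite oppr_ge0.
  rewrite -(wpos (- t) (mp_act (kappa t) z) t1) mulrN; congr (_ * U _).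
  rewrite /mp_act -moebius_mul.
  have -> : sl2_mul (mp_g (kappa (- t))) (mp_g (kappa t)) = mp_g (kappa (- t) * kappa t)%g by [].
  by rewrite kappaN mulVg moebius1.
have [c hc] := weight_vector hU wU.
by exists c; apply/funext => z; rewrite EU hc /fk !fkmE expr0 mul1r mulrA.
Qed.

Lemma weight_projection n (e : 'I_n -> uhp -> R[i]) v (Q : (uhp -> R[i]) -> Prop) :
  holomorphic v ->
  (forall t, exists a : 'I_n -> R[i], forall z, op d (kappa t) v z = \sum_i a i * e i z) ->
  Q v -> (forall t u, Q u -> Q (twist t u)) ->
  (forall u w, Q u -> Q w -> Q (fun z => 2^-1 * u z + 2^-1 * w z)) ->
  exists c, Q (fun z => c * fk j d z).
Proof.
move=> hv sv Qv QT QD.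
have hT t u : holomorphic u -> holomorphic (twist t u).
  move=> hu; exact: (@holomorphicM R _ _ (@holomorphic_cst R _) (@holo_op R d (kappa t) u hu)).
have hD u w : holomorphic u -> holomorphic w -> holomorphic (fun z => 2^-1 * u z + 2^-1 * w z).
  move=> hu hw; exact: (@holomorphicD R _ _ (@holomorphicM R _ _ (@holomorphic_cst R 2^-1) hu)
    (@holomorphicM R _ _ (@holomorphic_cst R 2^-1) hw)).
have [w [Qw hw] fixw] : exists2 w, Q w /\ holomorphic w &
    forall p m : nat, twist (4 * pi / 2 ^+ p * m%:R) w = w.
  apply: (@dyadic_projection _ R uhp twist (4 * pi) twist_lin twistD twist_4pi n e v _ (fun u => Q u /\ holomorphic u)).
  - move=> t; have [a ha] := sv t.
    exists (fun i => expi ((d + 4 * j)%:R / 2 * t) * a i) => z.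
    by rewrite /twist ha mulr_sumr; apply: eq_bigr => i _; rewrite mulrA.
  - by split.
  - by move=> t u [Qu hu]; split; [exact: QT|exact: hT].
  - by move=> u u' [Qu hu] [Qu' hu']; split; [exact: QD|exact: hD].
by have [c hc] := twist_fixed hw fixw; exists c; rewrite -hc.
Qed.

End WeightProjection.

(** * Matrix coefficients *)

Section MatrixCoefficients.
Variables (R : realType) (l : nat).
Local Notation uhp := (uhp R).
Local Notation d := (2 * l + 3)%N.
Local Notation fk := (@fk R).
Implicit Types (z : uhp) (s : Mp R) (t : R) (u v w : uhp -> R[i]) (H : Mp R -> R[i]) (j k : nat).

Lemma chi_opp (n : nat) t : chi (- n%:Z) t = expi (n%:R / 2 * t) :> R[i].
Proof. by rewrite /chi rmorphN /= !mulNr opprK. Qed.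

Lemma pi_op s u : rep_op (pi_rep R d) s u = op d s^-1%g u.
Proof. by []. Qed.

Lemma pi_space u : rep_space (pi_rep R d) u -> holomorphic u /\ L2 d u.
Proof. by move=> [hu su]; exact: (conj hu (conj (@ccont_holo R u hu) su)). Qed.

Lemma K_finite_orbit v : K_finite (pi_rep R d) v ->
  exists n (e : 'I_n -> uhp -> R[i]), forall t, exists a : 'I_n -> R[i],
    forall z, op d (kappa t) v z = \sum_i a i * e i z.
Proof.
move=> [_ [n [e [_ h]]]]; exists n, e => t; have [a ha] := h (- t); exists a => z.
by rewrite -ha pi_op kappaN invgK.
Qed.

Lemma K_finite_fk c k : K_finite (pi_rep R d) (fun z => c * fk k d z).
Proof.
have hk : holomorphic (fk k d) := @holo_fk R k d.
have sp c' : rep_space (pi_rep R d) (fun z => c' * fk k d z).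
  split; first exact: (@holomorphicM R _ _ (@holomorphic_cst R c') hk).
  by have [] := @L2_Z R d c' _ (@L2_fk R k l).
split; first exact: sp.
exists 1%N, (fun=> fk k d); split.
  move=> i; have := sp 1; congr rep_space.
  by apply/funext => z; rewrite mul1r.
move=> t; exists (fun=> c * expi ((d + 4 * k)%:R / 2 * t)) => z.
rewrite big_ord1; transitivity (c * op d (kappa (- t)) (fk k d) z).
  by rewrite /op kappaN mulrA.
by rewrite op_kappa_fk mulrN opprK mulrA.
Qed.

Let coef v w s := dot d (op d s^-1%g v) w.

Lemma coef_right v w s t : coef v w (s * kappa t)%g = coef (op d (kappa (- t)) v) w s.
Proof. by rewrite /coef invgM op_mul kappaN. Qed.

Lemma coef_left v w s t : ccont v -> ccont w ->
  coef v w (kappa t * s)%g = coef v (op d (kappa t) w) s.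
Proof.
move=> cv cw; rewrite /coef invgM op_mul.
rewrite -(@dot_op R d (kappa t) _ w (@ccont_op R d (kappa t)^-1%g _ (@ccont_op R d s^-1%g _ cv)) cw).
by rewrite -op_mul mulVg op1.
Qed.

Lemma dotDr u v w : L2 d u -> L2 d v -> L2 d w ->
  dot d u (fun z => v z + w z) = dot d u v + dot d u w.
Proof.
move=> Lu Lv Lw; rewrite dot_sym (dotDl Lv Lw Lu) [dot d u v]dot_sym [dot d u w]dot_sym.
exact: (rmorphD (@conjc R)).
Qed.

(** The property averaged over is that [u] represents [H] as [coef u w]. The equivariance of [H] on
    the right makes every [twist] preserve it, so the projected vector, a multiple of [f_j], still
    represents [H]. *)
Lemma project_right H v w j : K_finite (pi_rep R d) v -> L2 d w ->
  (forall s, H s = coef v w s) -> transforms_right (- (d + 4 * j)%:Z) H ->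
  exists c, forall s, H s = coef (fun z => c * fk j d z) w s.
Proof.
move=> Kv Lw Hv tH; have [n [e orb]] := K_finite_orbit Kv.
have [hv Lv] := pi_space Kv.1.
have [||c [_ hc]] := @weight_projection R d j n e v
  (fun u => L2 d u /\ forall s, H s = coef u w s) hv orb (conj Lv Hv).
- move=> t u [Lu hu]; have Lo : L2 d (op d (kappa t) u) := L2_op (kappa t) Lu.
  split; first exact: L2_Z.
  move=> s; have -> : coef (twist d j t u) w s = expi ((d + 4 * j)%:R / 2 * t) * coef (op d (kappa t) u) w s.
    have := @dotZl R d (expi ((d + 4 * j)%:R / 2 * t)) _ _ (L2_op s^-1%g Lo) Lw.
    move=> E; refine (etrans _ E).
    refine (congr1 (fun F => dot d F w) _).
    by apply/funext => z; rewrite /op /twist mulrA.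
  have := coef_right u w s (- t); rewrite opprK => <-.
  by rewrite -hu tH chi_opp mulrA mulrN -expiD subrr expi0 mul1r.
- move=> u u' [Lu hu] [Lu' hu']; split; first by apply: L2_D; exact: L2_Z.
  move=> s; rewrite /coef.
  have -> : op d s^-1%g (fun z => 2^-1 * u z + 2^-1 * u' z) =
    (fun z => 2^-1 * op d s^-1%g u z + 2^-1 * op d s^-1%g u' z).
    by apply/funext => z; rewrite /op mulrDl !mulrA.
  have Lo := L2_op s^-1%g Lu; have Lo' := L2_op s^-1%g Lu'.
  apply: esym; refine (etrans (dotDl (L2_Z 2^-1 Lo) (L2_Z 2^-1 Lo') Lw) _).
  refine (etrans (congr2 +%R (dotZl 2^-1 Lo Lw) (dotZl 2^-1 Lo' Lw)) _).
  have e1 := hu s; have e2 := hu' s; rewrite /coef in e1 e2; rewrite -e1 -e2.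
  by field.
by exists c.
Qed.

(** The same projection in the second vector, where conjugate-linearity inverts the character
    introduced by [twist]. *)
Lemma project_left H v w k : L2 d v -> K_finite (pi_rep R d) w ->
  (forall s, H s = coef v w s) -> transforms_left (- (d + 4 * k)%:Z) H ->
  exists c, forall s, H s = coef v (fun z => c * fk k d z) s.
Proof.
move=> Lv Kw Hv tH; have [n [e orb]] := K_finite_orbit Kw.
have [hw Lw] := pi_space Kw.1.
have [||c [_ hc]] := @weight_projection R d k n e w
  (fun u => L2 d u /\ forall s, H s = coef v u s) hw orb (conj Lw Hv).
- move=> t u [Lu hu]; have Lo : L2 d (op d (kappa t) u) := L2_op (kappa t) Lu.
  split; first exact: L2_Z.
  move=> s; have Ls := L2_op s^-1%g Lv.
  have -> : coef v (twist d k t u) s = expi (- ((d + 4 * k)%:R / 2 * t)) * coef v (op d (kappa t) u) s.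
    by rewrite expiN; exact: (@dotZr R l (expi ((d + 4 * k)%:R / 2 * t)) _ _ Ls Lo).
  rewrite -(coef_left s t Lv.1 Lu.1).
  by rewrite -hu tH chi_opp mulrA -expiD addNr expi0 mul1r.
- move=> u u' [Lu hu] [Lu' hu']; split; first by apply: L2_D; exact: L2_Z.
  move=> s; have Ls := L2_op s^-1%g Lv; rewrite /coef.
  have h2 : (2^-1)^*%C = 2^-1 :> R[i] by rewrite fmorphV rmorph_nat.
  apply: esym; refine (etrans (dotDr Ls (L2_Z 2^-1 Lu) (L2_Z 2^-1 Lu')) _).
  refine (etrans (congr2 +%R (dotZr 2^-1 Ls Lu) (dotZr 2^-1 Ls Lu')) _).
  have e1 := hu s; have e2 := hu' s; rewrite /coef in e1 e2; rewrite h2 -e1 -e2.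
  by field.
by exists c.
Qed.

(** By unitarity [<pi(s) f_j, f_k>] is the conjugate of [<pi(s^-1) f_k, f_j>], which [dot_op_fk]
    evaluates. *)
Lemma coef_fk a b j k s : coef (fun z => a * fk j d z) (fun z => b * fk k d z) s =
  (a * b^*%C * (dot d (fk j d) (fk j d))^*%C) * (bcf k d j s)^*%C.
Proof.
have Lj := @L2_fk R j l; have Lk := @L2_fk R k l.
rewrite /coef; have -> : op d s^-1%g (fun z => a * fk j d z) = (fun z => a * op d s^-1%g (fk j d) z).
  by apply/funext => z; rewrite /op mulrA.
have Lo := L2_op s^-1%g Lj.
rewrite (dotZl a Lo (L2_Z b Lk)) (dotZr b Lo Lk).
rewrite -(dot_op d s Lo.1 Lk.1) -op_mul mulVg op1 dot_sym dot_op_fk.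
rewrite (rmorphM (@conjc R)) -!mulrA; congr (_ * (_ * _)); exact: mulrC.
Qed.

(** Existence: the function is [<pi(s) v, f_k>] with [v = (j! / N) f_j], the scalar cancelling the
    conjugated squared norm [N]. Uniqueness: projecting both vectors reduces any competitor to
    multiples of [f_j] and [f_k]. *)
Lemma pi_coefficients j k : unique_up_to_scalar
  (fun H => [/\ K_finite_coef (pi_rep R d) H, transforms_right (- (d + 4 * j)%:Z) H &
                transforms_left (- (d + 4 * k)%:Z) H])
  (fun s => (j`!%:R * bcf k d j s)^*%C).
Proof.
have Lj := @L2_fk R j l; have Lk := @L2_fk R k l.
pose N := (dot d (fk j d) (fk j d))^*%C.
have N0 : N != 0 by rewrite fmorph_eq0 dot_fk_neq0.
have f0 : j`!%:R != 0 :> R[i] by rewrite pnatr_eq0 -lt0n fact_gt0.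
have cfM (b : R[i]) : (j`!%:R * b)^*%C = j`!%:R * b^*%C.
  by apply: etrans (rmorphM (@conjc R) _ _) _; congr (_ * _); exact: rmorph_nat.
have GE s : (j`!%:R * bcf k d j s)^*%C = coef (fun z => j`!%:R / N * fk j d z) (fun z => 1 * fk k d z) s.
  by rewrite coef_fk -/N conjc1 mulr1 divfK // cfM.
split.
- split.
  + exists (fun z => j`!%:R / N * fk j d z), (fun z => 1 * fk k d z).
    by split; [exact: K_finite_fk|exact: K_finite_fk|exact: GE].
  + move=> t s; rewrite !GE coef_right chi_opp /coef -dotZl; last 2 first.
      exact: L2_op (L2_Z _ Lj).
      exact: L2_Z.
    refine (congr1 (fun F => dot d F _) _); apply/funext => z.
    have := @op_kappa_fk R l (- t) j; rewrite mulrN opprK => h.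
    have := congr1 (fun F => F (mp_act s^-1%g z)) h; rewrite /op /= => h1.
    rewrite -[X in X * _]mulrA h1; ring.
  + move=> t s; rewrite !GE coef_left; [|exact: (L2_Z _ Lj).1|exact: (L2_Z _ Lk).1].
    rewrite chi_opp.
    have -> : op d (kappa t) (fun z => 1 * fk k d z) = (fun z => expi (- ((d + 4 * k)%:R / 2 * t)) * (1 * fk k d z)).
      apply/funext => z; have := congr1 (@^~ z) (@op_kappa_fk R l t k); rewrite /op /= => h1.
      by rewrite !mul1r h1.
    rewrite /coef dotZr; [|exact: L2_op (L2_Z _ Lj)|exact: L2_Z].
    by rewrite -expiN opprK.
- have [s hs] := @bcf_neq0 R k d j (ltn_addl _ (ltn0Sn 2)); exists s.
  by rewrite fmorph_eq0 mulf_neq0.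
- move=> H [[v [w [Kv Kw Hvw]]] tr tl].
  have [_ Lw] := pi_space Kw.1.
  have [c hc] := project_right Kv Lw Hvw tr.
  have [c' hc'] := project_left (L2_Z c Lj) Kw hc tl.
  exists (c * c'^*%C * N / j`!%:R) => s.
  by rewrite hc' coef_fk -/N cfM [RHS]mulrA divfK.
Qed.

Lemma conjcM (a b : R[i]) : (a * b)^*%C = a^*%C * b^*%C.
Proof. exact: (rmorphM (@conjc R)). Qed.

Definition cj u z : R[i] := (u z)^*%C.

Lemma cjK u : cj (cj u) = u.
Proof. by apply/funext => z; rewrite /cj conjcK. Qed.

Lemma rep_space_cj u : rep_space (pi_bar_rep R d) u <-> rep_space (pi_rep R d) (cj u).
Proof.
have E : nrm2 d (cj u) = nrm2 d u.
  by apply/funext => z; rewrite /nrm2 /cj normC_conj.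
have sq : sq_integrable d (cj u) = sq_integrable d u := congr1 (fun f => (dv_int f < +oo)%E : Prop) E.
split=> -[hu su]; refine (conj hu _).
  exact: (eq_ind_r id su sq).
exact: (eq_ind _ id su _ sq).
Qed.

(** Conjugation [cj] intertwines the antiholomorphic representation with the holomorphic one. It
    conjugates matrix coefficients and negates weights, so every notion used for [pi_bar_rep]
    translates to [pi_rep]. *)
Lemma rep_op_cj s u : rep_op (pi_bar_rep R d) s u = cj (rep_op (pi_rep R d) s (cj u)).
Proof.
apply/funext => z; rewrite /cj /= conjcM conjcK; congr (_ * _).
by apply: esym; apply: etrans (fmorphV (@conjc R) _) _; congr (_^-1); exact: (rmorphXn (@conjc R)).
Qed.

Lemma K_finite_cj u : K_finite (pi_bar_rep R d) u <-> K_finite (pi_rep R d) (cj u).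
Proof.
split=> -[su [n [e [he h]]]].
  split; first exact: (rep_space_cj u).1 su.
  exists n, (fun i => cj (e i)); split; first by move=> i; exact: (rep_space_cj (e i)).1 (he i).
  move=> t; have [a ha] := h t; exists (fun i => (a i)^*%C) => z.
  apply: (can_inj (@conjcK R)); have := ha z; rewrite rep_op_cj {1}/cj => ->.
  apply: esym; apply: etrans (raddf_sum (@conjc R) _ _ _) _; apply: eq_bigr => i _.
  by apply: etrans (conjcM _ _) _; rewrite !conjcK.
split; first exact: (rep_space_cj u).2 su.
exists n, (fun i => cj (e i)); split.
  by move=> i; apply: (rep_space_cj (cj (e i))).2; rewrite cjK; exact: he.
move=> t; have [a ha] := h t; exists (fun i => (a i)^*%C) => z.
rewrite rep_op_cj {1}/cj ha.
by apply: etrans (raddf_sum (@conjc R) _ _ _) _; apply: eq_bigr => i _; exact: conjcM.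
Qed.

Lemma K_finite_coef_cj H : K_finite_coef (pi_bar_rep R d) H <->
  K_finite_coef (pi_rep R d) (fun s => (H s)^*%C).
Proof.
split=> -[v [w [Kv Kw h]]]; exists (cj v), (cj w).
  split; [exact: (K_finite_cj v).1 Kv|exact: (K_finite_cj w).1 Kw|move=> s].
  rewrite h rep_op_cj -[RHS]conjcK; congr (_^*%C).
  apply: etrans (@dot_conj R d _ _); refine (congr1 (fun F => dot d _ F) _).
  by apply: esym; exact: cjK.
split; [by apply: (K_finite_cj (cj v)).2; rewrite cjK|by apply: (K_finite_cj (cj w)).2; rewrite cjK|move=> s].
by rewrite -[LHS]conjcK h rep_op_cj cjK; apply: esym; exact: dot_conj.
Qed.

Lemma chi_conj (n : int) t : (chi n t)^*%C = chi (- n) t :> R[i].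
Proof. by rewrite /chi -expiN rmorphN /= !mulNr. Qed.

Lemma transforms_right_cj (n : int) H : transforms_right n H <-> transforms_right (- n) (fun s => (H s)^*%C).
Proof.
split=> h t s; first by rewrite h conjcM chi_conj.
by apply: (can_inj (@conjcK R)); rewrite h conjcM chi_conj.
Qed.

Lemma transforms_left_cj (n : int) H : transforms_left n H <-> transforms_left (- n) (fun s => (H s)^*%C).
Proof.
split=> h t s; first by rewrite h conjcM chi_conj.
by apply: (can_inj (@conjcK R)); rewrite h conjcM chi_conj.
Qed.

End MatrixCoefficients.

(* The weight [m = l + 3/2] is represented by [d = 2 m]. *)
Theorem corollary4p8 (R : realType) (l j k : nat) :
  let d := (2 * l + 3)%N in
  let F : Mp R -> R[i] := iter j (lie (nplus R)) (Fkm k d) in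
  let G : Mp R -> R[i] :=
    iter j (lie (nminus R)) (fun s => (Fkm k d s)^*%C) in
  [/\ unique_up_to_scalar
        (fun H => [/\ K_finite_coef (pi_bar_rep R d) H,
                      transforms_right (d + 4 * j)%:Z H &
                      transforms_left (d + 4 * k)%:Z H]) F,
      forall s, (F s)^*%C = G s &
      unique_up_to_scalar
        (fun H => [/\ K_finite_coef (pi_rep R d) H,
                      transforms_right (- (d + 4 * j)%:Z) H &
                      transforms_left (- (d + 4 * k)%:Z) H]) G].
Proof.
move=> d F G.
have FE : F = (fun s => j`!%:R * bcf k d j s) by exact: iter_lie_nplus.
have GE : G = (fun s => (F s)^*%C).
  by rewrite FE; exact: iter_lie_nminus.
have P := @pi_coefficients R l j k.
have EG : (fun s => (j`!%:R * bcf k d j s)^*%C) = G by rewrite GE FE.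
rewrite EG in P; split; [|by move=> s; rewrite GE|exact: P].
(* The statement for [pi_bar_rep] is that for [pi_rep] conjugated; the scalar of uniqueness is
   conjugated as well. *)
have [[Kf Rf Lf] [s0 nz] un] := P; rewrite GE in Kf Rf Lf.
split.
- split; first exact: (K_finite_coef_cj l F).2 Kf.
    exact: (transforms_right_cj _ F).2 Rf.
  exact: (transforms_left_cj _ F).2 Lf.
- by exists s0; apply: contraNneq nz => F0; rewrite GE F0 conjc0.
- move=> H [/K_finite_coef_cj KH /transforms_right_cj RH /transforms_left_cj LH].
  have [a ha] := un _ (And3 KH RH LH); exists a^*%C => s.
  by apply: (can_inj (@conjcK R)); rewrite ha GE conjcM conjcK.
Qed.
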